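(* For a (Zariski) general quartic $V\subset\mathbb{P}^4$ of the second type, the number $L(o_2)$ of lines on $V$ passing through the point $o_2$ is equal to $24$.
   Context: The ground field is $\mathbb{C}$. Let $\mathbb{A}^4\subset\mathbb{P}^4$ be an affine chart with coordinates $(z_1,z_2,z_3,z_4)$, $o_1=(0,0,0,0)$, and $f=q_2+q_3+q_4$ with $q_i$ homogeneous of degree $i$, $q_2=z_1^2+z_2^2+z_3^2$, such that $q_2,q_3,q_4$ have exactly 24 distinct common zeros in $\mathbb{P}^3_{(z_1:z_2:z_3:z_4)}$. The hypersurface $V=\{f=0\}\subset\mathbb{P}^4$ (projective closure) is a quartic of the second type if $q_3(0,0,0,1)\neq0$, $\mathop{\rm Sing}V=\{o_1,o_2\}$ with $o_2\neq o_1$ a non-degenerate quadratic singularity (rank 4), and the line $[o_1,o_2]$ is not contained in $V$. Here $o_1$ is a quadratic singularity of rank 3. *)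

(* Defs.v *)
From HB Require Import structures.
From mathcomp Require Import all_boot all_order all_algebra.
From mathcomp Require Import reals complex mpoly.

Set Implicit Arguments.
Unset Strict Implicit.
Unset Printing Implicit Defensive.

Import GRing.Theory.
Local Open Scope ring_scope.

Definition has_exactly (T : eqType) (n : nat) (P : T -> Prop) : Prop :=
  exists s : seq T, [/\ uniq s, size s = n & forall x, x \in s <-> P x].

Section Projective.
Variable K : fieldType.

(* The projective subspaces of dimension k of P^n are the subspaces of
   dimension k.+1 of K^n.+1. *)
Definition proj_point n (p : {vspace 'rV[K]_n.+1}) : Prop := \dim p = 1%N.

Definition proj_line n (L : {vspace 'rV[K]_n.+1}) : Prop := \dim L = 2%N.

(* For F homogeneous: the projective subspace U lies on {F = 0}. *)
Definition lies_on n (F : {mpoly K[n.+1]}) (U : {vspace 'rV[K]_n.+1}) : Prop :=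
  forall v, v \in U -> F.@[v 0] = 0.

Definition singular_at n (F : {mpoly K[n.+1]}) (p : {vspace 'rV[K]_n.+1}) :=
  lies_on F p /\ forall i, lies_on F^`M(i) p.

(* The Hessian matrix at v of F in the variables other than the i-th one.  When
   v i <> 0 it is, up to a nonzero factor, the matrix of the quadratic part of
   the equation of {F = 0} at the point (v) in the affine chart {x_i <> 0}. *)
Definition chart_hessian n (F : {mpoly K[n.+1]}) (i : 'I_n.+1)
    (v : 'rV[K]_n.+1) : 'M[K]_n :=
  \matrix_(j, k) (F^`M(lift i j)^`M(lift i k)).@[v 0].

Definition quadratic_singularity n (F : {mpoly K[n.+1]})
    (p : {vspace 'rV[K]_n.+1}) (r : nat) : Prop :=
  singular_at F p /\
  forall v i, v \in p -> v 0 i != 0 -> \rank (chart_hessian F i v) = r.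

Definition lines_through n (F : {mpoly K[n.+1]}) (p L : {vspace 'rV[K]_n.+1}) :=
  [/\ proj_line L, (p <= L)%VS & lies_on F L].

End Projective.

Section SecondType.
Variable K : fieldType.

(* In {mpoly K[4]} the variable 'X_i is z_(i+1).  In {mpoly K[5]} 'X_0 is the
   equation of the hyperplane at infinity, and 'X_(lift ord0 i) is the
   homogeneous coordinate z_(i+1). *)
Definition z_vars : 4.-tuple {mpoly K[5]} := [tuple 'X_(lift ord0 i) | i < 4].

(* The homogenization in degree 4 of f, for f of degree at most 4. *)
Definition projective_closure (f : {mpoly K[4]}) : {mpoly K[5]} :=
  \sum_(d < 5) 'X_ord0 ^+ (4 - d) * (pihomog mdeg d f \mPo z_vars).

Definition q2 : {mpoly K[4]} := \sum_(i < 4 | (i < 3)%N) 'X_i ^+ 2.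

Definition o1 : {vspace 'rV[K]_5} := <[delta_mx (0 : 'I_1)%R ord0]>%VS.

Definition second_type (f : {mpoly K[4]}) (o2 : {vspace 'rV[K]_5}) : Prop :=
  let V := projective_closure f in
  (exists q3 q4 : {mpoly K[4]},
     [/\ q3 \is 3.-homog /\ q4 \is 4.-homog,
         f = q2 + q3 + q4,
         has_exactly 24 (fun p : {vspace 'rV[K]_4} =>
           [/\ proj_point p, lies_on q2 p, lies_on q3 p & lies_on q4 p]) &
         q3.@[fun i => (i == ord_max)%:R] != 0]) /\
  [/\ proj_point o2 /\ o2 != o1,
      forall p, proj_point p -> (singular_at V p <-> p = o1 \/ p = o2),
      quadratic_singularity V o1 3,
      quadratic_singularity V o2 4 &
      ~ lies_on V (o1 + o2)%VS].

(* The affine space of polynomials of degree at most 4 in z_1, ..., z_4, with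
   the coefficients as coordinates. *)
Definition coefs (f : {mpoly K[4]}) (i : 'I_#|{: 'X_{1..4 < 5}}|) : K :=
  f@_(enum_val i).

Definition zariski_open (U : {mpoly K[4]} -> Prop) : Prop :=
  exists S : {mpoly K[#|{: 'X_{1..4 < 5}}|]} -> Prop,
    forall f, U f <-> exists2 P, S P & P.@[coefs f] != 0.

(* Q holds on a nonempty dense open subset of T, T carrying the topology
   induced by the Zariski topology. *)
Definition for_general (T Q : {mpoly K[4]} -> Prop) : Prop :=
  exists U : {mpoly K[4]} -> Prop,
    [/\ zariski_open U,
        exists f, T f /\ U f,
        forall W, zariski_open W -> (exists f, T f /\ W f) ->
          exists f, [/\ T f, U f & W f] &
        forall f, T f -> U f -> Q f].

End SecondType.

(* Main.v *)
Require Import Defs.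
From HB Require Import structures.
From mathcomp Require Import all_boot all_order all_algebra.
From mathcomp Require Import perm closed_field separable cyclotomic boolp.
From mathcomp Require Import reals complex mpoly zify ring.

(* The lines on V through the node o2 are the common zeros in P^3 of the coefficients
   Q2, Q3, Q4 of an equation z1^2 Q2 + z1 Q3 + Q4 of V in coordinates where
   o2 = (0 : 1 : 0 : 0 : 0), so 24 = 2 * 3 * 4 is expected.  Every quartic of the second
   type is linearly equivalent to
     x0^2 (z1^2 + y1 y2) + x0 q3 + q4
   with Q2 = (x0 + u)(x0 + v) + w t for linear forms u, v, w, t in y, all the other
   coefficients being free parameters; this family is irreducible, so each required
   property has only to hold somewhere and to be open.  The quadric Q2 = 0, a smooth one
   (P^1 x P^1), and the cone q2 = 0 (resolved by the Hirzebruch surface F_2) are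
   parametrized, and the common zeros of two forms on such a surface are the roots of a
   Sylvester determinant of degree 24; it is separable for an explicit quartic, hence for
   a general one.  The quartics with a third singular point depend on fewer parameters
   than the whole family, hence satisfy a polynomial relation.  Finally, by Chevalley's
   theorem the linear transforms of the general members of the family contain an open
   subset of the family of all transforms. *)

Set Implicit Arguments.
Unset Strict Implicit.
Unset Printing Implicit Defensive.

Import GRing.Theory Num.Theory.
Local Open Scope ring_scope.

(** * Polynomial functions and dominant maps *)

Section PolyFun.
Variable K : fieldType.

(** The obstacle is that an inequation in the parameters of the normal form says nothing directly
    about an open set of polynomials f: the normal form depends on a choice of coordinates moving
    o2, and the admissible changes range over isometries of a quadratic form, not over an affine
    space. Chevalley's theorem is applied to parameters and matrix together, so that it returns an
    inequation on the coefficients of the transformed quartic. Taking the union over all invertible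
    matrices makes this condition invariant, hence meaningful for f itself. Density is then tested
    one chart at a time, where only the parameters of the normal form vary and irreducibility of an
    affine space is enough. Sing V = {o1, o2} is not verified on an example, which would mean
    solving a system of partial derivatives. Instead, a singular point off the line o1 o2 has four
    affine coordinates but determines five coefficients of the quartic linearly, and this deficit of
    one is what produces the polynomial relation. *)

Inductive polyfun (I : Type) : ((I -> K) -> K) -> Prop :=
| polyfun_var i : polyfun (fun v => v i)
| polyfun_const c : polyfun (fun _ => c)
| polyfunD f g : polyfun f -> polyfun g -> polyfun (fun v => f v + g v)
| polyfunM f g : polyfun f -> polyfun g -> polyfun (fun v => f v * g v)
| polyfun_ext f g : f =1 g -> polyfun f -> polyfun g.

Variable I : Type.
Implicit Types f g : (I -> K) -> K.

Lemma polyfunN f : polyfun f -> polyfun (fun v => - f v).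
Proof.
move=> Pf; apply: (@polyfun_ext _ (fun v => -1 * f v)).
  by move=> v; rewrite mulN1r.
exact: polyfunM (polyfun_const _ _) Pf.
Qed.

Lemma polyfunB f g : polyfun f -> polyfun g -> polyfun (fun v => f v - g v).
Proof. by move=> Pf Pg; apply: polyfunD Pf (polyfunN Pg). Qed.

Lemma polyfunX f n : polyfun f -> polyfun (fun v => f v ^+ n).
Proof.
move=> Pf; elim: n => [|n IHn]; first exact: polyfun_const.
apply: (@polyfun_ext _ (fun v => f v * f v ^+ n)); first by move=> v; rewrite exprS.
exact: polyfunM.
Qed.

Lemma polyfun_sum (T : Type) (r : seq T) (P : pred T) (F : T -> (I -> K) -> K) :
  (forall x, P x -> polyfun (F x)) -> polyfun (fun v => \sum_(x <- r | P x) F x v).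
Proof.
move=> PF; elim: r => [|x r IHr].
  by apply: polyfun_ext (polyfun_const _ 0) => v; rewrite big_nil.
have [Px|nPx] := boolP (P x).
  by apply: polyfun_ext (polyfunD (PF _ Px) IHr) => v; rewrite big_cons Px.
by apply: polyfun_ext IHr => v; rewrite big_cons (negPf nPx).
Qed.

Lemma polyfun_prod (T : Type) (r : seq T) (P : pred T) (F : T -> (I -> K) -> K) :
  (forall x, P x -> polyfun (F x)) -> polyfun (fun v => \prod_(x <- r | P x) F x v).
Proof.
move=> PF; elim: r => [|x r IHr].
  by apply: polyfun_ext (polyfun_const _ 1) => v; rewrite big_nil.
have [Px|nPx] := boolP (P x).
  by apply: polyfun_ext (polyfunM (PF _ Px) IHr) => v; rewrite big_cons Px.
by apply: polyfun_ext IHr => v; rewrite big_cons (negPf nPx).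
Qed.

Lemma polyfun_det n (F : (I -> K) -> 'M[K]_n) :
  (forall i j, polyfun (fun v => F v i j)) -> polyfun (fun v => \det (F v)).
Proof.
move=> PF; apply: polyfun_sum => s _; apply: polyfunM; first exact: polyfun_const.
by apply: polyfun_prod.
Qed.

Lemma polyfun_comp (J : Type) (f : (I -> K) -> K) (F : I -> (J -> K) -> K) :
  polyfun f -> (forall i, polyfun (F i)) -> polyfun (fun w => f (F^~ w)).
Proof.
move=> Pf PF; elim: Pf => [//|c|g h _ IHg _ IHh|g h _ IHg _ IHh|g h eqgh _ IHg].
- exact: polyfun_const.
- exact: polyfunD.
- exact: polyfunM.
by apply: polyfun_ext IHg => w; apply: eqgh.
Qed.

(** Restriction to the line from v to w reduces irreducibility of the affine space to the existence
    of a nonroot of a nonzero univariate polynomial. *)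
Lemma polyfun_line f (v w : I -> K) :
  polyfun f -> exists p : {poly K}, forall t, f (fun i => v i + t * (w i - v i)) = p.[t].
Proof.
elim=> [i|c|{}f g _ [p fp] _ [q gq]|{}f g _ [p fp] _ [q gq]|{}f g eqfg _ [p fp]].
- by exists ((v i)%:P + (w i - v i) *: 'X) => t; rewrite !hornerE mulrC.
- by exists c%:P => t; rewrite hornerC.
- by exists (p + q) => t; rewrite hornerD fp gq.
- by exists (p * q) => t; rewrite hornerM fp gq.
by exists p => t; rewrite -eqfg.
Qed.

Lemma polyfun_eq f v w : polyfun f -> v =1 w -> f v = f w.
Proof.
by move=> Pf eqvw; elim: Pf => //= [g h _ -> _ ->|g h _ -> _ ->|g h eqgh _]; rewrite -?eqgh.
Qed.

End PolyFun.

(* The affine space K^I is irreducible. *)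
Lemma polyfun_irreducible (K : closedFieldType) (I : Type) (f g : (I -> K) -> K)
    (v w : I -> K) :
  polyfun f -> polyfun g -> f v != 0 -> g w != 0 -> exists u, f u != 0 /\ g u != 0.
Proof.
move=> Pf Pg fv gw.
have [p fp] := polyfun_line v w Pf; have [q gq] := polyfun_line v w Pg.
have pn0 : p != 0.
  apply: contraNneq fv => p0; have := fp 0; rewrite p0 horner0 => <-; apply/eqP.
  by apply: polyfun_eq => // i; rewrite mul0r addr0.
have qn0 : q != 0.
  apply: contraNneq gw => q0; have := gq 1; rewrite q0 horner0 => <-; apply/eqP.
  by apply: polyfun_eq => // i; rewrite mul1r addrC subrK.
have /closed_nonrootP[t] : p * q != 0 by rewrite mulf_neq0.
rewrite rootM negb_or => /andP[pt qt].
by exists (fun i => v i + t * (w i - v i)); rewrite fp gq.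
Qed.

(** * Images of polynomial maps between affine spaces *)

Section Chevalley.
Variables (K : closedFieldType) (I J : finType).
Local Notation env c := [seq c j | j <- enum J].

Let nth_env (c : J -> K) (j : J) : (env c)`_(enum_rank j) = c j.
Proof. by rewrite (nth_map j) ?nth_enum_rank // -cardE ltn_ord. Qed.

Lemma polyfun_term (T : Type) (ix : T -> nat) (f : (T -> K) -> K) :
  polyfun f -> exists t : GRing.term K,
    GRing.rterm t /\ forall e, GRing.eval e t = f (fun i => e`_(ix i)).
Proof.
elim=> [i|c|{}f g _ [t [rt et]] _ [u [ru eu]]|{}f g _ [t [rt et]] _ [u [ru eu]]
        |{}f g eqfg _ [t [rt et]]].
- by exists (GRing.Var _ (ix i)).
- by exists (GRing.Const c).
- by exists (GRing.Add t u); split=> [|e] /=; rewrite ?rt ?et ?eu.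
- by exists (GRing.Mul t u); split=> [|e] /=; rewrite ?rt ?et ?eu.
by exists t; split=> // e; rewrite et eqfg.
Qed.

Lemma term_polyfun (t : GRing.term K) :
  GRing.rterm t -> polyfun (fun c : J -> K => GRing.eval (env c) t).
Proof.
elim: t => //= [n _|c _|n _|t IHt u IHu|t IHt|t IHt n|t IHt u IHu|t IHt n].
- have [ltn|len] := ltnP n #|J|.
    pose j := enum_val (Ordinal ltn).
    apply: polyfun_ext (polyfun_var K j) => c.
    by rewrite -(nth_env c j) /j enum_valK.
  (* Variables beyond the environment read the default value 0. *)
  apply: polyfun_ext (polyfun_const _ 0) => c.
  by rewrite nth_default // size_map -cardE.
- exact: polyfun_const.
- exact: polyfun_const.
- by case/andP=> /IHt ? /IHu ?; apply: polyfunD.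
- by move/IHt => ?; apply: polyfunN.
- move/IHt => Pt; elim: n => [|n IHn].
    by apply: polyfun_ext (polyfun_const _ 0) => c; rewrite mulr0n.
  by apply: polyfun_ext (polyfunD Pt IHn) => c; rewrite mulrS.
- by case/andP=> /IHt ? /IHu ?; apply: polyfunM.
by move/IHt => ?; apply: polyfunX.
Qed.

Variables (Psi : J -> (I -> K) -> K) (D : (I -> K) -> K).
Hypotheses (polyPsi : forall j, polyfun (Psi j)) (polyD : polyfun D).

(** An atom t = u either holds all along the image of [Psi] or fails wherever the pullback of t - u
    is nonzero. For a binary connective the two witnesses are multiplied, and irreducibility of the
    source keeps the product nonzero. *)
Let genericly_constant (th : GRing.formula K) :
  GRing.qf_form th -> GRing.rformula th ->
  exists (P : (J -> K) -> K) (b : bool),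
    [/\ polyfun P, exists y, P (Psi^~ y) != 0 &
        forall y, P (Psi^~ y) != 0 -> GRing.qf_eval (env (Psi^~ y)) th = b].
Proof.
have one : exists y : I -> K, (fun _ : J -> K => 1) (Psi^~ y) != 0 :> K.
  by exists (fun _ => 0); rewrite oner_neq0.
have both (P Q : (J -> K) -> K) : polyfun P -> polyfun Q ->
    (exists y, P (Psi^~ y) != 0) -> (exists y, Q (Psi^~ y) != 0) ->
    exists y, P (Psi^~ y) * Q (Psi^~ y) != 0.
  move=> PP PQ [y Py] [z Qz].
  have [u [Pu Qu]] := polyfun_irreducible (polyfun_comp PP polyPsi)
    (polyfun_comp PQ polyPsi) Py Qz.
  by exists u; rewrite mulf_neq0.
have bin (op : bool -> bool -> bool) (f1 f2 : GRing.formula K) :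
    (exists (P : (J -> K) -> K) (b : bool),
    [/\ polyfun P, exists y, P (Psi^~ y) != 0 &
        forall y, P (Psi^~ y) != 0 -> GRing.qf_eval (env (Psi^~ y)) f1 = b]) ->
    (exists (P : (J -> K) -> K) (b : bool),
    [/\ polyfun P, exists y, P (Psi^~ y) != 0 &
        forall y, P (Psi^~ y) != 0 -> GRing.qf_eval (env (Psi^~ y)) f2 = b]) ->
    exists (P : (J -> K) -> K) (b : bool),
    [/\ polyfun P, exists y, P (Psi^~ y) != 0 &
        forall y, P (Psi^~ y) != 0 ->
          op (GRing.qf_eval (env (Psi^~ y)) f1) (GRing.qf_eval (env (Psi^~ y)) f2) = b].
  move=> [P [b [PP nzP eP]]] [Q [c [PQ nzQ eQ]]].
  exists (fun v => P v * Q v), (op b c); split; [exact: polyfunM|exact: both|].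
  by move=> y; rewrite mulf_eq0 negb_or => /andP[/eP -> /eQ ->].
elim: th => //=.
- move=> b _ _; exists (fun _ => 1), b; split=> //; exact: polyfun_const.
- move=> t u _ /andP[rt ru].
  pose P := fun c : J -> K => GRing.eval (env c) t - GRing.eval (env c) u.
  have PP : polyfun P by apply: polyfunB; apply: term_polyfun.
  have [[y Py]|nex] := boolp.pselect (exists y, P (Psi^~ y) != 0).
    exists P, false; split=> //; first by exists y.
    by move=> z; rewrite subr_eq0 => /negPf.
  exists (fun _ => 1), true; split=> //; first exact: polyfun_const.
  by move=> y _; rewrite -subr_eq0; apply: contra_notT nex => ?; exists y.
- by move=> f1 IH1 f2 IH2 /andP[q1 q2] /andP[r1 r2]; apply: (bin andb); auto.
- by move=> f1 IH1 f2 IH2 /andP[q1 q2] /andP[r1 r2]; apply: (bin orb); auto.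
- by move=> f1 IH1 f2 IH2 /andP[q1 q2] /andP[r1 r2]; apply: (bin implb); auto.
move=> f1 IH1 q1 r1; have [P [b [PP nzP eP]]] := IH1 q1 r1.
by exists P, (~~ b); split=> // y /eP ->.
Qed.

(* Quantifier elimination makes the image of {D <> 0} constructible, and a
   quantifier-free formula has a constant truth value on a nonempty open subset
   of an irreducible set. *)
Theorem chevalley : (exists y, D y != 0) ->
  exists P : (J -> K) -> K, [/\ polyfun P, exists y, P (Psi^~ y) != 0 &
    forall y, P (Psi^~ y) != 0 -> exists2 z, D z != 0 & Psi^~ z =1 Psi^~ y].
Proof.
case=> y0 Dy0.
(* Slots below #|J| of the environment hold the point of the target, the later ones the point of the
   source that is quantified away. *)
pose ix (i : I) : nat := #|J| + enum_rank i.
have [tD [rtD etD]] := polyfun_term ix polyD.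
have [f [rf ef]] : exists f : GRing.formula K, GRing.rformula f /\
    forall e, GRing.holds e f <->
      forall j, j \in enum J -> Psi j (fun i => e`_(ix i)) = e`_(enum_rank j).
  elim: (enum J) => [|j s [f [rf ef]]]; first by exists (GRing.Bool true).
  have [t [rt et]] := polyfun_term ix (polyPsi j).
  exists (GRing.And (GRing.Equal t (GRing.Var _ (enum_rank j))) f).
  split=> [|e] /=; first by rewrite rt rf.
  rewrite et; split=> [[eqj /ef eqs] k|eqs].
    by rewrite in_cons => /predU1P[->|/eqs].
  by split; [|apply/ef => k ks]; apply: eqs; rewrite in_cons ?eqxx ?ks ?orbT.
pose g := foldr GRing.Exists (GRing.And f (GRing.Not (GRing.Equal tD (GRing.Const 0))))
  (iota #|J| #|I|).
have rg : GRing.rformula g.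
  rewrite /g; elim: (iota _ _) => //=; by rewrite rf rtD.
have holdsg (c : J -> K) : GRing.holds (env c) g <-> exists2 z, D z != 0 & Psi^~ z =1 c.
  split.
    case/GRing.foldExistsP=> e eqe /= [/ef ef' nD].
    have {}eqe j : e`_(enum_rank j) = c j.
      rewrite -nth_env -eqe // !inE mem_iota negb_and -ltnNge.
      by rewrite ltn_ord.
    exists (fun i => e`_(ix i)); first by rewrite -etD; apply/eqP.
    by move=> j; rewrite ef' ?mem_enum.
  case=> z Dz eqz; apply/GRing.foldExistsP.
  have nthe i : (env c ++ [seq z i | i <- enum I])`_(ix i) = z i.
    rewrite nth_cat size_map -cardE ltnNge leq_addr /= addKn.
    by rewrite (nth_map i) ?nth_enum_rank // -cardE ltn_ord.
  exists (env c ++ [seq z i | i <- enum I]).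
    move=> k; rewrite !inE mem_iota negb_and -ltnNge -leqNgt nth_cat size_map -cardE.
    case: ltnP => //= gek /= ltk; rewrite !nth_default // size_map -cardE //.
    by rewrite leq_subRL.
  split=> /=.
    apply/ef => j _; rewrite (polyfun_eq (polyPsi j) nthe) eqz.
    by rewrite nth_cat size_map -cardE ltn_ord nth_env.
  by rewrite etD (polyfun_eq polyD nthe); apply/eqP.
pose wf := @ClosedFieldQE.wf_ex_elim K.
pose hold := @ClosedFieldQE.holds_ex_elim K (@solve_monicpoly K).
have /andP[qq rq] := GRing.quantifier_elim_wf wf rg.
have eq_eval e := GRing.quantifier_elim_rformP wf hold e rg.
have [P [b [PP nzP eP]]] := genericly_constant qq rq.
exists P; split=> //.
have [y Py] := nzP.
have [u [Pu Du]] := polyfun_irreducible (polyfun_comp PP polyPsi) polyD Py Dy0.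
(* The constant truth value is read off at a point where both [P] and [D] are nonzero; there the
   formula holds, the point being its own preimage. *)
have bT : b = true.
  by rewrite -(eP u Pu); apply/eq_eval/holdsg; exists u.
by move=> z /eP; rewrite bT => /eq_eval/holdsg.
Qed.

End Chevalley.

(** Reduction modulo d recovers the digits one by one. This keeps the monomials of a polynomial
    distinct under Kronecker substitution. *)
Lemma base_expansion_inj d n (a b : 'I_n -> nat) :
  (forall i, a i < d)%N -> (forall i, b i < d)%N ->
  (\sum_(i < n) a i * d ^ i = \sum_(i < n) b i * d ^ i)%N -> a =1 b.
Proof.
elim: n a b => [|n IHn] a b lta ltb; first by move=> _ [].
have shift (c : 'I_n.+1 -> nat) :
  (\sum_(i < n.+1) c i * d ^ i = (\sum_(i < n) c (lift ord0 i) * d ^ i) * d + c ord0)%N.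
  rewrite big_ord_recl expn0 muln1 addnC big_distrl /=; congr (_ + _)%N.
  by apply: eq_bigr => i _; rewrite /bump /= add1n expnSr mulnA.
have d_gt0 : (0 < d)%N := leq_ltn_trans (leq0n _) (lta ord0).
rewrite !shift => eqab.
have eq0 : a ord0 = b ord0.
  by have := congr1 (modn^~ d) eqab; rewrite !modnMDl !modn_small.
move: eqab; rewrite eq0 => /eqP; rewrite eqn_add2r eqn_pmul2r // => /eqP eqab i.
have [j ->|->//] := unliftP ord0 i.
by apply: (IHn (a \o lift ord0) (b \o lift ord0)) => //= k; rewrite ?lta ?ltb.
Qed.

(* Kronecker substitution x_i = t^(d^i), d exceeding all exponents of p. *)
Lemma meval_neq0 (K : closedFieldType) n (p : {mpoly K[n]}) :
  p != 0 -> exists v, p.@[v] != 0.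
Proof.
move=> pn0.
have : msupp p != [::] by rewrite msupp_eq0.
case def_s: (msupp p) => [//|m0 s] _.
have m0p : m0 \in msupp p by rewrite def_s mem_head.
pose d := msize p; pose phi (m : 'X_{1..n}) := (\sum_(i < n) m i * d ^ i)%N.
have ltd m : m \in msupp p -> forall i, (m i < d)%N.
  move=> /msize_mdeg_lt lt_md i; apply: leq_ltn_trans lt_md.
  by rewrite mdegE (bigD1 i) //= leq_addr.
pose q : {poly K} := \sum_(m <- msupp p) (p@_m)%:P * 'X^(phi m).
have qE t : q.[t] = p.@[fun i => t ^+ (d ^ i)].
  rewrite mevalE /q horner_sum; apply: eq_bigr => m _.
  rewrite hornerCM hornerXn; congr (_ * _).
  rewrite expr_sum; apply: eq_bigr => i _; by rewrite -exprM mulnC.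
have /closed_nonrootP[t] : q != 0.
  apply/negP => /eqP q0; move: (m0p); rewrite mcoeff_msupp -[p@_m0]mulr1 => /eqP; apply.
  have /(congr1 (fun r : {poly K} => r`_(phi m0))) := q0; rewrite coef0 => <-.
  rewrite poly.coef_sum (bigD1_seq m0) ?msupp_uniq //=. rewrite coefCM coefXn eqxx big_seq_cond big1 ?addr0 //.
  move=> m /andP[mp nm]; rewrite coefCM coefXn; case: eqP => [eqphi|_]; last by rewrite mulr0.
  case/eqP: nm; apply/mnmP => i; exact: (base_expansion_inj (ltd _ mp) (ltd _ m0p) (esym eqphi)).
by rewrite rootE qE; exists (fun i => t ^+ (d ^ i)).
Qed.

Lemma meval_inj (K : closedFieldType) n (p q : {mpoly K[n]}) :
  (forall v, p.@[v] = q.@[v]) -> p = q.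
Proof.
move=> eqpq; apply/eqP; rewrite -subr_eq0; apply/negP => /negP/meval_neq0[v].
by rewrite mevalB eqpq subrr eqxx.
Qed.

(** Zariski open sets are defined by actual polynomials, and counting monomials needs a degree; both
    require leaving the inductive description. *)
Lemma polyfun_mpoly (K : fieldType) (I : finType) (f : (I -> K) -> K) :
  polyfun f -> exists p : {mpoly K[#|I|]}, forall v, f v = p.@[fun k => v (enum_val k)].
Proof.
elim=> [i|c|{}f g _ [p fp] _ [q gq]|{}f g _ [p fp] _ [q gq]|{}f g eqfg _ [p fp]].
- by exists 'X_(enum_rank i) => v; rewrite mevalXU enum_rankK.
- by exists c%:MP => v; rewrite mevalC.
- by exists (p + q) => v; rewrite mevalD fp gq.
- by exists (p * q) => v; rewrite mevalM fp gq.
by exists p => v; rewrite -eqfg.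
Qed.

Lemma meval_polyfun (K : fieldType) n (p : {mpoly K[n]}) (T : Type)
    (F : 'I_n -> (T -> K) -> K) :
  (forall i, polyfun (F i)) -> polyfun (fun v => p.@[F^~ v]).
Proof.
move=> PF; apply: polyfun_ext (fun v => esym (mevalE (F^~ v) p)) _.
apply: polyfun_sum => m _; apply: polyfunM; first exact: polyfun_const.
by apply: polyfun_prod => i _; apply: polyfunX.
Qed.

Lemma msizeM_leq (K : fieldType) n (p q : {mpoly K[n]}) :
  (msize (p * q) <= (msize p + msize q).-1)%N.
Proof.
have [->|pn0] := eqVneq p 0; first by rewrite mul0r msize0.
have [->|qn0] := eqVneq q 0; first by rewrite mulr0 msize0.
by rewrite msizeM.
Qed.

(* More polynomials than variables: for large d the products of powers less
   than d outnumber the monomials that occur in them. *)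
Theorem algebraically_dependent (K : closedFieldType) (I J : finType)
    (Psi : I -> (J -> K) -> K) :
    (#|J| < #|I|)%N -> (forall i, polyfun (Psi i)) ->
  exists P : (I -> K) -> K,
    [/\ polyfun P, exists x, P x != 0 & forall y, P (Psi^~ y) = 0].
Proof.
move=> ltJI polyPsi.
have [Q QE] := fin_all_exists (fun i => polyfun_mpoly (polyPsi i)).
pose e := \max_i msize (Q i).
(* A product of powers of the [Q i] with exponents below d has size at most L. There are d^n such
   products against at most L^#|J| monomials. As L <= (n e + 1) d, the choice of d gives L^#|J| <
   d^(#|J| + 1) <= d^n. *)
pose n := #|I|; pose d := ((n * e).+1 ^ #|J|).+1; pose L := (n * (d * e)).+1.
have msizeXn (p : {mpoly K[#|J|]}) k : (msize p <= e)%N -> (msize (p ^+ k) <= (k * e).+1)%N.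
  move=> lepe; elim: k => [|k IHk]; first by rewrite expr0 msize1.
  rewrite exprS; apply: leq_trans (msizeM_leq _ _) _.
  by rewrite -subn1 leq_subLR add1n (leq_trans (leq_add lepe IHk)) // mulSn addnS.
pose mon (a : {ffun I -> 'I_d}) := \prod_i Q i ^+ a i.
have msize_mon a : (msize (mon a) <= L)%N.
  have nE : n = size (index_enum I) by rewrite /n cardE enumT.
  rewrite /mon /L nE.
  elim: (index_enum I) => [|i s IHs]; first by rewrite big_nil msize1.
  rewrite big_cons; apply: leq_trans (msizeM_leq _ _) _.
  have le1 : (msize (Q i ^+ a i) <= (d * e).+1)%N.
    apply: leq_trans (msizeXn _ _ _) _; first exact: leq_bigmax.
    by rewrite ltnS leq_mul2r (ltnW (ltn_ord _)) orbT.
  by rewrite -subn1 leq_subLR add1n (leq_trans (leq_add le1 IHs)) // addSn addnS /= mulSn.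
pose A := \matrix_(a < #|{ffun I -> 'I_d}|, b < #|{ffun 'I_#|J| -> 'I_L}|)
  (mon (enum_val a))@_[multinom (enum_val b i : nat) | i < #|J|].
have rank_lt : (\rank A < #|{ffun I -> 'I_d}|)%N.
  apply: leq_ltn_trans (rank_leq_col A) _.
  rewrite !card_ffun !card_ord.
  have leLd : (L <= (n * e).+1 * d)%N.
    by rewrite /L mulSn [(d * e)%N]mulnC mulnA [X in (_ <= X)%N]addnC -addn1 leq_add2l.
  apply: (@leq_ltn_trans (((n * e).+1 * d) ^ #|J|)%N).
    by case: #|J| => [|k]; rewrite ?expn0 ?leq_exp2r.
  rewrite expnMn; apply: (@leq_trans (d ^ #|J|.+1)%N); last by rewrite leq_pexp2l.
  by rewrite expnS ltn_pmul2r // expn_gt0.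
(* The rows of [A] are the coefficient vectors of the products, so a left kernel vector is a linear
   relation between products, that is, a polynomial relation between the [Psi i]. *)
have /rowV0Pn[c cA cn0] : kermx A != 0 by rewrite kermx_eq0 -row_leq_rank -ltnNge.
have {cA} cA : c *m A = 0 by apply/sub_kermxP.
have rel : \sum_a c 0 a *: mon (enum_val a) = 0.
  apply/mpolyP => m; rewrite mcoeff0 raddf_sum /=.
  have [lt_mL|ge_mL] := ltnP (mdeg m) L; last first.
    apply: big1 => a _; rewrite mcoeffZ.
    suff /memN_msupp_eq0-> : m \notin msupp (mon (enum_val a)) by rewrite mulr0.
    by apply: msize_mdeg_ge; apply: leq_trans (msize_mon _) ge_mL.
  have ltL i : (m i < L)%N.
    by apply: leq_ltn_trans lt_mL; rewrite mdegE (bigD1 i) //= leq_addr.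
  pose b := enum_rank [ffun i => Ordinal (ltL i)].
  have := congr1 (fun M : 'rV_ _ => M 0 b) cA; rewrite !mxE => eq0; rewrite -[RHS]eq0.
  apply: eq_bigr => a _; rewrite mcoeffZ mxE; congr (_ * _@_ _).
  by apply/mnmP => i; rewrite mnmE enum_rankK ffunE.
pose mnm (a : {ffun I -> 'I_d}) : 'X_{1..n} := [multinom (a (enum_val i) : nat) | i < n].
have mnm_inj : injective mnm.
  move=> a a' /mnmP eqa; apply/ffunP => i; apply: val_inj.
  by have := eqa (enum_rank i); rewrite !mnmE enum_rankK.
pose p : {mpoly K[n]} := \sum_a c 0 a *: 'X_[mnm (enum_val a)].
have pn0 : p != 0.
  apply: contraNneq cn0 => p0; apply/eqP/rowP => a; rewrite mxE.
  have := congr1 (mcoeff (mnm (enum_val a))) p0; rewrite mcoeff0 => <-.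
  rewrite raddf_sum (bigD1 a) //= mcoeffZ mcoeffX eqxx mulr1 big1 ?addr0 // => b nb.
  by rewrite mcoeffZ mcoeffX (inj_eq mnm_inj) (inj_eq enum_val_inj) (negPf nb) mulr0.
exists (fun x => p.@[fun k => x (enum_val k)]); split.
- by apply: meval_polyfun => i; apply: polyfun_var.
- have [v pv] := meval_neq0 pn0; exists (fun i => v (enum_rank i)).
  by rewrite (@meval_eq _ _ _ v) // => k; rewrite enum_valK.
move=> y; have := congr1 (meval (fun k => y (enum_val k))) rel; rewrite meval0 => <-.
rewrite !raddf_sum /=; apply: eq_bigr => a _; rewrite !mevalZ; congr (_ * _).
rewrite mevalX rmorph_prod /= [RHS](reindex (@enum_val _ I)) /=; last first.
  by exists enum_rank => i _; rewrite ?enum_valK ?enum_rankK.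
by apply: eq_bigr => i _; rewrite rmorphXn /= -QE mnmE.
Qed.

(** * Polynomial families of forms *)

Section PolyFam.
Variables (K : fieldType) (I : Type).

(** The values may lie in an infinite-dimensional space of polynomials. Each family uses finitely
    many vectors with polynomial coefficients, so every linear functional, such as a coefficient or
    an evaluation, turns it into a polynomial function. *)
Inductive polyfam (V : lmodType K) : ((I -> K) -> V) -> Prop :=
| polyfam_const x : polyfam (fun _ => x)
| polyfamD F G : polyfam F -> polyfam G -> polyfam (fun v => F v + G v)
| polyfamZ f F : polyfun f -> polyfam F -> polyfam (fun v => f v *: F v)
| polyfam_ext F G : F =1 G -> polyfam F -> polyfam G.

Lemma polyfam_sum (V : lmodType K) (T : Type) (r : seq T) (P : pred T)
    (F : T -> (I -> K) -> V) :
  (forall x, P x -> polyfam (F x)) -> polyfam (fun v => \sum_(x <- r | P x) F x v).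
Proof.
move=> PF; elim: r => [|x r IHr].
  by apply: polyfam_ext (polyfam_const 0) => v; rewrite big_nil.
have [Px|nPx] := boolP (P x).
  by apply: polyfam_ext (polyfamD (PF _ Px) IHr) => v; rewrite big_cons Px.
by apply: polyfam_ext IHr => v; rewrite big_cons (negPf nPx).
Qed.

Lemma polyfam_linear (V W : lmodType K) (phi : {linear V -> W}) (F : (I -> K) -> V) :
  polyfam F -> polyfam (fun v => phi (F v)).
Proof.
elim=> [x|{}F G _ IHF _ IHG|f {}F Pf _ IHF|{}F G eqFG _ IHF].
- exact: polyfam_const.
- by apply: polyfam_ext (polyfamD IHF IHG) => v; rewrite linearD.
- by apply: polyfam_ext (polyfamZ Pf IHF) => v; rewrite linearZ.
by apply: polyfam_ext IHF => v; rewrite eqFG.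
Qed.

Lemma polyfam_scalar (V : lmodType K) (phi : {scalar V}) (F : (I -> K) -> V) :
  polyfam F -> polyfun (fun v => phi (F v)).
Proof.
elim=> [x|{}F G _ IHF _ IHG|f {}F Pf _ IHF|{}F G eqFG _ IHF].
- exact: polyfun_const.
- by apply: polyfun_ext (polyfunD IHF IHG) => v; rewrite linearD.
- by apply: polyfun_ext (polyfunM Pf IHF) => v; rewrite linearZ.
by apply: polyfun_ext IHF => v; rewrite eqFG.
Qed.

Lemma polyfamM (V : algType K) (F G : (I -> K) -> V) :
  polyfam F -> polyfam G -> polyfam (fun v => F v * G v).
Proof.
move=> PF PG; elim: PF => [x|{}F F' _ IHF _ IHF'|f {}F Pf _ IHF|{}F F' eqF _ IHF].
- elim: PG => [y|{}G G' _ IHG _ IHG'|f {}G Pf _ IHG|{}G G' eqG _ IHG].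
  + exact: polyfam_const.
  + by apply: polyfam_ext (polyfamD IHG IHG') => v; rewrite mulrDr.
  + by apply: polyfam_ext (polyfamZ Pf IHG) => v; rewrite scalerAr.
  by apply: polyfam_ext IHG => v; rewrite eqG.
- by apply: polyfam_ext (polyfamD IHF IHF') => v; rewrite mulrDl.
- by apply: polyfam_ext (polyfamZ Pf IHF) => v; rewrite scalerAl.
by apply: polyfam_ext IHF => v; rewrite eqF.
Qed.

Lemma polyfamX (V : algType K) (F : (I -> K) -> V) k :
  polyfam F -> polyfam (fun v => F v ^+ k).
Proof.
move=> PF; elim: k => [|k IHk]; first exact: polyfam_const.
by apply: polyfam_ext (polyfamM PF IHk) => v; rewrite exprS.
Qed.

Lemma polyfam_prod (V : algType K) (T : Type) (r : seq T) (P : pred T)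
    (F : T -> (I -> K) -> V) :
  (forall x, P x -> polyfam (F x)) -> polyfam (fun v => \prod_(x <- r | P x) F x v).
Proof.
move=> PF; elim: r => [|x r IHr].
  by apply: polyfam_ext (polyfam_const 1) => v; rewrite big_nil.
have [Px|nPx] := boolP (P x).
  by apply: polyfam_ext (polyfamM (PF _ Px) IHr) => v; rewrite big_cons Px.
by apply: polyfam_ext IHr => v; rewrite big_cons (negPf nPx).
Qed.

End PolyFam.

Lemma polyfam_comp (K : fieldType) (V : lmodType K) (I J : Type) (F : (I -> K) -> V)
    (G : I -> (J -> K) -> K) :
  polyfam F -> (forall i, polyfun (G i)) -> polyfam (fun w => F (G^~ w)).
Proof.
move=> PF PG; elim: PF => [x|{}F F' _ IHF _ IHF'|f {}F Pf _ IHF|{}F F' eqF _ IHF].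
- exact: polyfam_const.
- exact: polyfamD.
- by apply: polyfamZ IHF; apply: polyfun_comp.
by apply: polyfam_ext IHF => w; apply: eqF.
Qed.

Lemma polyfam_meval (K : fieldType) (I : Type) n (F : (I -> K) -> {mpoly K[n]})
    (x : 'I_n -> (I -> K) -> K) :
  polyfam F -> (forall i, polyfun (x i)) -> polyfun (fun v => (F v).@[x^~ v]).
Proof.
move=> PF Px; elim: PF => [p|{}F F' _ IHF _ IHF'|f {}F Pf _ IHF|{}F F' eqF _ IHF].
- exact: meval_polyfun.
- by apply: polyfun_ext (polyfunD IHF IHF') => v; rewrite mevalD.
- by apply: polyfun_ext (polyfunM Pf IHF) => v; rewrite mevalZ.
by apply: polyfun_ext IHF => v; rewrite eqF.
Qed.

Lemma mpoly_ring_ind (R : comNzRingType) n (P : {mpoly R[n]} -> Prop) :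
  (forall c, P c%:MP) -> (forall i, P 'X_i) ->
  (forall p q, P p -> P q -> P (p + q)) -> (forall p q, P p -> P q -> P (p * q)) ->
  forall p, P p.
Proof.
move=> PC PX PD PM p; rewrite [p]mpolyE.
apply: (big_ind P) => [||m _]; [by rewrite -mpolyC0|exact: PD|].
rewrite -mul_mpolyC; apply: (PM); first exact: PC.
rewrite mpolyXE_id; apply: (big_ind P) => [||i _]; [by rewrite -mpolyC1|exact: PM|].
by elim: (m i) => [|k IHk]; rewrite ?expr0 -?mpolyC1 // exprS; apply: (PM).
Qed.

Lemma poly_horner_inj (K : closedFieldType) (p q : {poly K}) :
  (forall t, p.[t] = q.[t]) -> p = q.
Proof.
move=> eqpq; apply/eqP; rewrite -subr_eq0; apply/negP => /negP/closed_nonrootP[t].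
by rewrite rootE !hornerE eqpq subrr eqxx.
Qed.

Lemma comp_mpoly_homog (R : comNzRingType) n k (t : n.-tuple {mpoly R[k]}) d
    (p : {mpoly R[n]}) :
  (forall i, tnth t i \is 1.-homog) -> p \is d.-homog -> p \mPo t \is d.-homog.
Proof.
move=> ht hp; rewrite comp_mpolyEX big_seq; apply: rpred_sum => m mp.
have <- : mdeg m = d by exact: (dhomog_mf hp).
apply: dhomogZ; rewrite comp_mpolyX mdegE.
elim: (index_enum _) => [|i s IHs]; first by rewrite !big_nil dhomog1.
by rewrite !big_cons; apply: dhomogM IHs; have := dhomogMn (m i) (ht i); rewrite mul1n.
Qed.

(** * Linear changes of coordinates, gradients and Hessians *)

Section LinearSubstitution.
Variables (K : numClosedFieldType) (n : nat).
Implicit Types (p q : {mpoly K[n]}) (v w : 'rV[K]_n) (M : 'M[K]_n).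

(** Points are row vectors and the result takes at v the value of p at v M, hence the transposed
    indices. *)
Definition lin_subst M p : {mpoly K[n]} := p \mPo [tuple \sum_j M j i *: 'X_j | i < n].

Lemma meval_lin_subst M p v : (lin_subst M p).@[v 0] = p.@[(v *m M) 0].
Proof.
rewrite /lin_subst comp_mpoly_meval; apply: meval_eq => i.
rewrite tnth_mktuple raddf_sum !mxE; apply: eq_bigr => j _.
by rewrite /= mevalZ mevalXU mulrC.
Qed.

Lemma meval_row_inj p q : (forall v, p.@[v 0] = q.@[v 0]) -> p = q.
Proof.
move=> eqpq; apply: meval_inj => v.
have := eqpq (\row_i v i); rewrite !(@meval_eq _ _ _ v) // => i; exact: mxE.
Qed.

Lemma lin_substM M N p : lin_subst M (lin_subst N p) = lin_subst (M *m N) p.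
Proof. by apply: meval_row_inj => v; rewrite !meval_lin_subst mulmxA. Qed.

Lemma lin_subst1 p : lin_subst 1%:M p = p.
Proof. by apply: meval_row_inj => v; rewrite meval_lin_subst mulmx1. Qed.

Lemma lin_subst_homog d M p : p \is d.-homog -> lin_subst M p \is d.-homog.
Proof.
apply: comp_mpoly_homog => i; rewrite tnth_mktuple; apply: rpred_sum => j _.
by apply: dhomogZ; rewrite dhomogX; apply/eqP; apply: mdeg1.
Qed.

End LinearSubstitution.

Lemma polyfam_lin_subst (K : numClosedFieldType) (I : Type) n
    (M : (I -> K) -> 'M[K]_n) (F : (I -> K) -> {mpoly K[n]}) :
    (forall i j, polyfun (fun v => M v i j)) -> polyfam F ->
  polyfam (fun v => lin_subst (M v) (F v)).
Proof.
move=> PM; elim=> [p|{}F F' _ IHF _ IHF'|f {}F Pf _ IHF|{}F F' eqF _ IHF].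
- apply: polyfam_ext (fun v => esym (comp_mpolyEX _ _)) _.
  apply: polyfam_sum => m _; apply: polyfamZ; first exact: polyfun_const.
  apply: polyfam_ext (fun v => esym (comp_mpolyX _ _)) _.
  apply: polyfam_prod => i _; apply: polyfamX.
  apply: (@polyfam_ext _ _ _ (fun v => \sum_j M v j i *: 'X_j)).
    by move=> v; rewrite tnth_mktuple.
  by apply: polyfam_sum => j _; apply: polyfamZ => //; apply: polyfam_const.
- by apply: polyfam_ext (polyfamD IHF IHF') => v; rewrite /lin_subst comp_mpolyD.
- by apply: polyfam_ext (polyfamZ Pf IHF) => v; rewrite /lin_subst comp_mpolyZ.
by apply: polyfam_ext IHF => v; rewrite eqF.
Qed.

Section Taylor.
Variables (K : numClosedFieldType) (n : nat).
Implicit Types (p q : {mpoly K[n]}) (v w : 'rV[K]_n) (M : 'M[K]_n).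

(** The restriction of p to the line v + X w, as a polynomial in X. Its first coefficients are the
    value, the derivative along w and half the Hessian form, so transformation rules for gradient
    and Hessian follow from uniqueness of coefficients, without a chain rule. *)
Definition line_poly p v w : {poly K} :=
  (map_mpoly polyC p).@[fun i => (v 0 i)%:P + w 0 i *: 'X].

Lemma line_polyC c v w : line_poly c%:MP v w = c%:P.
Proof. by rewrite /line_poly map_mpolyC mevalC. Qed.

Lemma line_polyX i v w : line_poly 'X_i v w = (v 0 i)%:P + w 0 i *: 'X.
Proof. by rewrite /line_poly map_mpolyX mevalXU. Qed.

Lemma line_polyD p q v w : line_poly (p + q) v w = line_poly p v w + line_poly q v w.
Proof. by rewrite /line_poly rmorphD mevalD. Qed.

Lemma line_polyM p q v w : line_poly (p * q) v w = line_poly p v w * line_poly q v w.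
Proof. by rewrite /line_poly rmorphM mevalM. Qed.

Lemma horner_line_poly p v w t : (line_poly p v w).[t] = p.@[(v + t *: w) 0].
Proof.
elim/mpoly_ring_ind: p => [c|i|p q IHp IHq|p q IHp IHq].
- by rewrite line_polyC hornerC mevalC.
- by rewrite line_polyX mevalXU !hornerE !mxE mulrC.
- by rewrite line_polyD hornerD mevalD IHp IHq.
by rewrite line_polyM hornerM mevalM IHp IHq.
Qed.

Lemma deriv_line_poly p v w :
  (line_poly p v w)^`() = \sum_i w 0 i *: line_poly p^`M(i) v w.
Proof.
elim/mpoly_ring_ind: p => [c|i|p q IHp IHq|p q IHp IHq].
- rewrite line_polyC derivC big1 // => i _.
  by rewrite mderivC -mpolyC0 line_polyC scaler0.
- rewrite line_polyX derivD derivC derivZ derivX add0r (bigD1 i) //= big1 ?addr0.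
    have subUU : (U_(i) - U_(i) = 0 :> 'X_{1..n})%MM.
      by apply/mnmP => k; rewrite mnmBE subnn mnm0E.
    by rewrite mderivX mnm1E eqxx scale1r subUU mpolyX0 -mpolyC1 line_polyC alg_polyC.
  move=> j ne_ji; rewrite mderivX mnm1E eq_sym (negPf ne_ji) scale0r -mpolyC0.
  by rewrite line_polyC scaler0.
- rewrite line_polyD derivD IHp IHq -big_split; apply: eq_bigr => i _ /=.
  by rewrite mderivD line_polyD scalerDr.
rewrite line_polyM derivM IHp IHq mulr_suml mulr_sumr -big_split; apply: eq_bigr => i _ /=.
by rewrite mderivM line_polyD !line_polyM scalerDr -scalerAl -scalerAr.
Qed.

Definition gradient p v : 'rV[K]_n := \row_i p^`M(i).@[v 0].
Definition hessian p v : 'M[K]_n := \matrix_(i, j) p^`M(i)^`M(j).@[v 0].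

Lemma coef0_line_poly p v w : (line_poly p v w)`_0 = p.@[v 0].
Proof. by rewrite -horner_coef0 horner_line_poly scale0r addr0. Qed.

Lemma coef1_line_poly p v w : (line_poly p v w)`_1 = (w *m (gradient p v)^T) 0 0.
Proof.
have <- : (line_poly p v w)^`()`_0 = (line_poly p v w)`_1 by rewrite coef_deriv mulr1n.
rewrite deriv_line_poly coef_sum mxE; apply: eq_bigr => i _.
by rewrite -mul_polyC coefCM coef0_line_poly !mxE.
Qed.

Lemma coef2_line_poly p v w :
  (line_poly p v w)`_2 *+ 2 = (w *m hessian p v *m w^T) 0 0.
Proof.
have <- := coef_deriv (line_poly p v w) 1.
rewrite deriv_line_poly coef_sum -mulmxA mxE; apply: eq_bigr => i _.
rewrite -mul_polyC coefCM coef1_line_poly !mxE; congr (_ * _).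
by apply: eq_bigr => j _; rewrite !mxE mulrC.
Qed.

Lemma hessian_sym p v : (hessian p v)^T = hessian p v.
Proof. by apply/matrixP => i j; rewrite !mxE mderiv_comm. Qed.

Lemma mx_eq_linear (a b : 'rV[K]_n) :
  (forall w, (w *m a^T) 0 0 = (w *m b^T) 0 0) -> a = b.
Proof.
move=> eqab; apply/rowP => i.
by have := eqab (delta_mx 0 i); rewrite -!rowE !mxE.
Qed.

(** Polarization: the quadratic form of A - B at the sum of two basis vectors is twice an entry, and
    2 is invertible. *)
Lemma sym_mx_eq_quadratic (A B : 'M[K]_n) : A^T = A -> B^T = B ->
  (forall w, (w *m A *m w^T) 0 0 = (w *m B *m w^T) 0 0) -> A = B.
Proof.
move=> symA symB eqAB; apply/eqP; rewrite -subr_eq0; apply/eqP/matrixP => i j.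
pose C := A - B.
have symC : C^T = C by rewrite /C linearB /= symA symB.
pose f (x y : 'rV[K]_n) : K := (x *m C *m y^T) 0 0.
have f0 w : f w w = 0.
  by rewrite /f /C mulmxBr mulmxBl [LHS]mxE [X in _ + X]mxE eqAB subrr.
have fDl x y z : f (x + y) z = f x z + f y z by rewrite /f !mulmxDl [LHS]mxE.
have fDr x y z : f x (y + z) = f x y + f x z by rewrite /f [(y + z)^T]linearD /= mulmxDr [LHS]mxE.
have fdelta k l : f (delta_mx 0 k) (delta_mx 0 l) = C k l.
  by rewrite /f trmx_delta -rowE -colE !mxE.
have := f0 (delta_mx 0 i + delta_mx 0 j).
rewrite fDl !fDr !f0 add0r addr0 !fdelta (_ : C j i = C i j) -?mulr2n; last by rewrite -[in LHS]symC [LHS]mxE.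
by move/eqP; rewrite mulrn_eq0 /= => /eqP; rewrite !mxE.
Qed.

Lemma line_poly_lin_subst M p v w :
  line_poly (lin_subst M p) v w = line_poly p (v *m M) (w *m M).
Proof.
apply: poly_horner_inj => t.
by rewrite !horner_line_poly meval_lin_subst mulmxDl -scalemxAl.
Qed.

Lemma gradient_lin_subst M p v : gradient (lin_subst M p) v = gradient p (v *m M) *m M^T.
Proof.
apply: mx_eq_linear => w.
by rewrite -coef1_line_poly line_poly_lin_subst coef1_line_poly trmx_mul trmxK mulmxA.
Qed.

Lemma hessian_lin_subst M p v :
  hessian (lin_subst M p) v = M *m hessian p (v *m M) *m M^T.
Proof.
apply: sym_mx_eq_quadratic; first exact: hessian_sym.
  by rewrite !trmx_mul trmxK hessian_sym mulmxA.
by move=> w; rewrite -coef2_line_poly line_poly_lin_subst coef2_line_poly trmx_mul !mulmxA.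
Qed.

End Taylor.

(** * Counting common zeros on a Hirzebruch surface *)

Section Sylvester.

(** A binary form of formal degree m. Homogeneity turns a vanishing leading coefficient into a zero
    at (0 : 1) instead of a drop of degree. *)
Definition hval (R : comNzRingType) m (a : nat -> R) (t0 t1 : R) : R :=
  \sum_(j < m.+1) a j * t0 ^+ (m - j) * t1 ^+ j.

Definition shifts (R : comNzRingType) k n m (a : nat -> R) : 'M[R]_(k, n) :=
  \matrix_(i, j) if (i <= j <= i + m)%N then a (j - i)%N else 0.

Definition sylv (R : comNzRingType) m k (a b : nat -> R) : 'M[R]_(k + m) :=
  col_mx (shifts k (k + m) m a) (shifts m (k + m) k b).

Definition veronese (R : comNzRingType) n (t0 t1 : R) : 'cV[R]_n :=
  \col_j (t0 ^+ (n.-1 - j) * t1 ^+ j).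

(** Each row is the form times a monomial of degree k - 1. Hence a common zero of two forms puts its
    Veronese vector into the kernel of their Sylvester matrix. *)
Lemma shifts_veronese (R : comNzRingType) k m n (a : nat -> R) t0 t1 (i : 'I_k) :
  n = (k + m)%N -> (shifts k n m a *m veronese n t0 t1) i 0 =
  t0 ^+ (k.-1 - i) * t1 ^+ i * hval m a t0 t1.
Proof.
move=> ->.
have lt_ik := ltn_ord i.
rewrite mxE.
pose F (j : nat) : R := (if (i <= j <= i + m)%N then a (j - i)%N else 0) *
   (t0 ^+ ((k + m).-1 - j) * t1 ^+ j).
rewrite (eq_bigr (fun j : 'I_(k + m) => F j)); last by move=> j _; rewrite !mxE.
rewrite -(big_mkord xpredT F) (big_cat_nat (n := i)) ?(leq_trans (ltnW lt_ik)) ?leq_addr //=.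
rewrite big_nat big1 ?add0r; last first.
  by move=> j /andP[_ lt_ji]; rewrite /F leqNgt lt_ji mul0r.
rewrite (big_cat_nat (n := i + m.+1)) ?leq_addr //=; last by rewrite addnS -addSn leq_add2r.
rewrite [X in _ + X]big_nat [X in _ + X]big1 ?addr0; last first.
  by move=> j /andP[le_j _]; rewrite /F [(j <= i + m)%N]leqNgt -addnS le_j andbF mul0r.
have -> : \sum_(i <= j < i + m.+1) F j = \sum_(j < m.+1) F (j + i)%N.
  by have := big_addn 0 (i + m.+1) i xpredT F; rewrite add0n addKn => ->; rewrite big_mkord.
rewrite /hval mulr_sumr.
apply: eq_bigr => j _; have le_jm : (j <= m)%N by rewrite -ltnS.
rewrite /F leq_addl addnC leq_add2l le_jm /= addKn exprD.
have -> : ((k + m).-1 - (i + j) = (k.-1 - i) + (m - j))%N.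
  by clear -lt_ik le_jm; move: (nat_of_ord i) (nat_of_ord j) lt_ik le_jm => i0 j0; lia.
by rewrite exprD; ring.
Qed.

Lemma sylv_veronese (R : comNzRingType) m k (a b : nat -> R) t0 t1 :
  hval m a t0 t1 = 0 -> hval k b t0 t1 = 0 ->
  sylv m k a b *m veronese (k + m) t0 t1 = 0.
Proof.
move=> a0 b0; rewrite /sylv mul_col_mx -[RHS]vsubmxK; congr col_mx.
  by apply/colP => i; rewrite shifts_veronese // a0 mulr0 !mxE.
apply/colP => i; rewrite (@shifts_veronese _ m k) 1?addnC //.
by rewrite b0 mulr0 !mxE.
Qed.

Lemma map_sylv (R S : comNzRingType) (f : {rmorphism R -> S}) m k a b :
  map_mx f (sylv m k a b) = sylv m k (f \o a) (f \o b).
Proof.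
rewrite /sylv map_col_mx; congr col_mx; apply/matrixP => i j; rewrite !mxE;
  by case: ifP => // _; rewrite rmorph0.
Qed.

Variable K : numClosedFieldType.
Implicit Types (a b : nat -> K).

Let trunc m a : {poly K} := \poly_(j < m.+1) a j.

Let horner_trunc m a t : (trunc m a).[t] = hval m a 1 t.
Proof.
by rewrite horner_poly; apply: eq_bigr => j _; rewrite expr1n mulr1.
Qed.

Let mul_shifts k m n (u : 'rV[K]_k) a (j : 'I_n) : n = (k + m)%N ->
  (u *m shifts k n m a) 0 j = (rVpoly u * trunc m a)`_j.
Proof.
move=> nE; rewrite mxE coefM.
pose F (i : nat) : K := (rVpoly u)`_i * (if (i <= j <= i + m)%N then a (j - i)%N else 0).
rewrite (eq_bigr (fun i : 'I_k => F i)); last by move=> i _; rewrite /F coef_rVpoly_ord !mxE.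

have F0 i : (k <= i)%N -> F i = 0.
  by move=> le_ki; rewrite /F nth_default ?mul0r // (leq_trans (size_poly _ _)).
have -> : \sum_(i < k) F i = \sum_(i < k + j.+1) F i.
  by rewrite big_split_ord /= [X in _ + X]big1 ?addr0 // => i _; rewrite F0 ?leq_addr.
rewrite addnC big_split_ord /= [X in _ + X]big1 ?addr0; last first.
  by move=> i _; rewrite /F leqNgt ltnS leq_addr mulr0.
apply: eq_bigr => i _; rewrite /F; congr (_ * _); rewrite coef_poly.
have le_ij : (i <= j)%N by rewrite -ltnS.
by rewrite le_ij /= ltnS leq_subLR.
Qed.

Let common_root m (A B : {poly K}) (U V : {poly K}) :
  size A = m.+1 -> (size V <= m)%N -> U * A + V * B = 0 -> (U != 0) || (V != 0) ->
  exists t, A.[t] = 0 /\ B.[t] = 0.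
Proof.
move=> sA sV rel nz.
have An0 : A != 0 by rewrite -size_poly_eq0 sA.
apply: contrapT => nex.
have cop : coprimep A B.
  apply: Pdiv.ClosedField.root_coprimep => t /rootP At.
  by apply/negP => /eqP Bt; apply: nex; exists t.
have : A %| V * B.
  by move/eqP: rel; rewrite addrC addr_eq0 => /eqP ->; rewrite dvdpNr dvdp_mull.
rewrite Gauss_dvdpl // => dvd.
have V0 : V = 0.
  by apply/eqP; apply: contraTT (dvd) => Vn0; apply/negP => /(dvdp_leq Vn0); rewrite sA leqNgt ltnS sV.
move: rel nz; rewrite V0 mul0r addr0 => /eqP; rewrite mulf_eq0 (negPf An0) orbF => ->.
by rewrite eqxx.
Qed.

(** A common zero gives a nonzero Veronese vector in the kernel. Conversely a left kernel vector is
    a relation U a + V b = 0 with cofactors of too small degree for a and b to be coprime. *)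
Lemma sylv_eq0 m k a b : (0 < k + m)%N ->
  reflect (exists t0 t1, [/\ (t0, t1) != (0, 0), hval m a t0 t1 = 0 & hval k b t0 t1 = 0])
          (\det (sylv m k a b) == 0).
Proof.
move=> km_gt0; apply: (iffP idP) => [|[t0 [t1 [tn0 a0 b0]]]]; last first.
  apply/negP => /negP; rewrite -unitfE -[_ \is a _]/(sylv m k a b \in unitmx) => inv.
  have := mulKmx inv (veronese (k + m) t0 t1); rewrite sylv_veronese // mulmx0 => /colP V0.
  have n0 : (0 < k + m)%N by [].
  have nmax : ((k + m).-1 < k + m)%N by rewrite prednK.
  move/negP: tn0; apply; rewrite xpair_eqE.
  have := V0 (Ordinal n0); have := V0 (Ordinal nmax); rewrite !mxE /= subnn subn0 !expr0.
  rewrite mul1r mulr1 => /esym/eqP t1E /esym/eqP t0E.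
  case: ((k + m).-1) t0E t1E => [|l]; first by rewrite expr0 oner_eq0.
  by rewrite !expf_eq0 /= => -> ->.
move/det0P=> [w wn0 w0].
pose U := rVpoly (lsubmx w); pose V := rVpoly (rsubmx w).
have rel : U * trunc m a + V * trunc k b = 0.
  apply/polyP => j; rewrite coef0 coefD.
  have [lt_j|ge_j] := ltnP j (k + m).
    rewrite -(mul_shifts (lsubmx w) a (Ordinal lt_j)) // -(mul_shifts (rsubmx w) b (Ordinal lt_j)) 1?addnC //.
    have := congr1 (fun M : 'rV_ _ => M 0 (Ordinal lt_j)) w0.
    by rewrite -{1}[w]hsubmxK /sylv mul_row_col !mxE.
  have le_size (p q : {poly K}) c d :
      (size p <= c)%N -> (size q <= d.+1)%N -> (c + d <= j)%N -> (size (p * q)%R <= j)%N.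
    move=> sp sq; apply: leq_trans; apply: leq_trans (size_polyMleq _ _) _.
    by rewrite -subn1 leq_subLR add1n -addnS leq_add.
  rewrite !nth_default ?addr0 //.
    by apply: (le_size _ _ m k); rewrite ?size_poly // addnC.
  by apply: (le_size _ _ k m); rewrite ?size_poly.
have nz : (U != 0) || (V != 0).
  apply: contraNT wn0; rewrite negb_or !negbK => /andP[/eqP U0 /eqP V0].
  by rewrite -[w]hsubmxK -[lsubmx w]rVpolyK -[rsubmx w]rVpolyK -/U -/V U0 V0 !linear0 row_mx0.
have fin t : (trunc m a).[t] = 0 -> (trunc k b).[t] = 0 ->
    exists t0 t1, [/\ (t0, t1) != (0, 0), hval m a t0 t1 = 0 & hval k b t0 t1 = 0].
  by move=> a0 b0; exists 1, t; rewrite xpair_eqE oner_eq0 -!horner_trunc.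
have size_trunc l (c : nat -> K) : c l != 0 -> size (trunc l c) = l.+1.
  by move=> cl; rewrite size_poly_eq.
(* If one leading coefficient is nonzero, that form has its full degree and the relation yields a
   common root with t0 = 1; if both vanish, (0 : 1) is a common zero. *)
have [am0|am0] := eqVneq (a m) 0; last first.
  have [t [] ] := common_root (size_trunc _ _ am0) (size_poly _ _) rel nz.
  exact: fin.
have [bk0|bk0] := eqVneq (b k) 0; last first.
  rewrite addrC in rel; rewrite orbC in nz.
  have [t [] ] := common_root (size_trunc _ _ bk0) (size_poly _ _) rel nz.
  by move=> b0 a0; apply: fin b0.
have at01 l (c : nat -> K) : hval l c 0 1 = c l.
  rewrite /hval big_ord_recr /= subnn expr0 mulr1 expr1n mulr1 big1 ?add0r // => j _.
  by rewrite expr0n subn_eq0 leqNgt ltn_ord mulr0 mul0r.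
by exists 0, 1; rewrite !at01 xpair_eqE oner_eq0 andbF.
Qed.

End Sylvester.

(** Constant row operations make all rows beyond the rank vanish at x; each of them then contributes
    a factor X - x to the determinant. *)
Lemma dvdp_det_corank (K : fieldType) n (M : 'M[{poly K}]_n) (x : K) :
  ('X - x%:P) ^+ (n - \rank (map_mx (horner_eval x) M)) %| \det M.
Proof.
set M0 := map_mx _ M; pose L := col_ebase M0.
have uL : L \in unitmx := col_ebase_unit M0.
pose N := map_mx polyC (invmx L) *m M.
have -> : \det M = \det (map_mx polyC L) * \det N.
  by rewrite -det_mulmx mulmxA -map_mxM mulmxV // map_mx1 mul1mx.
apply: dvdp_mull.
pose d (i : 'I_n) : {poly K} := if (i < \rank M0)%N then 1 else 'X - x%:P.
have dvd i j : d i %| N i j.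
  rewrite /d; case: ltnP => [_|ge_i]; first exact: dvd1p.
  rewrite dvdp_XsubCl; apply/rootP.
  have -> : (N i j).[x] = (invmx L *m M0) i j.
    rewrite !mxE horner_sum; apply: eq_bigr => k _.
    by rewrite !mxE hornerM hornerC.
  rewrite -[M0 in _ *m M0]mulmx_ebase -!mulmxA mulKmx // mxE big1 // => k _.
  by rewrite !mxE ltnNge ge_i andbF mul0r.
have -> : N = diag_mx (\row_i d i) *m (\matrix_(i, j) (N i j %/ d i)).
  by apply/matrixP => i j; rewrite mul_diag_mx [RHS]mxE [X in _ = X * _]mxE [X in _ * X]mxE mulrC divpK ?dvd.
rewrite det_mulmx det_diag; apply: dvdp_mulr.
rewrite (bigID (fun i : 'I_n => (i < \rank M0)%N)) /=; apply: dvdp_mull.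
rewrite (eq_bigr (fun _ => 'X - x%:P)) => [|i]; last by rewrite mxE /d => /negPf ->.
rewrite prodr_const.
have -> : #|[pred i : 'I_n | ~~ (i < \rank M0)%N]| = (n - \rank M0)%N.
  have := cardC [pred i : 'I_n | (i < \rank M0)%N]; rewrite card_ord.
  have -> : #|[pred i : 'I_n | (i < \rank M0)%N]| = \rank M0.
    rewrite -sum1_card (big_ord_narrow (F := fun _ => 1%N) (rank_leq_row M0)) /=.
    by rewrite sum1_card card_ord.
  by move=> cE; rewrite -[X in (X - _)%N]cE addKn; apply: eq_card.
exact: dvdpp.
Qed.

(** Entry (i, j) has degree at most r i - c j, so every product in the Leibniz expansion has degree
    at most the sum of the r i minus the sum of the c j. *)
Lemma size_det_weighted (K : fieldType) n (M : 'M[{poly K}]_n) (r c : 'I_n -> nat) N :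
  (forall i j, M i j != 0 -> (size (M i j) + c j <= (r i).+1)%N) ->
  (\sum_i r i = N + \sum_i c i)%N -> (size (\det M) <= N.+1)%N.
Proof.
move=> leM sumE; apply: leq_trans (size_sum _ _ _) _; apply/bigmax_leqP => s _.
suff : (size (\prod_i M i (s i))%R <= N.+1)%N.
  by rewrite mulr_sign; case: ifP => _; rewrite ?size_polyN.
have [->|] := eqVneq (\prod_i M i (s i)) 0; first by rewrite size_poly0.
move=> nz; rewrite -(leq_add2r (\sum_i c i)) addSn -sumE.
rewrite [X in (_ + X)%N](reindex_inj (@perm_inj _ s)) /=.
elim: (index_enum _) nz => [|i l IHl]; first by rewrite !big_nil size_poly1.
rewrite !big_cons mulf_eq0 negb_or => /andP[nzi nzl].
rewrite size_mul //; have := leM _ _ nzi; have := IHl nzl.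
have : (0 < size (M i (s i)))%N by rewrite size_poly_gt0.
move: (size (M i (s i))) (size (\prod_(j <- l) M j (s j))%R) (\sum_(j <- l) c (s j))%N (\sum_(j <- l) r j)%N => *; lia.
Qed.

(* Forms of bidegree (d, e) on the Hirzebruch surface F_omega, with homogeneous
   coordinates s0, s1 of degree (1, 0), t1 of degree (0, 1) and t0 of degree
   (-omega, 1), whose coefficients are polynomials in parameters in K^I. *)
Section HirzebruchForms.
Variables (K : fieldType) (I : Type) (omega : nat).
Local Notation fam := ((I -> K) -> K -> K -> K -> K -> K).

(** The degree in s of the coefficient of t0^(e - j) t1^j: every factor t0, of degree -omega in s,
    has to be compensated. *)
Definition sdeg d e j := (d + omega * (e - j))%N.

Inductive hform (d e : nat) : fam -> Prop :=
| hform0 : hform d e (fun _ _ _ _ _ => 0)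
| hform_mono f i j : polyfun f -> (j <= e)%N -> (i <= sdeg d e j)%N ->
    hform d e (fun n s0 s1 t0 t1 =>
      f n * (s0 ^+ (sdeg d e j - i) * s1 ^+ i * t0 ^+ (e - j) * t1 ^+ j))
| hformD g h : hform d e g -> hform d e h ->
    hform d e (fun n s0 s1 t0 t1 => g n s0 s1 t0 t1 + h n s0 s1 t0 t1)
| hform_ext g h : (forall n s0 s1 t0 t1, g n s0 s1 t0 t1 = h n s0 s1 t0 t1) ->
    hform d e g -> hform d e h.

Lemma hformM d e d' e' g h : hform d e g -> hform d' e' h ->
  hform (d + d') (e + e') (fun n s0 s1 t0 t1 => g n s0 s1 t0 t1 * h n s0 s1 t0 t1).
Proof.
move=> Pg Ph; elim: Pg => [|f i j Pf le_je le_i|g1 g2 _ IH1 _ IH2|g1 g2 eqg _ IH].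
- by apply: hform_ext (hform0 _ _) => *; rewrite mul0r.
- elim: Ph => [|f' i' j' Pf' le_je' le_i'|h1 h2 _ IH1 _ IH2|h1 h2 eqh _ IH].
  + by apply: hform_ext (hform0 _ _) => *; rewrite mulr0.
  + have degE : sdeg (d + d') (e + e') (j + j') = (sdeg d e j + sdeg d' e' j')%N.
      rewrite /sdeg.
      have -> : (e + e' - (j + j') = (e - j) + (e' - j'))%N by lia.
      by rewrite mulnDr; lia.
    have le_ii' : (i + i' <= sdeg (d + d') (e + e') (j + j'))%N by rewrite degE leq_add.
    apply: hform_ext (hform_mono (polyfunM Pf Pf') (leq_add le_je le_je') le_ii').
    move=> n s0 s1 t0 t1; rewrite degE.
    have -> : (sdeg d e j + sdeg d' e' j' - (i + i') =
      (sdeg d e j - i) + (sdeg d' e' j' - i'))%N by lia.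
    have -> : (e + e' - (j + j') = (e - j) + (e' - j'))%N by lia.
    by rewrite !exprD; ring.
  + by apply: hform_ext (hformD IH1 IH2) => *; rewrite mulrDr.
  by apply: hform_ext IH => *; rewrite eqh.
- by apply: hform_ext (hformD IH1 IH2) => *; rewrite mulrDl.
by apply: hform_ext IH => *; rewrite eqg.
Qed.

Lemma hform_const f : polyfun f -> hform 0 0 (fun n _ _ _ _ => f n).
Proof.
move=> Pf; have le0 : (0 <= sdeg 0 0 0)%N by [].
apply: hform_ext (hform_mono Pf (leqnn 0) le0) => n s0 s1 t0 t1.
by rewrite /sdeg muln0 !expr0 !mulr1.
Qed.

Lemma hformZ d e f h : polyfun f -> hform d e h ->
  hform d e (fun n s0 s1 t0 t1 => f n * h n s0 s1 t0 t1).
Proof. by move=> Pf; apply: hformM (hform_const Pf). Qed.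

Lemma hform_sum d e (T : Type) (r : seq T) (P : pred T) (F : T -> fam) :
  (forall x, P x -> hform d e (F x)) ->
  hform d e (fun n s0 s1 t0 t1 => \sum_(x <- r | P x) F x n s0 s1 t0 t1).
Proof.
move=> PF; elim: r => [|x r IHr].
  by apply: hform_ext (hform0 _ _) => *; rewrite big_nil.
have [Px|nPx] := boolP (P x).
  by apply: hform_ext (hformD (PF _ Px) IHr) => *; rewrite big_cons Px.
by apply: hform_ext IHr => *; rewrite big_cons (negPf nPx).
Qed.

Lemma hformX d e h k : hform d e h ->
  hform (k * d) (k * e) (fun n s0 s1 t0 t1 => h n s0 s1 t0 t1 ^+ k).
Proof.
move=> Ph; elim: k => [|k IHk].
  by apply: hform_ext (hform_const (polyfun_const _ 1)) => *; rewrite expr0.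
by apply: hform_ext (hformM Ph IHk) => *; rewrite exprS.
Qed.

Lemma hform_prod d e (T : Type) (r : seq T) (m : T -> nat) (F : T -> fam) k :
  (forall x, hform d e (F x)) -> (\sum_(x <- r) m x)%N = k ->
  hform (k * d) (k * e) (fun n s0 s1 t0 t1 => \prod_(x <- r) F x n s0 s1 t0 t1 ^+ m x).
Proof.
move=> PF <-; elim: r => [|x r IHr].
  rewrite big_nil.
  by apply: hform_ext (hform_const (polyfun_const _ 1)) => *; rewrite big_nil.
rewrite big_cons !mulnDl.
by apply: hform_ext (hformM (hformX (m x) (PF x)) IHr) => *; rewrite big_cons.
Qed.

(* The coefficients in t0, t1, dehomogenized by s0 = 1, s1 = 'X. *)
Lemma hform_coefs d e h : hform d e h ->
  exists A : nat -> (I -> K) -> {poly K},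
    [/\ forall j, polyfam (A j),
        forall j n, (size (A j n) <= (sdeg d e j).+1)%N,
        forall n s t0 t1, h n 1 s t0 t1 = hval e (fun j => (A j n).[s]) t0 t1 &
        forall n t0 t1, h n 0 1 t0 t1 = hval e (fun j => (A j n)`_(sdeg d e j)) t0 t1].
Proof.
elim=> [|f i j Pf le_je le_i|g1 g2 _ [A [PA sA eA eA']] _ [B [PB sB eB eB']]
        |g1 g2 eqg _ [A [PA sA eA eA']]].
- exists (fun _ _ => 0); split=> [j|j n|n s t0 t1|n t0 t1].
  + exact: polyfam_const.
  + by rewrite size_poly0.
  + by rewrite /hval big1 // => j _; rewrite horner0 !mul0r.
  by rewrite /hval big1 // => j _; rewrite coef0 !mul0r.
- have lt_je : (j < e.+1)%N by [].
  exists (fun j' n => if j' == j then f n *: 'X^i else 0); split=> [j'|j' n|n s t0 t1|n t0 t1].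
  + have [_|_] := eqVneq j' j; last exact: polyfam_const.
    by apply: polyfamZ => //; apply: polyfam_const.
  + have [->|_] := eqVneq j' j; last by rewrite size_poly0.
    by rewrite (leq_trans (size_scale_leq _ _)) // size_polyXn.
  + rewrite /hval (bigD1 (Ordinal lt_je)) //= eqxx hornerZ hornerXn big1.
      by rewrite expr1n mul1r addr0 !mulrA.
    by move=> j' /negPf; rewrite -val_eqE /= => ->; rewrite horner0 !mul0r.
  rewrite /hval (bigD1 (Ordinal lt_je)) //= eqxx big1 ?addr0.
    rewrite -mul_polyC coefCM coefXn expr1n mulr1 eqn_leq le_i andbT expr0n subn_eq0 !mulrA.
    by [].
  by move=> j' /negPf; rewrite -val_eqE /= => ->; rewrite coef0 !mul0r.
- exists (fun j n => A j n + B j n); split=> [j|j n|n s t0 t1|n t0 t1].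
  + exact: polyfamD.
  + by rewrite (leq_trans (size_polyD _ _)) // geq_max sA sB.
  + rewrite eA eB /hval -big_split; apply: eq_bigr => j _.
    by rewrite /= hornerD !mulrDl.
  rewrite eA' eB' /hval -big_split; apply: eq_bigr => j _.
  by rewrite /= coefD !mulrDl.
by exists A; split=> // *; rewrite -eqg.
Qed.

End HirzebruchForms.

Lemma polyfam_det (K : fieldType) (I : Type) n (F : (I -> K) -> 'M[{poly K}]_n) :
  (forall i j, polyfam (fun v => F v i j)) -> polyfam (fun v => \det (F v)).
Proof.
move=> PF; apply: polyfam_sum => s _; apply: polyfamM; first exact: polyfam_const.
by apply: polyfam_prod.
Qed.

(** The bound is the intersection number on F_omega of the classes (d1, e1) and (d2, e2). It equals
    24 for (0, 3) and (0, 4) on F_2, and for (3, 3) and (4, 4) on F_0. *)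
Lemma size_det_sylv (K : fieldType) omega d1 e1 d2 e2 (A B : nat -> {poly K}) :
  (forall j, (size (A j) <= (sdeg omega d1 e1 j).+1)%N) ->
  (forall j, (size (B j) <= (sdeg omega d2 e2 j).+1)%N) ->
  (size (\det (sylv e1 e2 A B)) <= (e2 * d1 + e1 * d2 + omega * (e1 * e2)).+1)%N.
Proof.
move=> sA sB.
(* Row i of a block is shifted by i places, which raises its weight by omega * i against the column
   weight omega * j. *)
pose r (i : 'I_(e2 + e1)) := match split i with
  | inl i => (d1 + omega * e1 + omega * i)%N | inr i => (d2 + omega * e2 + omega * i)%N end.
apply: (@size_det_weighted _ _ _ r (fun j => omega * j)%N) => [i j|].
  rewrite /r /sylv mxE; case: (split i) => {}i; rewrite mxE; case: ifP; rewrite ?eqxx // => /andP[le_ij le_j] _.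
    apply: leq_trans (leq_add (sA _) (leqnn _)) _.
    rewrite addSn ltnS /sdeg -!addnA leq_add2l -!mulnDr leq_mul2l.
    by apply/orP; right; move: (nat_of_ord i) (nat_of_ord j) le_ij le_j => *; lia.
  apply: leq_trans (leq_add (sB _) (leqnn _)) _.
  rewrite addSn ltnS /sdeg -!addnA leq_add2l -!mulnDr leq_mul2l.
  by apply/orP; right; move: (nat_of_ord i) (nat_of_ord j) le_ij le_j => *; lia.
rewrite !big_split_ord /=.
rewrite (eq_bigr (fun i : 'I_e2 => d1 + omega * e1 + omega * i)%N); last first.
  by move=> i _; rewrite /r (unsplitK (inl i)).
rewrite [X in (_ + X)%N](eq_bigr (fun i : 'I_e1 => d2 + omega * e2 + omega * i)%N); last first.
  by move=> i _; rewrite /r (unsplitK (inr i)).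
rewrite [X in _ = (_ + (_ + X))%N](eq_bigr (fun i : 'I_e1 => omega * e2 + omega * i)%N); last first.
  by move=> i _; rewrite mulnDr.
rewrite !big_split /= !sum_nat_const !card_ord.
move: (\sum_(i < e2) _)%N (\sum_(i < e1) _)%N => x y; nia.
Qed.

Lemma veronese_indep (K : fieldType) n (t0 t1 u0 u1 : K) : (1 < n)%N ->
  (t0, t1) != (0, 0) -> (u0, u1) != (0, 0) -> t0 * u1 != t1 * u0 ->
  \rank (row_mx (veronese n t0 t1) (veronese n u0 u1)) = 2.
Proof.
move=> n_gt1 tn0 un0 neq.
case: n n_gt1 => [//|n]; rewrite ltnS => n_gt0.
rewrite -mxrank_tr; apply/eqP; rewrite -[_ == _]/(row_free _).
apply: inj_row_free => v v0.
pose x := lsubmx v 0 0; pose y := rsubmx v 0 0.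
have rel (i : 'I_n.+1) : x * (t0 ^+ (n - i) * t1 ^+ i) + y * (u0 ^+ (n - i) * u1 ^+ i) = 0.
  have := congr1 (fun w : 'rV_ _ => w 0 i) v0.
  by rewrite tr_row_mx -{1}[v]hsubmxK mul_row_col /x /y !mxE !big_ord1 !mxE.
suff [x0 y0] : x = 0 /\ y = 0.
  rewrite -[v]hsubmxK; apply/rowP => i; rewrite !mxE; case: (split i) => j; rewrite ord1 mxE.
    by rewrite -[RHS]x0 /x mxE.
  by rewrite -[RHS]y0 /y mxE.
have solve (a b c d : K) : a * d != b * c -> x * a + y * c = 0 -> x * b + y * d = 0 -> x = 0 /\ y = 0.
  move=> nz eq1 eq2.
  have xz : x * (a * d - b * c) = 0.
    have -> : x * (a * d - b * c) = (x * a + y * c) * d - (x * b + y * d) * c by ring.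
    by rewrite eq1 eq2 !mul0r subrr.
  have yz : y * (a * d - b * c) = 0.
    have -> : y * (a * d - b * c) = (x * b + y * d) * a - (x * a + y * c) * b by ring.
    by rewrite eq1 eq2 !mul0r subrr.
  by move/eqP: xz; move/eqP: yz; rewrite !mulf_eq0 subr_eq0 (negPf nz) !orbF => /eqP -> /eqP ->.
have lt1 : (1 < n.+1)%N by [].
have := rel ord0; have := rel (Ordinal lt1); have := rel ord_max.
rewrite /= subn0 subnn !expr0 !expr1 !mulr1 !mul1r => relm rel1 rel0.
(* A nonzero 2 x 2 minor: the first and last entries if one of the points is (0 : 1), the first two
   entries otherwise. *)
have [t00|t0n0] := eqVneq t0 0.
  have t1n0 : t1 != 0 by move: tn0; rewrite t00 xpair_eqE eqxx.
  have u0n0 : u0 != 0 by apply: contraNneq neq => ->; rewrite t00 mul0r mulr0.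
  apply: solve rel0 relm.
  rewrite t00 expr0n -[n == 0%N]negbK -lt0n n_gt0 mul0r eq_sym.
  by rewrite mulf_neq0 ?expf_neq0.
have [u00|u0n0] := eqVneq u0 0.
  have u1n0 : u1 != 0 by move: un0; rewrite u00 xpair_eqE eqxx.
  apply: solve rel0 relm.
  rewrite u00 expr0n -[n == 0%N]negbK -lt0n n_gt0 mulr0.
  by rewrite mulf_neq0 ?expf_neq0.
apply: solve rel0 rel1.
have -> : t0 ^+ n = t0 ^+ (n - 1) * t0 by rewrite -exprSr subn1 prednK.
have -> : u0 ^+ n = u0 ^+ (n - 1) * u0 by rewrite -exprSr subn1 prednK.
rewrite -subr_eq0.
have -> : t0 ^+ (n - 1) * t0 * (u0 ^+ (n - 1) * u1) - t0 ^+ (n - 1) * t1 * (u0 ^+ (n - 1) * u0) =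
  t0 ^+ (n - 1) * u0 ^+ (n - 1) * (t0 * u1 - t1 * u0) by ring.
by rewrite !mulf_neq0 ?expf_neq0 // subr_eq0.
Qed.

Lemma separable_polyZ (K : fieldType) (c : K) (p : {poly K}) :
  c != 0 -> separable_poly (c *: p) = separable_poly p.
Proof. by move=> cn0; apply: eqp_separable; apply: eqp_scale. Qed.

Section CountZeros.
Variables (K : numClosedFieldType) (I : Type) (omega d1 e1 d2 e2 : nat).
Variables (a b : (I -> K) -> K -> K -> K -> K -> K).
Hypotheses (Pa : hform omega d1 e1 a) (Pb : hform omega d2 e2 b).
Hypotheses (e1_gt0 : (0 < e1)%N) (e2_gt0 : (0 < e2)%N).
Let N := (e2 * d1 + e1 * d2 + omega * (e1 * e2))%N.
Hypothesis N_gt0 : (0 < N)%N.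

Definition common_zero n s0 s1 t0 t1 :=
  [/\ (t0, t1) != (0, 0), a n s0 s1 t0 t1 = 0 & b n s0 s1 t0 t1 = 0].

(** Eliminating t leaves a polynomial in s of degree at most N. The empty fibre over [x1] shows that
    it is not zero at [n1], and the N values in [S] then force full degree and simple roots; both
    persist where the leading coefficient and the discriminant do not vanish. *)
Theorem generic_count_zeros n1 (S : seq K) x1 :
    uniq S -> size S = N ->
    (forall s, s \in S -> exists t0 t1, common_zero n1 1 s t0 t1) ->
    (forall t0 t1, ~ common_zero n1 1 x1 t0 t1) ->
    (forall t0 t1, ~ common_zero n1 0 1 t0 t1) ->
  exists2 G, polyfun G /\ G n1 != 0 & forall n, G n != 0 ->
    (forall t0 t1, ~ common_zero n 0 1 t0 t1) /\
    exists (Z : seq K) (u : K -> K * K), [/\ uniq Z, size Z = N,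
      forall s, s \in Z -> common_zero n 1 s (u s).1 (u s).2 &
      forall s t0 t1, common_zero n 1 s t0 t1 -> s \in Z /\ t0 * (u s).2 = t1 * (u s).1].
Proof.
move=> uS sS zS nz1 nzinf.
have [A [PA sA eA eA']] := hform_coefs Pa; have [B [PB sB eB eB']] := hform_coefs Pb.
have e_gt0 : (0 < e2 + e1)%N by rewrite addn_gt0 e1_gt0 orbT.
pose Delta n := \det (sylv e1 e2 (A^~ n) (B^~ n)).
have PDelta : polyfam Delta.
  apply: polyfam_det => i j.
  have PS k m (C : nat -> (I -> K) -> {poly K}) (i0 : 'I_k) : (forall j, polyfam (C j)) ->
      polyfam (fun n => shifts k (e2 + e1) m (C^~ n) i0 j).
    move=> PC; apply: (@polyfam_ext _ _ _ (fun n => if (i0 <= j <= i0 + m)%N then C (j - i0)%N n else 0)).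
      by move=> n; rewrite mxE.
    case: (_ <= _ <= _)%N => //; apply: polyfam_const.
  rewrite -(splitK i); case: (split i) => i0 /=.
    by have := PS e2 e1 A i0 PA; apply: polyfam_ext => n; rewrite /sylv col_mxEu.
  by have := PS e1 e2 B i0 PB; apply: polyfam_ext => n; rewrite /sylv col_mxEd.
have sDelta n : (size (Delta n) <= N.+1)%N by apply: size_det_sylv.
have DeltaE n s : (Delta n).[s] = \det (sylv e1 e2 (fun j => (A j n).[s]) (fun j => (B j n).[s])).
  by rewrite -[LHS]/(horner_eval s (Delta n)) -det_map_mx map_sylv.
have zeroP n s : reflect (exists t0 t1, common_zero n 1 s t0 t1) ((Delta n).[s] == 0).
  rewrite DeltaE; apply: (iffP (sylv_eq0 _ _ e_gt0)) => -[t0 [t1 [tn0 a0 b0]]];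
    by exists t0, t1; split=> //; rewrite ?eA ?eB // -?eA -?eB.
(* The discriminant as a resultant of formal degrees N and N - 1. It detects multiple roots only if
   the coefficient of degree N is nonzero, so that coefficient is a factor of the final polynomial
   too; [einf] does the same for the fibre s0 = 0. *)
pose disc n := \det (sylv N N.-1 (fun j => (Delta n)`_j) (fun j => (Delta n)^`()`_j)).
pose einf n := \det (sylv e1 e2 (fun j => (A j n)`_(sdeg omega d1 e1 j))
                                (fun j => (B j n)`_(sdeg omega d2 e2 j))).
have infP n : reflect (exists t0 t1, common_zero n 0 1 t0 t1) (einf n == 0).
  apply: (iffP (sylv_eq0 _ _ e_gt0)) => -[t0 [t1 [tn0 a0 b0]]];
    by exists t0, t1; split=> //; rewrite ?eA' ?eB' // -?eA' -?eB'.
have Psylv k m (C D : nat -> (I -> K) -> K) : (forall j, polyfun (C j)) ->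
    (forall j, polyfun (D j)) -> polyfun (fun n => \det (sylv m k (C^~ n) (D^~ n))).
  move=> PC PD; apply: polyfun_det => i j.
  have PS k0 m0 (E : nat -> (I -> K) -> K) (i0 : 'I_k0) : (forall j, polyfun (E j)) ->
      polyfun (fun n => shifts k0 (k + m) m0 (E^~ n) i0 j).
    move=> PE; apply: (@polyfun_ext _ _ (fun n => if (i0 <= j <= i0 + m0)%N then E (j - i0)%N n else 0)).
      by move=> n; rewrite mxE.
    case: (_ <= _ <= _)%N => //; apply: polyfun_const.
  rewrite -(splitK i); case: (split i) => i0 /=.
    by have := PS k m C i0 PC; apply: polyfun_ext => n; rewrite /sylv col_mxEu.
  by have := PS m k D i0 PD; apply: polyfun_ext => n; rewrite /sylv col_mxEd.
have Pcoef j (C : (I -> K) -> {poly K}) : polyfam C -> polyfun (fun n => (C n)`_j).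
  by move=> PC; apply: polyfun_ext (polyfam_scalar (coefp j) PC).
have Pdisc : polyfun disc.
  apply: Psylv => j; first exact: Pcoef.
  by apply: Pcoef; apply: (polyfam_linear (@deriv K)).
have Peinf : polyfun einf by apply: Psylv => j; apply: Pcoef.
have hval_poly (p : {poly K}) m t : (size p <= m.+1)%N -> hval m (fun j => p`_j) 1 t = p.[t].
  move=> sp; rewrite (horner_coef_wide _ sp) /hval; apply: eq_bigr => j _.
  by rewrite expr1n mulr1.
have hval01 m (c : nat -> K) t : hval m c 0 t = c m * t ^+ m.
  rewrite /hval big_ord_recr /= subnn expr0 mulr1 big1 ?add0r // => j _.
  by rewrite expr0n subn_eq0 leqNgt ltn_ord mulr0 mul0r.
have hvalZ m (c : nat -> K) t0 t1 : t0 != 0 -> hval m c t0 t1 = t0 ^+ m * hval m c 1 (t1 / t0).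
  move=> t0n0; rewrite /hval mulr_sumr; apply: eq_bigr => j _.
  have le_jm : (j <= m)%N by rewrite -ltnS.
  have -> : t0 ^+ m = t0 ^+ (m - j) * t0 ^+ j by rewrite -exprD subnK.
  rewrite expr1n mulr1 expr_div_n mulrCA -!mulrA [t0 ^+ j * _]mulrC divfK ?expf_neq0 //.
have discP n : (Delta n)`_N != 0 -> (disc n != 0) = separable_poly (Delta n).
  move=> lead.
  have sD : size (Delta n) = N.+1.
    by apply/eqP; rewrite eqn_leq sDelta ltnNge; apply: contraNN lead => /(nth_default 0) ->.
  have sD' : (size (Delta n)^`() <= N.-1.+1)%N.
    by rewrite prednK // -ltnS -sD lt_size_deriv // -size_poly_eq0 sD.
  have NN_gt0 : (0 < N.-1 + N)%N by rewrite addn_gt0 N_gt0 orbT.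
  apply/idP/idP => [nd|sep].
    rewrite unlock; apply: Pdiv.ClosedField.root_coprimep => t /rootP r1; apply: contraNneq nd => r2.
    apply/(sylv_eq0 _ _ NN_gt0); exists 1, t.
    by rewrite xpair_eqE oner_eq0 !hval_poly ?sD.
  have sep' : coprimep (Delta n) (Delta n)^`() by rewrite unlock in sep.
  apply/negP => /(sylv_eq0 _ _ NN_gt0)[t0 [t1 [tn0]]].
  have [t00|t0n0] := eqVneq t0 0.
    move: tn0; rewrite t00 xpair_eqE eqxx hval01 /= => t1n0 /eqP.
    by rewrite mulf_eq0 (negPf lead) expf_eq0 (negPf t1n0) andbF.
  rewrite ![hval _ _ t0 t1]hvalZ // !hval_poly ?sD // => /eqP; rewrite mulf_eq0 expf_eq0 (negPf t0n0) andbF /= => /eqP r1.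
  move=> /eqP; rewrite mulf_eq0 expf_eq0 (negPf t0n0) andbF /= => /rootP r2.
  by have := coprimep_root sep' (introT rootP r1); rewrite r2 eqxx.
exists (fun n => (Delta n)`_N * disc n * einf n).
  split; first by apply: polyfunM => //; apply: polyfunM => //; apply: Pcoef.
  have Dn0 : Delta n1 != 0.
    apply/eqP => D0; have /zeroP[t0 [t1 z]] : (Delta n1).[x1] == 0 by rewrite D0 horner0.
    exact: nz1 z.
  have rootS : all (root (Delta n1)) S.
    by apply/allP => s /zS z; rewrite rootE; apply/zeroP.
  have sD : size (Delta n1) = N.+1.
    by apply/eqP; rewrite eqn_leq sDelta -sS max_poly_roots.
  have lead : (Delta n1)`_N != 0 by rewrite -[N]/(N.+1.-1) -sD -lead_coefE lead_coef_eq0.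
  have DE : Delta n1 = lead_coef (Delta n1) *: \prod_(z <- S) ('X - z%:P).
    by apply: all_roots_prod_XsubC; rewrite ?sD ?sS // uniq_rootsE.
  rewrite !mulf_neq0 ?discP //.
    by rewrite DE separable_polyZ ?lead_coef_eq0 // separable_prod_XsubC.
  by apply/infP => -[t0 [t1 /nzinf]].
move=> n; rewrite !mulf_eq0 !negb_or => /andP[/andP[lead]].
rewrite discP // => sep /infP nzi; split=> [t0 t1 z|]; first by apply: nzi; exists t0, t1.
have [Z DE] := closed_field_poly_normal (Delta n).
have Dn0 : Delta n != 0 by apply: contraNneq lead => ->; rewrite coef0.
have sD : size (Delta n) = N.+1.
  by apply/eqP; rewrite eqn_leq sDelta ltnNge; apply: contraNN lead => /(nth_default 0) ->.
have /choice[u uP] : forall s, exists t : K * K, s \in Z -> common_zero n 1 s t.1 t.2.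
  move=> s; have [sZ|_] := boolP (s \in Z); last by exists (0, 0).
  have /zeroP[t0 [t1 z]] : (Delta n).[s] == 0.
    by rewrite DE hornerZ mulf_eq0 -[X in _ || X]/(root _ s) root_prod_XsubC sZ orbT.
  by exists (t0, t1).
exists Z, u; split=> //.
- by move: sep; rewrite DE separable_polyZ ?lead_coef_eq0 // separable_prod_XsubC.
- by move: sD; rewrite DE size_scale ?lead_coef_eq0 // size_prod_XsubC => -[].
move=> s t0 t1 z.
have Ds : (Delta n).[s] = 0 by apply/eqP/zeroP; exists t0, t1.
have sZ : s \in Z.
  move/eqP: Ds; rewrite DE hornerZ mulf_eq0 lead_coef_eq0 (negPf Dn0) /=.
  by rewrite -rootE root_prod_XsubC.
split=> //; apply/eqP; apply: contraT => neq.
(* A second zero over s would give two independent Veronese vectors in the kernel of the Sylvester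
   matrix at s, hence a square factor of [Delta n], against separability. *)
have [un0 ua ub] := uP s sZ; have [tn0 ta tb] := z.
have e_gt1 : (1 < e2 + e1)%N by lia.
pose M := sylv e1 e2 (A^~ n) (B^~ n).
pose M0 := map_mx (horner_eval s) M.
pose W := row_mx (veronese (e2 + e1) t0 t1) (veronese (e2 + e1) (u s).1 (u s).2).
have MW : M0 *m W = 0.
  rewrite /M0 /M map_sylv mul_mx_row -[RHS]row_mx0; congr row_mx; apply: sylv_veronese; by rewrite -?eA -?eB.
have rW : \rank W = 2 by apply: veronese_indep => //; rewrite -surjective_pairing.
have := mulmx0_rank_max MW; rewrite rW => rM.
have : ('X - s%:P) ^+ 2 %| Delta n.
  apply: dvdp_trans (dvdp_det_corank M s); apply: dvdp_exp2l.
  by rewrite leq_subRL ?rank_leq_row // addnC.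
by rewrite (separable_nosquare sep) // size_XsubC.
Qed.

End CountZeros.

Lemma meval_exp (R : comNzRingType) n (p : {mpoly R[n]}) k (v : 'I_n -> R) :
  (p ^+ k).@[v] = p.@[v] ^+ k.
Proof. by elim: k => [|k IHk]; rewrite ?expr0 ?meval1 // !exprS mevalM IHk. Qed.

(** * The normal form *)

Section NormalForm.
Variable K : numClosedFieldType.

Definition cone_form (a b c : {mpoly K[4]}) : {mpoly K[5]} :=
  'X_ord0 ^+ 2 * (a \mPo z_vars K) + 'X_ord0 * (b \mPo z_vars K) + (c \mPo z_vars K).

Definition zpart (v : 'rV[K]_5) : 'rV[K]_4 := \row_i v 0 (lift ord0 i).

Lemma meval_z_vars (p : {mpoly K[4]}) (v : 'rV[K]_5) :
  (p \mPo z_vars K).@[v 0] = p.@[zpart v 0].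
Proof.
rewrite comp_mpoly_meval; apply: meval_eq => i.
by rewrite tnth_mktuple mevalXU mxE.
Qed.

Lemma meval_cone_form a b c (v : 'rV[K]_5) : (cone_form a b c).@[v 0] =
  v 0 0 ^+ 2 * a.@[zpart v 0] + v 0 0 * b.@[zpart v 0] + c.@[zpart v 0].
Proof.
by rewrite /cone_form !mevalD !mevalM !meval_z_vars ?meval_exp !mevalXU.
Qed.

Lemma cone_form_homog a b c :
  a \is 2.-homog -> b \is 3.-homog -> c \is 4.-homog -> cone_form a b c \is 4.-homog.
Proof.
have homz d p : p \is d.-homog -> p \mPo z_vars K \is d.-homog.
  apply: comp_mpoly_homog => i; rewrite tnth_mktuple dhomogX; apply/eqP; exact: mdeg1.
have homX : 'X_ord0 \is [in K[5], 1.-homog] by rewrite dhomogX; apply/eqP; exact: mdeg1.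
move=> ha hb hc; apply: rpredD; last exact: homz.
apply: rpredD; first exact: (dhomogM (dhomogMn 2 homX) (homz _ _ ha)).
exact: (dhomogM homX (homz _ _ hb)).
Qed.

(* A parameter is the coefficient of y_j in one of the four linear forms lform n k,
   or that of a monomial of degree 3 or 4 in (z1, y) of degree at most 1 in z1; the
   remaining monomials are unused.  The tangent cone of the normal quartic
   at (0 : 1 : 0 : 0 : 0) is (x0 + l0)(x0 + l1) + l2 l3. *)
Definition params : Type := ('I_4 * 'I_3) + 'X_{1..4 < 5}.
HB.instance Definition _ := Finite.on params.

Implicit Types n : params -> K.

Definition lform n k : {mpoly K[4]} := \sum_(i < 3) n (inl (k, i)) *: 'X_(lift ord0 i).

Definition low_form n d : {mpoly K[4]} :=
  \sum_(m : 'X_{1..4 < 5} | (mdeg m == d) && (m ord0 <= 1)%N) n (inr m) *: 'X_[m].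

(** A form equivalent to [q2], with two squares replaced by a product so that its zeros are
    parametrized by monomials up to sign. *)
Definition nq2 : {mpoly K[4]} := 'X_ord0 ^+ 2 + 'X_(inord 1) * 'X_(inord 2).
Definition nq3 n : {mpoly K[4]} :=
  'X_ord0 ^+ 2 * (lform n 0 + lform n 1) + low_form n 3.
Definition nq4 n : {mpoly K[4]} :=
  'X_ord0 ^+ 2 * (lform n 0 * lform n 1 + lform n (inord 2) * lform n (inord 3)) + low_form n 4.

Definition normal_quartic n : {mpoly K[5]} := cone_form nq2 (nq3 n) (nq4 n).

Lemma nq2_homog : nq2 \is 2.-homog.
Proof.
have hX i : 'X_i \is [in K[4], 1.-homog] by rewrite dhomogX; apply/eqP; exact: mdeg1.
by apply: rpredD; [exact: (dhomogMn 2 (hX _))|exact: (dhomogM (hX _) (hX _))].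
Qed.

Lemma lform_homog n k : lform n k \is 1.-homog.
Proof.
apply: rpred_sum => i _; apply: dhomogZ; rewrite dhomogX; apply/eqP; exact: mdeg1.
Qed.

Lemma low_form_homog n d : low_form n d \is d.-homog.
Proof. by apply: rpred_sum => m /andP[md _]; apply: dhomogZ; rewrite dhomogX. Qed.

Lemma nq3_homog n : nq3 n \is 3.-homog.
Proof.
have hX i : 'X_i \is [in K[4], 1.-homog] by rewrite dhomogX; apply/eqP; exact: mdeg1.
apply: rpredD; last exact: low_form_homog.
by apply: (dhomogM (dhomogMn 2 (hX _))); apply: rpredD; apply: lform_homog.
Qed.

Lemma nq4_homog n : nq4 n \is 4.-homog.
Proof.
have hX i : 'X_i \is [in K[4], 1.-homog] by rewrite dhomogX; apply/eqP; exact: mdeg1.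
apply: rpredD; last exact: low_form_homog.
apply: (dhomogM (dhomogMn 2 (hX _))).
by apply: rpredD; apply: (dhomogM (lform_homog _ _) (lform_homog _ _)).
Qed.

Lemma polyfam_lform k : polyfam (fun n => lform n k).
Proof.
by apply: polyfam_sum => i _; apply: polyfamZ; [apply: polyfun_var|apply: polyfam_const].
Qed.

Lemma polyfam_low_form d : polyfam (fun n => low_form n d).
Proof.
by apply: polyfam_sum => i _; apply: polyfamZ; [apply: polyfun_var|apply: polyfam_const].
Qed.

Lemma polyfam_nq3 : polyfam nq3.
Proof.
apply: polyfamD (polyfam_low_form _); apply: polyfamM; first exact: polyfam_const.
by apply: polyfamD; apply: polyfam_lform.
Qed.

Lemma polyfam_nq4 : polyfam nq4.
Proof.
apply: polyfamD (polyfam_low_form _); apply: polyfamM; first exact: polyfam_const.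
by apply: polyfamD; apply: polyfamM; apply: polyfam_lform.
Qed.

Lemma polyfam_normal_quartic : polyfam normal_quartic.
Proof.
apply: polyfamD; last exact: (polyfam_linear (comp_mpoly (z_vars K)) polyfam_nq4).
apply: polyfamD; first exact: polyfam_const.
apply: polyfamM; first exact: polyfam_const.
exact: (polyfam_linear (comp_mpoly (z_vars K)) polyfam_nq3).
Qed.

(* Coordinates (x, y) on P^3, the space of lines through o2 = (0 : 1 : 0 : 0 : 0). *)
Definition lval n k (y : 'I_3 -> K) : K := \sum_(i < 3) n (inl (k, i)) * y i.

Definition low_val n d e (y : 'I_3 -> K) : K :=
  \sum_(m : 'X_{1..4 < 5} | (mdeg m == d) && (m ord0 == e))
     n (inr m) * \prod_(i < 3) y i ^+ m (lift ord0 i).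

Definition cone2 n x y : K :=
  (x + lval n 0 y) * (x + lval n 1 y) + lval n (inord 2) y * lval n (inord 3) y.
Definition cone3 n x y : K := x * low_val n 3 1 y + low_val n 4 1 y.
(** The summand with [x ^+ 2] comes from the product in [nq2], which has no z1; the square in [nq2]
    contributes to [cone2]. *)
Definition cone4 n x y : K :=
  x ^+ 2 * (y 0 * y 1) + x * low_val n 3 0 y + low_val n 4 0 y.

Definition ypart (z : 'rV[K]_4) (i : 'I_3) : K := z 0 (lift ord0 i).

Lemma meval_lform n k (z : 'rV[K]_4) : (lform n k).@[z 0] = lval n k (ypart z).
Proof.
by rewrite raddf_sum /=; apply: eq_bigr => i _; rewrite mevalZ mevalXU.
Qed.

Lemma meval_low_form n d (z : 'rV[K]_4) :
  (low_form n d).@[z 0] = z 0 0 * low_val n d 1 (ypart z) + low_val n d 0 (ypart z).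
Proof.
rewrite raddf_sum /= (bigID (fun m : 'X_{1..4 < 5} => m ord0 == 1%N)) /=; congr (_ + _).
  rewrite mulr_sumr; apply: eq_big => [m|m /andP[_ /eqP m1]].
    by case: (m ord0) => [|[|l]]; rewrite ?andbF ?andbT.
  by rewrite mevalZ mevalX big_ord_recl m1 expr1 mulrCA.
apply: eq_big => [m|m /andP[/andP[_ lem] nm]].
  by case: (m ord0) => [|[|l]]; rewrite ?andbF ?andbT.
have m0 : m ord0 = 0%N by case: (m ord0) lem nm => [|[|l]].
by rewrite mevalZ mevalX big_ord_recl m0 expr0 mul1r.
Qed.

Lemma meval_nq2 (z : 'rV[K]_4) : nq2.@[z 0] = z 0 0 ^+ 2 + ypart z 0 * ypart z 1.
Proof.
rewrite /nq2.
have -> : inord 1 = lift ord0 0 :> 'I_4 by apply: val_inj; rewrite /= inordK.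
have -> : inord 2 = lift ord0 1 :> 'I_4 by apply: val_inj; rewrite /= inordK.
by rewrite mevalD !mevalM !mevalXU.
Qed.

Lemma meval_nq3 n (z : 'rV[K]_4) : (nq3 n).@[z 0] =
  z 0 0 ^+ 2 * (lval n 0 (ypart z) + lval n 1 (ypart z)) +
  (z 0 0 * low_val n 3 1 (ypart z) + low_val n 3 0 (ypart z)).
Proof.
by rewrite /nq3 mevalD mevalM mevalD ?meval_exp !mevalXU !meval_lform meval_low_form.
Qed.

Lemma meval_nq4 n (z : 'rV[K]_4) : (nq4 n).@[z 0] =
  z 0 0 ^+ 2 * (lval n 0 (ypart z) * lval n 1 (ypart z) +
    lval n (inord 2) (ypart z) * lval n (inord 3) (ypart z)) +
  (z 0 0 * low_val n 4 1 (ypart z) + low_val n 4 0 (ypart z)).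
Proof.
by rewrite /nq4 mevalD mevalM mevalD !mevalM ?meval_exp !mevalXU !meval_lform meval_low_form.
Qed.

Lemma meval_normal_quartic n (v : 'rV[K]_5) : (normal_quartic n).@[v 0] =
  let x := v 0 0 in let z := zpart v 0 0 in let y := ypart (zpart v) in
  z ^+ 2 * cone2 n x y + z * cone3 n x y + cone4 n x y.
Proof.
rewrite /normal_quartic meval_cone_form meval_nq2 meval_nq3 meval_nq4 /=.
by rewrite /cone2 /cone3 /cone4; ring.
Qed.

Lemma lvalZ n k c y : lval n k (fun i => c * y i) = c * lval n k y.
Proof. by rewrite /lval mulr_sumr; apply: eq_bigr => i _; rewrite mulrCA. Qed.

Lemma low_valZ n d e c y : (e <= d)%N ->
  low_val n d e (fun i => c * y i) = c ^+ (d - e) * low_val n d e y.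
Proof.
move=> le_ed; rewrite /low_val mulr_sumr; apply: eq_bigr => m /andP[/eqP md /eqP m0].
rewrite mulrCA; congr (_ * _).
have -> : (d - e = \sum_(i < 3) m (lift ord0 i))%N.
  by move: (mdegE m); rewrite md [X in d = X -> _]big_ord_recl m0 => ->; rewrite addKn.
by rewrite expr_sum -big_split; apply: eq_bigr => i _; rewrite exprMn.
Qed.

Lemma cone2Z n c x y : cone2 n (c * x) (fun i => c * y i) = c ^+ 2 * cone2 n x y.
Proof. by rewrite /cone2 !lvalZ; ring. Qed.

Lemma cone3Z n c x y : cone3 n (c * x) (fun i => c * y i) = c ^+ 3 * cone3 n x y.
Proof. by rewrite /cone3 !low_valZ //=; ring. Qed.

Lemma cone4Z n c x y : cone4 n (c * x) (fun i => c * y i) = c ^+ 4 * cone4 n x y.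
Proof. by rewrite /cone4 !low_valZ //=; ring. Qed.

End NormalForm.

(** A cone Z with exactly N points in projective space, given by pairwise nonproportional
    representatives. Vectors are easier to carry through matrices than subspaces are; they become
    points or lines only at the end. *)
Definition represented (K : fieldType) N d (Z : 'rV[K]_d -> Prop) : Prop :=
  exists w : 'I_N -> 'rV[K]_d,
    [/\ forall i, w i != 0 /\ Z (w i), forall i j c, w i = c *: w j -> i = j &
        forall v, v != 0 -> Z v -> exists i c, v = c *: w i].

Lemma unity_roots (K : numClosedFieldType) N : (0 < N)%N ->
  exists S : seq K, [/\ uniq S, size S = N & forall s, s \in S -> s ^+ N = 1].
Proof.
move=> N_gt0; have [S SE] := closed_field_poly_normal ('X^N - 1 : {poly K}).
have lead : lead_coef ('X^N - 1 : {poly K}) = 1 by rewrite lead_coefXnsubC.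
rewrite lead scale1r in SE; exists S; split.
- by rewrite -separable_prod_XsubC -SE separable_Xn_sub_1 // pnatr_eq0 -lt0n.
- have := size_XnsubC (1 : K) N_gt0; rewrite SE size_prod_XsubC; by case.
move=> s; rewrite -root_prod_XsubC -SE rootE !hornerE => /eqP/eqP.
by rewrite subr_eq0 => /eqP.
Qed.

Lemma mcoeff_pihomog (R : comNzRingType) k d (p : {mpoly R[k]}) m :
  (pihomog mdeg d p)@_m = if mdeg m == d then p@_m else 0.
Proof.
rewrite pihomogE raddf_sum /=.
have [md|nmd] := ifPn.
  have [mr|nmr] := boolP (m \in msupp p).
    rewrite -big_filter (bigD1_seq m) ?filter_uniq ?msupp_uniq ?mem_filter ?md //=.
    rewrite mcoeffZ mcoeffX eqxx mulr1 big1 ?addr0 // => l nl.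
    by rewrite mcoeffZ mcoeffX (negPf nl) mulr0.
  rewrite (memN_msupp_eq0 nmr) big_seq_cond big1 // => l /andP[lr _].
  rewrite mcoeffZ mcoeffX; case: eqP => [eqm|]; last by rewrite mulr0.
  by rewrite -eqm lr in nmr.
apply: big1 => l /eqP ld; rewrite mcoeffZ mcoeffX; case: eqP => [eqm|]; last by rewrite mulr0.
by rewrite -eqm ld eqxx in nmd.
Qed.

Section Examples.
Variable K : numClosedFieldType.

Definition params_of (L : 'I_4 -> 'I_3 -> K) (r : {mpoly K[4]}) (i : params) : K :=
  match i with inl (k, j) => L k j | inr m => r@_m end.

Lemma low_form_params_of L r d : (d < 5)%N ->
  (forall m, mdeg m = d -> r@_m != 0 -> (m ord0 <= 1)%N) ->
  low_form (params_of L r) d = pihomog mdeg d r.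
Proof.
move=> lt_d5 supp; apply/mpolyP => m0; rewrite /low_form raddf_sum /=.
rewrite mcoeff_pihomog.
have [md|nmd] := ifPn; last first.
  apply: big1 => m /andP[/eqP md _]; rewrite mcoeffZ mcoeffX; case: eqP => [eqm|]; last by rewrite mulr0.
  by rewrite -eqm md eqxx in nmd.
have lt5 : (mdeg m0 < 5)%N by rewrite (eqP md).
have [m01|m01] := leqP (m0 ord0) 1.
  rewrite (bigD1 (BMultinom lt5)) /= ?md ?m01 // mcoeffZ mcoeffX eqxx mulr1 big1 ?addr0 //.
  move=> m /andP[_ nm]; rewrite mcoeffZ mcoeffX; case: eqP => [eqm|]; last by rewrite mulr0.
  by case/eqP: nm; apply: val_inj.
rewrite big1.
  apply/esym/eqP; apply: contraTT m01 => rn0; rewrite -leqNgt; apply: supp rn0; exact/eqP.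
move=> m /andP[_ lem]; rewrite mcoeffZ mcoeffX; case: eqP => [eqm|]; last by rewrite mulr0.
by rewrite -eqm ltnNge lem in m01.
Qed.

Lemma lval_params_of L r k y : lval (params_of L r) k y = \sum_(i < 3) L k i * y i.
Proof. by []. Qed.

Lemma hform_lval omega d e k (y : 'I_3 -> (params -> K) -> K -> K -> K -> K -> K) :
  (forall i, hform omega d e (y i)) ->
  hform omega d e (fun n s0 s1 t0 t1 => lval n k (fun i => y i n s0 s1 t0 t1)).
Proof.
by move=> Py; apply: hform_sum => i _; apply: hformZ; first exact: polyfun_var.
Qed.

Lemma hform_low_val omega a b d e (y : 'I_3 -> (params -> K) -> K -> K -> K -> K -> K) :
  (forall i, hform omega a b (y i)) ->
  hform omega ((d - e) * a) ((d - e) * b)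
    (fun n s0 s1 t0 t1 => low_val n d e (fun i => y i n s0 s1 t0 t1)).
Proof.
move=> Py; apply: hform_sum => m /andP[/eqP md /eqP m0].
apply: hformZ; first exact: polyfun_var.
apply: (hform_prod (m := fun i : 'I_3 => m (lift ord0 i)) Py).
by move: (mdegE m); rewrite md [X in d = X -> _]big_ord_recl m0 => ->; rewrite addKn.
Qed.

(** This bounds the degree in z1 alone, the variable in which [low_form] is at most linear. *)
Definition deg0 k (p : {mpoly K[4]}) : Prop := forall m, p@_m != 0 -> (m ord0 <= k)%N.

Lemma deg0D k p q : deg0 k p -> deg0 k q -> deg0 k (p + q).
Proof.
move=> dp dq m; rewrite mcoeffD; have [p0|pn0] := eqVneq p@_m 0; last by move=> _; apply: dp.
by rewrite p0 add0r; apply: dq.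
Qed.

Lemma deg0Z k c p : deg0 k p -> deg0 k (c *: p).
Proof. by move=> dp m; rewrite mcoeffZ mulf_eq0 negb_or => /andP[_ /dp]. Qed.

Lemma deg0M k l p q : deg0 k p -> deg0 l q -> deg0 (k + l) (p * q).
Proof.
move=> dp dq m; rewrite -mcoeff_msupp => /msuppM_le/allpairsP[[m1 m2] /= [m1p m2q ->]].
by rewrite mnmDE leq_add // ?dp ?dq // -mcoeff_msupp.
Qed.

Lemma deg0_leq k l p : (k <= l)%N -> deg0 k p -> deg0 l p.
Proof. by move=> le_kl dp m /dp/leq_trans; apply. Qed.

Lemma deg0_var (i : 'I_4) : deg0 (i == ord0) 'X_i.
Proof.
move=> m; rewrite mcoeffX; have [<- _|_] := eqVneq U_(i)%MM m; last by rewrite eqxx.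
by rewrite mnm1E.
Qed.

Lemma deg0_exp k j p : deg0 k p -> deg0 (j * k) (p ^+ j).
Proof.
move=> dp; elim: j => [|j IHj]; last by rewrite exprS mulSn; apply: deg0M.
move=> m; rewrite expr0 mcoeff1; have [-> _|_] := eqVneq m 0%MM; last by rewrite eqxx.
by rewrite mnm0E.
Qed.

Lemma deg0_varX (i : 'I_3) j : deg0 0 ('X_(lift ord0 i) ^+ j : {mpoly K[4]}).
Proof.
have := @deg0_exp _ j _ (@deg0_var (lift ord0 i)).
by rewrite (_ : (lift ord0 i == ord0) = false) ?muln0.
Qed.

Lemma low_form_sum L p3 p4 : p3 \is 3.-homog -> p4 \is 4.-homog ->
  deg0 1 p3 -> deg0 1 p4 ->
  low_form (params_of L (p3 + p4)) 3 = p3 /\ low_form (params_of L (p3 + p4)) 4 = p4.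
Proof.
move=> h3 h4 d3 d4; have lowE d : (d < 5)%N ->
    low_form (params_of L (p3 + p4)) d = pihomog mdeg d (p3 + p4).
  by move=> lt_d5; apply: low_form_params_of => // m _; apply: deg0D.
rewrite !lowE //.
rewrite !pihomogD (pihomog_dE h3) (pihomog_dE h4).
by rewrite (pihomog_ne0 _ h4) // (pihomog_ne0 _ h3) // addr0 add0r.
Qed.

Lemma var_homog (i : 'I_4) : 'X_i \is [in K[4], 1.-homog].
Proof. by rewrite dhomogX; apply/eqP; apply: mdeg1. Qed.

Lemma ypartZ c (z : 'rV[K]_4) : ypart (c *: z) = (fun i => c * ypart z i).
Proof. by apply/funext => i; rewrite /ypart !mxE. Qed.

Lemma row4P (z z' : 'rV[K]_4) : z 0 0 = z' 0 0 ->
  (forall i : 'I_3, z 0 (lift ord0 i) = z' 0 (lift ord0 i)) -> z = z'.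
Proof.
move=> eq0 eqS; apply/rowP => i; have [j ->|->] := unliftP ord0 i; first exact: eqS.
exact: eq0.
Qed.

End Examples.

(** * The 24 zeros on the tangent cone at o1 *)

Section ConeZeros.
Variable K : numClosedFieldType.

(** The resolution of the cone [nq2] = 0 by F_2; it contracts the curve t0 = 0 to the vertex (0 : 0
    : 0 : 1). *)
Definition cone_pt (s0 s1 t0 t1 : K) : 'rV[K]_4 :=
  \row_i tnth [tuple s0 * s1 * t0; s0 ^+ 2 * t0; - (s1 ^+ 2 * t0); t1] i.

Let mono omega d e i j : (j <= e)%N -> (i <= sdeg omega d e j)%N ->
  @hform K params omega d e (fun n s0 s1 t0 t1 =>
      s0 ^+ (sdeg omega d e j - i) * s1 ^+ i * t0 ^+ (e - j) * t1 ^+ j).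
Proof.
move=> le_j le_i; apply: hform_ext (hform_mono (polyfun_const _ 1) le_j le_i) => *.
by rewrite mul1r.
Qed.

Lemma hform_cone_pt i :
  hform 2 0 1 (fun (n : params -> K) s0 s1 t0 t1 => cone_pt s0 s1 t0 t1 0 i).
Proof.
case: i => [[|[|[|[|//]]]]] lti.
- have := @mono 2 0 1 1 0 isT isT; apply: hform_ext => *.
  by rewrite mxE (tnth_nth 0) /= !expr1 mulr1.
- have := @mono 2 0 1 0 0 isT isT; apply: hform_ext => *.
  by rewrite mxE (tnth_nth 0) /= !expr0 !expr1 !mulr1.
- have := hformZ (polyfun_const _ (-1)) (@mono 2 0 1 2 0 isT isT); apply: hform_ext => *.
  by rewrite mxE (tnth_nth 0) /= !expr0 !expr1 !mulr1 mul1r mulN1r.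
have := @mono 2 0 1 0 1 isT isT; apply: hform_ext => *.
by rewrite mxE (tnth_nth 0) /= !expr0 !expr1 !mul1r.
Qed.

Let a (n : params -> K) s0 s1 t0 t1 := (nq3 n).@[cone_pt s0 s1 t0 t1 0].
Let b (n : params -> K) s0 s1 t0 t1 := (nq4 n).@[cone_pt s0 s1 t0 t1 0].

Let Py (i : 'I_3) : hform 2 0 1 (fun (n : params -> K) s0 s1 t0 t1 =>
  ypart (cone_pt s0 s1 t0 t1) i) := hform_cone_pt (lift ord0 i).

Let Pa : hform 2 0 3 a.
Proof.
apply: hform_ext (fun n s0 s1 t0 t1 => esym (meval_nq3 n (cone_pt s0 s1 t0 t1))) _.
apply: hformD; first exact: (hformM (hformX 2 (hform_cone_pt 0)) (hformD (hform_lval 0 Py) (hform_lval 1 Py))).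
apply: hformD; last exact: (hform_low_val 3 0 Py).
exact: (hformM (hform_cone_pt 0) (hform_low_val 3 1 Py)).
Qed.

Let Pb : hform 2 0 4 b.
Proof.
apply: hform_ext (fun n s0 s1 t0 t1 => esym (meval_nq4 n (cone_pt s0 s1 t0 t1))) _.
apply: hformD; first exact: (hformM (hformX 2 (hform_cone_pt 0))
  (hformD (hformM (hform_lval 0 Py) (hform_lval 1 Py))
          (hformM (hform_lval (inord 2) Py) (hform_lval (inord 3) Py)))).
apply: hformD; last exact: (hform_low_val 4 0 Py).
exact: (hformM (hform_cone_pt 0) (hform_low_val 4 1 Py)).
Qed.

Definition cone_zero n (z : 'rV[K]_4) : Prop :=
  [/\ (nq2 K).@[z 0] = 0, (nq3 n).@[z 0] = 0 & (nq4 n).@[z 0] = 0].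

Let i1 : 'I_4 := lift ord0 0.
Let i2 : 'I_4 := lift ord0 1.

Let i3 : 'I_4 := lift ord0 2.

Theorem generic_cone_zeros : exists G, [/\ polyfun G, exists n : params -> K, G n != 0 &
  forall n, G n != 0 -> (nq3 n).@[(delta_mx 0 ord_max : 'rV_4) 0] != 0 -> represented 24 (cone_zero n)].
Proof.
(* With s0 = t0 = 1 the equations become t1^3 = 1 and t1 = s1^8. *)
pose p3 : {mpoly K[4]} := 'X_i3 ^+ 3 + -1 *: 'X_i1 ^+ 3.
pose p4 : {mpoly K[4]} := 'X_i3 * 'X_i1 ^+ 3 + -1 *: 'X_i2 ^+ 4.
pose n1 := params_of (fun _ _ => 0) (p3 + p4).
have [l3 l4] : low_form n1 3 = p3 /\ low_form n1 4 = p4.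
  apply: low_form_sum.
  - apply: rpredD; first exact: (dhomogMn 3 (var_homog _ _)).
    by apply: dhomogZ; apply: (dhomogMn 3 (var_homog _ _)).
  - apply: rpredD; first exact: (dhomogM (var_homog _ _) (dhomogMn 3 (var_homog _ _))).
    by apply: dhomogZ; apply: (dhomogMn 4 (var_homog _ _)).
  - apply: (@deg0_leq _ 0) => //; apply: deg0D; last apply: deg0Z.
      exact: (@deg0_varX K 2 3).
    exact: (@deg0_varX K 0 3).
  apply: (@deg0_leq _ 0) => //; apply: deg0D; last apply: deg0Z.
    exact: (deg0M (@deg0_varX K 2 1) (@deg0_varX K 0 3)).
  exact: (@deg0_varX K 1 4).
have lf0 k : lform n1 k = 0 by apply: big1 => i _; rewrite scale0r.
have a1E s0 s1 t0 t1 : a n1 s0 s1 t0 t1 = t1 ^+ 3 - (s0 ^+ 2 * t0) ^+ 3.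
  rewrite /a /nq3 l3 !lf0 addr0 mulr0 add0r mevalD mevalZ !meval_exp !mevalXU !mxE !(tnth_nth 0) /=.
  by rewrite mulN1r.
have b1E s0 s1 t0 t1 : b n1 s0 s1 t0 t1 = t1 * (s0 ^+ 2 * t0) ^+ 3 - (s1 ^+ 2 * t0) ^+ 4.
  rewrite /b /nq4 l4 !lf0 mulr0 addr0 mulr0 add0r mevalD mevalZ mevalM !meval_exp !mevalXU !mxE !(tnth_nth 0) /=.
  by ring.
have [S [uS sS rS]] := @unity_roots K 24 isT.
have [] := generic_count_zeros Pa Pb isT isT isT (n1 := n1) (S := S) (x1 := 0) uS sS.
- move=> s /rS s24; exists 1, (s ^+ 8); split; first by rewrite xpair_eqE oner_eq0.
    by rewrite a1E -exprM s24 expr1n !mulr1 expr1n subrr.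
  by rewrite b1E !expr1n !mulr1 expr1n mulr1 -exprM subrr.
- move=> t0 t1 [tn0]; rewrite a1E b1E => eqa eqb; move/negP: tn0; apply.
  move: eqa eqb; rewrite expr1n expr0n /= mul0r expr0n /= subr0 mul1r => /eqP.
  rewrite subr_eq0 => /eqP eqt /eqP; rewrite -eqt -exprS expf_eq0 /= => /eqP t10.
  by move/eqP: eqt; rewrite t10 expr0n eq_sym expf_eq0 /= xpair_eqE eqxx andbT.
- move=> t0 t1 [tn0]; rewrite a1E b1E => eqa eqb; move/negP: tn0; apply.
  move: eqa eqb; rewrite expr1n expr0n /= !mul0r mul1r !expr0n /= subr0 mulr0 sub0r.
  move=> /eqP; rewrite expf_eq0 /= => /eqP -> /eqP; rewrite oppr_eq0 expf_eq0 /= => /eqP ->.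
  by rewrite eqxx.
move=> G [PG Gn1] genG; exists G; split=> //; first by exists n1.
move=> n Gn q3n; have [noinf [Z [u [uZ sZ zZ allZ]]]] := genG n Gn.
pose pt s := cone_pt 1 s (u s).1 (u s).2.
have u0 s : s \in Z -> (u s).1 != 0.
  move=> /zZ[un0 az _]; apply: contraNneq q3n => u10.
  have u2n0 : (u s).2 != 0 by move: un0; rewrite u10 xpair_eqE eqxx.
  have ptE : cone_pt 1 s (u s).1 (u s).2 = (u s).2 *: delta_mx 0 ord_max.
    apply/rowP => i; rewrite !mxE !(tnth_nth 0) u10 !mulr0 oppr0 /=.
    by case: i => [[|[|[|[|//]]]]] lti; rewrite -val_eqE /= ?mulr0 ?mulr1.
  move: az; rewrite /a ptE.
  have -> : (nq3 n).@[((u s).2 *: delta_mx 0 ord_max : 'rV_4) 0] =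
      (u s).2 ^+ 3 * (nq3 n).@[(delta_mx 0 ord_max : 'rV_4) 0].
    by rewrite !meval_nq3 ypartZ !lvalZ !low_valZ // mxE; ring.
  by move=> /eqP; rewrite mulf_eq0 expf_eq0 /= (negPf u2n0) => /eqP ->.
have Zi (i : 'I_24) : nth 0 Z i \in Z by rewrite mem_nth ?sZ.
exists (fun i => pt (nth 0 Z i)); split.
- move=> i; split.
    apply: contraNneq (u0 _ (Zi i)) => /rowP/(_ i1); rewrite !mxE (tnth_nth 0) /=.
    by rewrite expr1n mul1r => ->.
  have [_ az bz] := zZ _ (Zi i); split=> //.
  by rewrite meval_nq2 /ypart !mxE !(tnth_nth 0) /=; ring.
- move=> i j c eqw.
  have := congr1 (fun w : 'rV_4 => w 0 0) eqw; have := congr1 (fun w : 'rV_4 => w 0 i1) eqw.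
  rewrite !mxE !(tnth_nth 0) /= !expr1n !mul1r => eq1 eq0.
  have eqs : nth 0 Z i = nth 0 Z j.
    apply: (mulIf (u0 _ (Zi i))); rewrite eq0 eq1; ring.
  by apply/val_inj/eqP; rewrite -(@nth_uniq _ 0 Z) ?sZ ?ltn_ord //; apply/eqP.
move=> v vn0 [v2 v3 v4].
rewrite meval_nq2 /ypart -/i1 -/i2 in v2.
(* Points with vanishing first y-coordinate come from the fibre s0 = 0, which carries no common zero
   by [noinf]. *)
have [v10|v1n0] := eqVneq (v 0 i1) 0.
  have v00 : v 0 0 = 0.
    by apply/eqP; move/eqP: v2; rewrite v10 mul0r addr0 expf_eq0.
  have vE : v = cone_pt 0 1 (- v 0 i2) (v 0 i3).
    apply/rowP => i; rewrite !mxE !(tnth_nth 0) !mul0r expr1n mul1r opprK.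
    case: i => [[|[|[|[|//]]]]] lti /=.
    + by rewrite -v00; congr (v 0 _); apply: val_inj.
    + by rewrite expr0n /= mul0r -v10; congr (v 0 _); apply: val_inj.
    + by congr (v 0 _); apply: val_inj.
    + by congr (v 0 _); apply: val_inj.
  case: (noinf (- v 0 i2) (v 0 i3)); split; rewrite /a /b -?vE //.
  apply: contraNneq vn0 => -[i20 imax0]; rewrite vE i20 imax0.
  apply/eqP/rowP => i; rewrite !mxE !(tnth_nth 0) !mulr0 oppr0.
  by case: i => [[|[|[|[|//]]]]].
pose s := v 0 0 / v 0 i1.
have vE : v = cone_pt 1 s (v 0 i1) (v 0 i3).
  have si1 : s * v 0 i1 = v 0 0 by rewrite divfK.
  apply/rowP => i; rewrite !mxE !(tnth_nth 0) !expr1n !mul1r.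
  case: i => [[|[|[|[|//]]]]] lti /=.
  + by rewrite si1; congr (v 0 _); apply: val_inj.
  + by congr (v 0 _); apply: val_inj.
  + apply: (mulIf v1n0); rewrite mulNr -mulrA -expr2 -exprMn si1.
    have -> : Ordinal lti = i2 by apply: val_inj.
    by apply/eqP; rewrite -addr_eq0 addrC mulrC v2.
  + by congr (v 0 _); apply: val_inj.
have zs : common_zero a b n 1 s (v 0 i1) (v 0 i3).
  by split; rewrite /a /b -?vE // xpair_eqE (negPf v1n0).
have [sZs cross] := allZ _ _ _ zs.
have lt_i : (index s Z < 24)%N by have := sZs; rewrite -index_mem sZ.
exists (Ordinal lt_i), (v 0 i1 / (u s).1); rewrite /pt nth_index // {1}vE.
have us0 := u0 _ sZs.
have tmax : v 0 i3 = v 0 i1 / (u s).1 * (u s).2.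
  by rewrite mulrAC cross mulfK.
apply/rowP => i; rewrite !mxE !(tnth_nth 0) /=.
by case: i => [[|[|[|[|//]]]]] lti /=; rewrite ?tmax //; field.
Qed.

End ConeZeros.

(** * The 24 directions of lines through the node *)

Section LineZeros.
Variable K : numClosedFieldType.
Implicit Types n : params -> K.

Definition line_zero n (x : 'rV[K]_4) : Prop :=
  [/\ cone2 n (x 0 0) (ypart x) = 0, cone3 n (x 0 0) (ypart x) = 0
    & cone4 n (x 0 0) (ypart x) = 0].

(* x *m cone_coord n lists the linear forms u, v, w, t with cone2 = uv + wt. *)
Definition cone_coord n : 'M[K]_4 :=
  \matrix_(i, k) if unlift ord0 i is Some j then n (inl (k, j)) else (k < 2)%:R.

Lemma mul_cone_coord n (x : 'rV[K]_4) k :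
  (x *m cone_coord n) 0 k = (k < 2)%:R * x 0 0 + lval n k (ypart x).
Proof.
rewrite mxE big_ord_recl mxE unlift_none mulrC; congr (_ + _).
by apply: eq_bigr => i _; rewrite mxE liftK mulrC.
Qed.

Definition segre_pt (s0 s1 t0 t1 : K) : 'rV[K]_4 :=
  \row_i tnth [tuple s0 * t0; - (s1 * t1); s0 * t1; s1 * t0] i.

(** The adjugate replaces the inverse so that the point depends polynomially on n; the resulting
    factor, a power of the determinant, is harmless for homogeneous equations as long as the quadric
    is smooth. *)
Definition quadric_pt n s0 s1 t0 t1 : 'rV[K]_4 :=
  segre_pt s0 s1 t0 t1 *m \adj (cone_coord n).

Let mono d e i j : (j <= e)%N -> (i <= sdeg 0 d e j)%N ->
  @hform K params 0 d e (fun n s0 s1 t0 t1 =>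
      s0 ^+ (sdeg 0 d e j - i) * s1 ^+ i * t0 ^+ (e - j) * t1 ^+ j).
Proof.
move=> le_j le_i; apply: hform_ext (hform_mono (polyfun_const _ 1) le_j le_i) => *.
by rewrite mul1r.
Qed.

Let hform_segre_pt i :
  hform 0 1 1 (fun n s0 s1 t0 t1 => segre_pt s0 s1 t0 t1 0 i).
Proof.
case: i => [[|[|[|[|//]]]]] lti.
- have := @mono 1 1 0 0 isT isT; apply: hform_ext => *.
  by rewrite mxE (tnth_nth 0) /= !expr0 !expr1 !mulr1.
- have := hformZ (polyfun_const _ (-1)) (@mono 1 1 1 1 isT isT); apply: hform_ext => *.
  by rewrite mxE (tnth_nth 0) /= !expr0 !expr1 mul1r mulr1 mulN1r.
- have := @mono 1 1 0 1 isT isT; apply: hform_ext => *.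
  by rewrite mxE (tnth_nth 0) /= !expr0 !expr1 !mulr1.
have := @mono 1 1 1 0 isT isT; apply: hform_ext => *.
by rewrite mxE (tnth_nth 0) /= !expr0 !expr1 !mulr1 mul1r.
Qed.

Lemma polyfun_cone_coord i k : polyfun (fun n => cone_coord n i k).
Proof.
rewrite /cone_coord; case Ei: (unlift ord0 i) => [j|].
  by apply: polyfun_ext (polyfun_var _ (inl (k, j))) => n; rewrite mxE Ei.
by apply: polyfun_ext (polyfun_const _ (k < 2)%:R) => n; rewrite mxE Ei.
Qed.

Let hform_quadric_pt i :
  hform 0 1 1 (fun n s0 s1 t0 t1 => quadric_pt n s0 s1 t0 t1 0 i).
Proof.
apply: (@hform_ext _ _ _ _ _ (fun n s0 s1 t0 t1 => \sum_j \adj (cone_coord n) j i * segre_pt s0 s1 t0 t1 0 j)).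
  by move=> n s0 s1 t0 t1; rewrite [RHS]mxE; apply: eq_bigr => j _; rewrite mulrC.
apply: hform_sum => j _; apply: hformZ => //.
apply: (@polyfun_ext _ _ (fun n => (-1) ^+ (i + j) * \det (row' i (col' j (cone_coord n))))).
  by move=> n; rewrite [RHS]mxE.
apply: polyfunM; first exact: polyfun_const.
apply: polyfun_det => k l; have := polyfun_cone_coord (lift i k) (lift j l).
by apply: polyfun_ext => n; rewrite !mxE.
Qed.

Let a n s0 s1 t0 t1 := cone3 n (quadric_pt n s0 s1 t0 t1 0 0) (ypart (quadric_pt n s0 s1 t0 t1)).
Let b n s0 s1 t0 t1 := cone4 n (quadric_pt n s0 s1 t0 t1 0 0) (ypart (quadric_pt n s0 s1 t0 t1)).

Let Py (i : 'I_3) : hform 0 1 1 (fun n s0 s1 t0 t1 =>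
  ypart (quadric_pt n s0 s1 t0 t1) i) := hform_quadric_pt (lift ord0 i).

Let Pa : hform 0 3 3 a.
Proof.
apply: hformD; last exact: (hform_low_val 4 1 Py).
exact: (hformM (hform_quadric_pt 0) (hform_low_val 3 1 Py)).
Qed.

Let Pb : hform 0 4 4 b.
Proof.
apply: hformD; last exact: (hform_low_val 4 0 Py).
apply: hformD; first exact: (hformM (hformX 2 (hform_quadric_pt 0)) (hformM (Py 0) (Py 1))).
exact: (hformM (hform_quadric_pt 0) (hform_low_val 3 0 Py)).
Qed.

Lemma quadric_ptK n s0 s1 t0 t1 :
  quadric_pt n s0 s1 t0 t1 *m cone_coord n = \det (cone_coord n) *: segre_pt s0 s1 t0 t1.
Proof. by rewrite /quadric_pt -mulmxA mul_adj_mx mul_mx_scalar. Qed.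

(** Setting z1 to 0 and then to 1 isolates the two parts; subtracting [z 0 0 *: delta_mx 0 0] is
    what sets z1 to 0. *)
Lemma low_val_eq n d g3 (p : {mpoly K[4]}) : low_form n d = p ->
  (forall z : 'rV[K]_4, p.@[z 0] = z 0 0 * g3 (ypart z) + p.@[(z - z 0 0 *: delta_mx 0 0) 0]) ->
  forall x : 'rV[K]_4, low_val n d 1 (ypart x) = g3 (ypart x) /\
    low_val n d 0 (ypart x) = p.@[(x - x 0 0 *: delta_mx 0 0) 0].
Proof.
move=> <- pE x; pose x0 : 'rV[K]_4 := x - x 0 0 *: delta_mx 0 0; pose x1 := x0 + delta_mx 0 0.
have y0 : ypart x0 = ypart x by apply/funext => i; rewrite /ypart !mxE /= mulr0 subr0.
have y1 : ypart x1 = ypart x by apply/funext => i; rewrite -y0 /ypart !mxE /= addr0.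
have x00 : x0 0 0 = 0 by rewrite !mxE mulr1 subrr.
have x10 : x1 0 0 = 1 by rewrite mxE x00 add0r mxE.
have x11 : x1 - x1 0 0 *: delta_mx 0 0 = x0 by rewrite x10 scale1r addrK.
have e0 := meval_low_form n d x0; rewrite x00 mul0r add0r y0 in e0.
split; last by rewrite -e0.
have := pE x1; rewrite x11 e0 meval_low_form x10 !mul1r y1.
by move/addIr.
Qed.

(* On the quadric uv + wt = 0 of this quartic, cone3 and cone4 restrict to u^3 + v^3
   and t^4 - w^4; with s0 = t0 = 1 the equations become (s1 t1)^3 = 1 and
   s1^4 = t1^4, that is, s1^24 = 1 and t1 = s1^7. *)
Let L2 (k : 'I_4) (i : 'I_3) : K :=
  match (k : nat), (i : nat) with
  | 0%N, 2%N => -1 | 1%N, 2%N => 1 | 2%N, 0%N => 1 | 3%N, 1%N => 1 | _, _ => 0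
  end.
Let z1 : 'I_4 := lift ord0 0.
Let z2 : 'I_4 := lift ord0 1.
Let z3 : 'I_4 := lift ord0 2.
(** With u = x - y_3 and v = x + y_3, the relation x^2 = y_3^2 - y_1 y_2 on the quadric reduces u^3
    + v^3 to a form linear in x, which [cone3] can be. In [p4] the last bracket cancels the forced
    term x^2 y_1 y_2 of [cone4]. *)
Let p3 : {mpoly K[4]} := 'X_ord0 * (8%:R *: 'X_z3 ^+ 2 + (-2%:R) *: ('X_z1 * 'X_z2)).
Let p4 : {mpoly K[4]} := 'X_z2 ^+ 4 + -1 *: 'X_z1 ^+ 4
  + (-1 *: ('X_z3 ^+ 2 * ('X_z1 * 'X_z2)) + ('X_z1 * 'X_z2) ^+ 2).
Let n2 := params_of L2 (p3 + p4).

Let lvalE (y : 'I_3 -> K) :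
  [/\ lval n2 0 y = - y 2, lval n2 1 y = y 2, lval n2 (inord 2) y = y 0 & lval n2 (inord 3) y = y 1].
Proof.
have e0 : ord0 = 0 :> 'I_3 by apply: val_inj.
have e1 : lift ord0 ord0 = 1 :> 'I_3 by apply: val_inj.
have e2 : lift ord0 (lift ord0 ord0) = 2 :> 'I_3 by apply: val_inj.
by split; rewrite lval_params_of !big_ord_recl big_ord0 /L2 /= ?inordK // ?e0 ?e1 ?e2; ring.
Qed.

Let low34 : low_form n2 3 = p3 /\ low_form n2 4 = p4.
Proof.
have h i := @var_homog K i; have hX i k : 'X_i ^+ k \is [in K[4], k.-homog].
  by have := dhomogMn k (h i); rewrite mul1n.
have d i k := @deg0_varX K i k.
apply: low_form_sum.
- apply: (dhomogM (h _)); apply: rpredD; apply: dhomogZ; first exact: hX.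
  exact: (dhomogM (h _) (h _)).
- apply: rpredD; first by apply: rpredD; [|apply: dhomogZ]; apply: hX.
  apply: rpredD; last exact: (dhomogMn 2 (dhomogM (h _) (h _))).
  by apply: dhomogZ; apply: (dhomogM (hX _ 2) (dhomogM (h _) (h _))).
- apply: (deg0M (k := 1) (l := 0)); first exact: (@deg0_var K ord0).
  apply: deg0D; apply: deg0Z; first exact: d.
  exact: (deg0M (d 0 1) (d 1 1)).
apply: (@deg0_leq K 0) => //; apply: deg0D; first by apply: deg0D; [|apply: deg0Z]; apply: d.
apply: deg0D; last exact: (@deg0_exp K 0 2 _ (deg0M (d 0 1) (d 1 1))).
by apply: deg0Z; apply: (deg0M (d 2 2) (deg0M (d 0 1) (d 1 1))).
Qed.

Let zE (z : 'rV[K]_4) : [/\ z 0 z1 = ypart z 0, z 0 z2 = ypart z 1 & z 0 z3 = ypart z 2].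
Proof. by []. Qed.

Let low3E (x : 'rV[K]_4) : let y := ypart x in
  low_val n2 3 1 y = 8%:R * y 2 ^+ 2 - 2%:R * (y 0 * y 1) /\ low_val n2 3 0 y = 0.
Proof.
have p3E (z : 'rV[K]_4) : p3.@[z 0] =
    z 0 0 * (8%:R * ypart z 2 ^+ 2 - 2%:R * (ypart z 0 * ypart z 1)).
  rewrite /p3 mevalM mevalD !mevalZ meval_exp mevalM !mevalXU.
  by have [-> -> ->] := zE z; rewrite mulNr.
have [|l1 l0] := low_val_eq (g3 := fun y => 8%:R * y 2 ^+ 2 - 2%:R * (y 0 * y 1)) low34.1 _ x => [z|].
  by rewrite !p3E !mxE /= mulr1 subrr mul0r addr0.
by cbv zeta; rewrite l1 l0 p3E !mxE /= mulr1 subrr mul0r.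
Qed.

Let low4E (x : 'rV[K]_4) : let y := ypart x in
  low_val n2 4 1 y = 0 /\
  low_val n2 4 0 y = y 1 ^+ 4 - y 0 ^+ 4 - (y 2 ^+ 2 * (y 0 * y 1) - (y 0 * y 1) ^+ 2).
Proof.
have p4E (z : 'rV[K]_4) : p4.@[z 0] = ypart z 1 ^+ 4 - ypart z 0 ^+ 4 -
   (ypart z 2 ^+ 2 * (ypart z 0 * ypart z 1) - (ypart z 0 * ypart z 1) ^+ 2).
  rewrite /p4 !mevalD !mevalZ !meval_exp !mevalM ?meval_exp !mevalXU.
  by have [-> -> ->] := zE z; ring.
have ypE (z : 'rV[K]_4) : ypart (z - z 0 0 *: delta_mx 0 0) = ypart z.
  by apply/funext => i; rewrite /ypart !mxE /= mulr0 subr0.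
have [|l1 l0] := low_val_eq (g3 := fun _ => 0) low34.2 _ x => [z|].
  by rewrite !p4E ypE mulr0 add0r.
by cbv zeta; rewrite l1 l0 p4E ypE.
Qed.

Theorem generic_line_zeros : exists G, [/\ polyfun G,
  exists n : params -> K, G n != 0 /\ \det (cone_coord n) != 0 &
  forall n, G n != 0 -> \det (cone_coord n) != 0 -> represented 24 (line_zero n)].
Proof.
pose d := \det (cone_coord n2).
have coordE (x : 'rV[K]_4) : let y := ypart x in let X := x *m cone_coord n2 in
    [/\ X 0 0 = x 0 0 - y 2, X 0 1 = x 0 0 + y 2, X 0 (inord 2) = y 0 & X 0 (inord 3) = y 1].
  have [l0 l1 l2 l3] := lvalE (ypart x).
  by split; rewrite mul_cone_coord ?l0 ?l1 ?l2 ?l3 ?inordK //= ?mul1r ?mul0r ?add0r.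
have dn0 : d != 0.
  apply/negP => /det0P[x xn0 x0]; have [e0 e1 e2 e3] := coordE x.
  rewrite x0 !mxE in e0 e1 e2 e3.
  case/eqP: xn0; have xx : x 0 0 = 0.
    apply: (mulfI (_ : 2%:R != 0 :> K)); rewrite ?pnatr_eq0 // mulr0.
    have -> : 2%:R * x 0 0 = (x 0 0 - ypart x 2) + (x 0 0 + ypart x 2) by ring.
    by rewrite -e0 -e1 addr0.
  have yy : ypart x 2 = 0 by move: e1; rewrite xx add0r => <-.
  apply: row4P => [|i]; rewrite !mxE ?xx // -/(ypart x i).
  case: i => [[|[|[|//]]]] lti.
  - by rewrite [RHS]e2; congr ypart; apply: val_inj.
  - by rewrite [RHS]e3; congr ypart; apply: val_inj.
  by rewrite -[RHS]yy; congr ypart; apply: val_inj.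
have ptE s0 s1 t0 t1 : let x := quadric_pt n2 s0 s1 t0 t1 in let y := ypart x in
    [/\ x 0 0 - y 2 = d * (s0 * t0), x 0 0 + y 2 = - (d * (s1 * t1)),
        y 0 = d * (s0 * t1) & y 1 = d * (s1 * t0)].
  cbv zeta; have [<- <- <- <-] := coordE (quadric_pt n2 s0 s1 t0 t1).
  by rewrite quadric_ptK !mxE !(tnth_nth 0) !inordK //= mulrN.
have quadE s0 s1 t0 t1 : let x := quadric_pt n2 s0 s1 t0 t1 in let y := ypart x in
    x 0 0 ^+ 2 = y 2 ^+ 2 - y 0 * y 1.
  cbv zeta; have [e0 e1 e2 e3] := ptE s0 s1 t0 t1.
  set x := quadric_pt _ _ _ _ _ in e0 e1 e2 e3 *.
  have : (x 0 0 - ypart x 2) * (x 0 0 + ypart x 2) + ypart x 0 * ypart x 1 = 0.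
    by rewrite e0 e1 e2 e3; ring.
  by move=> rel; rewrite -[LHS]subr0 -rel; ring.
have a2E s0 s1 t0 t1 : a n2 s0 s1 t0 t1 = d ^+ 3 * ((s0 * t0) ^+ 3 - (s1 * t1) ^+ 3).
  have [e0 e1 e2 e3] := ptE s0 s1 t0 t1; have q := quadE s0 s1 t0 t1.
  rewrite /a /cone3; set x := quadric_pt _ _ _ _ _ in e0 e1 e2 e3 q *.
  rewrite (low3E x).1 (low4E x).1 addr0.
  have -> : d ^+ 3 * ((s0 * t0) ^+ 3 - (s1 * t1) ^+ 3) =
     (x 0 0 - ypart x 2) ^+ 3 + (x 0 0 + ypart x 2) ^+ 3 by rewrite e0 e1; ring.
  have -> : (x 0 0 - ypart x 2) ^+ 3 + (x 0 0 + ypart x 2) ^+ 3 =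
     2%:R * x 0 0 * (x 0 0 ^+ 2 + 3%:R * ypart x 2 ^+ 2) by ring.
  by rewrite q; ring.
have b2E s0 s1 t0 t1 : b n2 s0 s1 t0 t1 = d ^+ 4 * ((s1 * t0) ^+ 4 - (s0 * t1) ^+ 4).
  have [e0 e1 e2 e3] := ptE s0 s1 t0 t1; have q := quadE s0 s1 t0 t1.
  rewrite /b /cone4; set x := quadric_pt _ _ _ _ _ in e0 e1 e2 e3 q *.
  rewrite (low3E x).2 (low4E x).2 mulr0 addr0 q.
  have -> : d ^+ 4 * ((s1 * t0) ^+ 4 - (s0 * t1) ^+ 4) =
     ypart x 1 ^+ 4 - ypart x 0 ^+ 4 by rewrite e2 e3; ring.
  by ring.
have [S [uS sS rS]] := @unity_roots K 24 isT.
have [] := generic_count_zeros Pa Pb isT isT isT (n1 := n2) (S := S) (x1 := 0) uS sS.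
- move=> s /rS s24; exists 1, (s ^+ 7); split; first by rewrite xpair_eqE oner_eq0.
    by rewrite a2E -exprS -exprM s24 mulr1 expr1n subrr mulr0.
  rewrite b2E mulr1 mul1r -exprM (_ : (7 * 4 = 24 + 4)%N) // exprD s24 mul1r.
  by rewrite subrr mulr0.
- move=> t0 t1 [tn0]; rewrite a2E b2E => eqa eqb; move/negP: tn0; apply.
  move: eqa eqb; rewrite !mul1r !mul0r !expr0n /= subr0 sub0r => /eqP.
  rewrite mulf_eq0 !expf_eq0 /= (negPf dn0) /= => /eqP ->.
  move/eqP; rewrite mulf_eq0 oppr_eq0 !expf_eq0 /= (negPf dn0) /= => /eqP ->.
  by rewrite eqxx.
- move=> t0 t1 [tn0]; rewrite a2E b2E => eqa eqb; move/negP: tn0; apply.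
  move: eqa eqb; rewrite !mul1r !mul0r !expr0n /= subr0 sub0r => /eqP.
  rewrite mulf_eq0 oppr_eq0 !expf_eq0 /= (negPf dn0) /= => /eqP ->.
  move/eqP; rewrite mulf_eq0 !expf_eq0 /= (negPf dn0) /= => /eqP ->.
  by rewrite eqxx.
move=> G [PG Gn2] genG; exists G; split=> //; first by exists n2.
move=> n Gn; set D := \det (cone_coord n) => Dn0.
have [noinf [Z [u [uZ sZ zZ allZ]]]] := genG n Gn.
pose pt s := quadric_pt n 1 s (u s).1 (u s).2.
have Zi (i : 'I_24) : nth 0 Z i \in Z by rewrite mem_nth ?sZ.
have DscaleK (v : 'rV[K]_4) : D *: v = (v *m cone_coord n) *m \adj (cone_coord n).
  by rewrite -mulmxA mul_mx_adj mul_mx_scalar.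
have cone2E (x : 'rV[K]_4) : let X := x *m cone_coord n in
    cone2 n (x 0 0) (ypart x) = X 0 0 * X 0 1 + X 0 (inord 2) * X 0 (inord 3).
  by rewrite /= !mul_cone_coord !inordK //= !mul1r !mul0r !add0r.
have homogE c (x : 'rV[K]_4) : c != 0 -> line_zero n (c *: x) <-> line_zero n x.
  move=> cn0; rewrite /line_zero ypartZ mxE cone2Z cone3Z cone4Z.
  have eqv m y : c ^+ m * y = 0 <-> y = 0.
    split=> [/eqP|->]; last by rewrite mulr0.
    by rewrite mulf_eq0 expf_eq0 (negPf cn0) andbF /= => /eqP.
  by split=> -[/eqv e2 /eqv e3 /eqv e4]; split=> //; apply/eqv.
have pt0 s0 s1 t0 t1 : cone2 n (quadric_pt n s0 s1 t0 t1 0 0) (ypart (quadric_pt n s0 s1 t0 t1)) = 0.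
  by rewrite cone2E quadric_ptK !mxE !(tnth_nth 0) !inordK //=; ring.
have un0 s : s \in Z -> u s != (0, 0) by case/zZ; rewrite -surjective_pairing.
exists (fun i => pt (nth 0 Z i)); split.
- move=> i; have [tn0 az bz] := zZ _ (Zi i); split; last by split=> //; apply: pt0.
  apply: contraNneq (un0 _ (Zi i)) => pti.
  have := quadric_ptK n 1 (nth 0 Z i) (u (nth 0 Z i)).1 (u (nth 0 Z i)).2.
  rewrite -/(pt _) pti mul0mx => /esym/rowP eqs.
  have := eqs 0; have := eqs (inord 2); rewrite !mxE !(tnth_nth 0) inordK //= !mul1r.
  move=> /eqP; rewrite mulf_eq0 (negPf Dn0) /= => /eqP u2 /eqP.
  rewrite mulf_eq0 (negPf Dn0) /= => /eqP u1.
  by rewrite [u _]surjective_pairing u1 u2.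
- move=> i j c eqw.
  have := congr1 (fun w => w *m cone_coord n) eqw; rewrite -scalemxAl !quadric_ptK => /rowP eqs.
  set s := nth 0 Z i in eqs; set s' := nth 0 Z j in eqs.
  have eq0 := eqs 0; have eq1 := eqs 1; have eq2 := eqs (inord 2); have eq3 := eqs (inord 3).
  rewrite !mxE !(tnth_nth 0) ?inordK //= ?mul1r in eq0 eq1 eq2 eq3.
  have {}eq0 : (u s).1 = c * (u s').1 by apply: (mulfI Dn0); rewrite eq0 mulrCA.
  have {}eq2 : (u s).2 = c * (u s').2 by apply: (mulfI Dn0); rewrite eq2 mulrCA.
  have {}eq1 : s * (u s).2 = c * (s' * (u s').2).
    by apply: (mulfI Dn0); move: eq1; rewrite !mulrN => /oppr_inj ->; rewrite -/D; ring.
  have {}eq3 : s * (u s).1 = c * (s' * (u s').1) by apply: (mulfI Dn0); rewrite eq3 -/D; ring.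
  have eqs' : s = s'.
    have [u10|u1n0] := eqVneq (u s).1 0; last first.
      by apply: (mulIf u1n0); rewrite eq3 eq0; ring.
    have u2n0 : (u s).2 != 0.
      by have := un0 _ (Zi i); rewrite -/s [u s]surjective_pairing u10 xpair_eqE eqxx.
    by apply: (mulIf u2n0); rewrite eq1 eq2; ring.
  by apply/val_inj/eqP; rewrite -(@nth_uniq _ 0 Z) ?sZ ?ltn_ord //; apply/eqP.
move=> v vn0 [v2 v3 v4].
pose X := v *m cone_coord n; pose U := X 0 0; pose V := X 0 1.
pose W := X 0 (inord 2); pose T := X 0 (inord 3).
have rel : U * V + W * T = 0 by rewrite -v2 cone2E.
have Xn0 : X != 0.
  apply: contraNneq vn0 => X0; have := DscaleK v; rewrite -/X X0 mul0mx => /eqP.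
  by rewrite scaler_eq0 (negPf Dn0).
have XE s0 s1 t0 t1 : U = s0 * t0 -> V = - (s1 * t1) -> W = s0 * t1 -> T = s1 * t0 ->
    D *: v = quadric_pt n s0 s1 t0 t1.
  move=> eU eV eW eT; rewrite DscaleK /quadric_pt; congr (_ *m _); apply/rowP => i.
  rewrite -/X [RHS]mxE (tnth_nth 0); case: i => [[|[|[|[|//]]]]] lti /=.
  + by rewrite -eU; congr (X 0 _); apply: val_inj.
  + by rewrite -eV; congr (X 0 _); apply: val_inj.
  + by rewrite -eW; congr (X 0 _); apply: val_inj; rewrite /= inordK.
  by rewrite -eT; congr (X 0 _); apply: val_inj; rewrite /= inordK.
have zeroE s0 s1 t0 t1 : D *: v = quadric_pt n s0 s1 t0 t1 ->
    a n s0 s1 t0 t1 = 0 /\ b n s0 s1 t0 t1 = 0.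
  by move=> E; rewrite /a /b -E; have [] := (homogE D v Dn0).2 (And3 v2 v3 v4).
(* U = W = 0 is the fibre s0 = 0 of one ruling, excluded by [noinf]. Elsewhere U V + W T = 0 makes
   (-V, T) a multiple of (W, U), and the factor is the coordinate s of the fibre. *)
have [UW0|UWn0] := boolP ((U, W) == (0, 0)).
  move: UW0; rewrite xpair_eqE => /andP[/eqP U0 /eqP W0].
  have E : D *: v = quadric_pt n 0 1 T (- V) by apply: XE; rewrite ?mul0r ?mul1r ?opprK.
  have [az bz] := zeroE _ _ _ _ E.
  case: (noinf T (- V)); split=> //; apply: contraNneq Xn0 => -[T0 /eqP].
  rewrite oppr_eq0 => /eqP V0.
  apply/eqP/rowP => i; rewrite [RHS]mxE; case: i => [[|[|[|[|//]]]]] lti;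
    [rewrite -U0|rewrite -V0|rewrite -W0|rewrite -T0]; congr (X 0 _); apply: val_inj; rewrite /= ?inordK //.
have [s [Vs Ts]] : exists s, V = - (s * W) /\ T = s * U.
  have [U00|Un0] := eqVneq U 0.
    have Wn0 : W != 0 by move: UWn0; rewrite U00 xpair_eqE eqxx.
    have T0 : T = 0 by apply/eqP; move/eqP: rel; rewrite U00 mul0r add0r mulf_eq0 (negPf Wn0).
    by exists (- V / W); rewrite divfK // opprK U00 T0 mulr0.
  exists (T / U); rewrite divfK //; split=> //.
  apply: (mulfI Un0); apply/eqP; rewrite -subr_eq0; apply/eqP; rewrite -[RHS]rel; field.
  exact: Un0.
have E : D *: v = quadric_pt n 1 s U W by apply: XE; rewrite ?mul1r.
have [az bz] := zeroE _ _ _ _ E.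
have [sZs cross] := allZ s U W (And3 UWn0 az bz).
have [c [Uc Wc]] : exists c, U = c * (u s).1 /\ W = c * (u s).2.
  have [u10|u1n0] := eqVneq (u s).1 0.
    have u2n0 : (u s).2 != 0.
      by have := un0 _ sZs; rewrite [u s]surjective_pairing u10 xpair_eqE eqxx.
    exists (W / (u s).2); rewrite divfK //; split=> //; rewrite u10 mulr0.
    by apply: (mulIf u2n0); rewrite cross u10 mulr0 mul0r.
  exists (U / (u s).1); rewrite divfK //; split=> //.
  by rewrite mulrAC cross mulfK.
have lt_i : (index s Z < 24)%N by have := sZs; rewrite -index_mem sZ.
exists (Ordinal lt_i), (c / D); rewrite /pt nth_index //.
apply: (scalerI Dn0); rewrite E scalerA mulrCA mulfV // mulr1 Uc Wc.
rewrite /quadric_pt scalemxAl; congr (_ *m _); apply/rowP => i; rewrite !mxE !(tnth_nth 0).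
by case: i => [[|[|[|[|//]]]]] lti /=; ring.
Qed.

End LineZeros.

Lemma meval_homog (K : fieldType) n d (p : {mpoly K[n]}) c (v : 'rV[K]_n) :
  p \is d.-homog -> p.@[(c *: v) 0] = c ^+ d * p.@[v 0].
Proof.
move=> hp; rewrite !mevalE mulr_sumr !big_seq; apply: eq_bigr => m mp.
rewrite mulrCA; congr (_ * _); have <- : mdeg m = d by exact: (dhomog_mf hp).
by rewrite mdegE expr_sum -big_split; apply: eq_bigr => i _; rewrite mxE exprMn.
Qed.

(** * Singular points of the normal form *)

Section Singular.
Variable K : numClosedFieldType.
Implicit Types n : params -> K.

Lemma gradient_eq0_scale n c (v : 'rV[K]_5) : c != 0 ->
  gradient (normal_quartic n) v = 0 -> gradient (normal_quartic n) (c *: v) = 0.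
Proof.
move=> cn0 gv; apply: (scalerI cn0); rewrite scaler0.
have hH : normal_quartic n \is 4.-homog.
  by apply: cone_form_homog; [exact: nq2_homog|exact: nq3_homog|exact: nq4_homog].
have := gradient_lin_subst c%:M (normal_quartic n) v.
rewrite tr_scalar_mx !mul_mx_scalar => <-.
have -> : lin_subst c%:M (normal_quartic n) = c ^+ 4 *: normal_quartic n.
  by apply: meval_row_inj => w; rewrite meval_lin_subst mul_mx_scalar mevalZ (meval_homog _ _ hH).
apply/rowP => i; have := congr1 (fun M : 'rV_5 => M 0 i) gv.
by rewrite !mxE mderivZ mevalZ => ->; rewrite mulr0.
Qed.

Section Slots.
Variable i : 'I_3.
Let yi : 'I_4 := lift ord0 i.
Let vi : 'I_5 := lift ord0 yi.

(** The monomial y_i^3 X_j with x0 put to 1: it belongs to the cubic part for X_j = x0 and to the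
    quartic part otherwise. Its degree in z1 is at most 1, so all five coefficients are free
    parameters. *)
Definition slot_mon (j : 'I_5) : 'X_{1..4} :=
  if unlift ord0 j is Some k then (U_(yi) *+ 3 + U_(k))%MM else (U_(yi) *+ 3)%MM.

Lemma mdeg_slot_mon j : (mdeg (slot_mon j) < 5)%N.
Proof.
rewrite /slot_mon; case: unlift => [k|]; last by rewrite mdegMn mdeg1.
by rewrite mdegD mdegMn !mdeg1.
Qed.

Definition slot (j : 'I_5) : params := inr (BMultinom (mdeg_slot_mon j)).

Lemma slot_inj : injective slot.
Proof.
move=> j j' [eqm]; have degE k : mdeg (slot_mon (lift ord0 k)) = 4%N.
  by rewrite /slot_mon liftK mdegD mdegMn !mdeg1.
have deg0 : mdeg (slot_mon ord0) = 3%N by rewrite /slot_mon unlift_none mdegMn mdeg1.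
have [k jE|jE] := unliftP ord0 j; have [k' jE'|jE'] := unliftP ord0 j'; rewrite jE jE' in eqm *.
- congr (lift _ _); move: eqm; rewrite /slot_mon !liftK => /mnmP/(_ k).
  by rewrite !mnmDE !mnm1E eqxx => /addnI; case: eqVneq.
- by have := degE k; rewrite eqm deg0.
- by have := degE k'; rewrite -eqm deg0.
by [].
Qed.

Definition no_slots n (s : params) : K := if [exists j, s == slot j] then 0 else n s.

Lemma low_form_slots n d : low_form n d =
  low_form (no_slots n) d + \sum_(j | mdeg (slot_mon j) == d) n (slot j) *: 'X_[slot_mon j].
Proof.
have nE (m : 'X_{1..4 < 5}) :
    n (inr m) = no_slots n (inr m) + \sum_j n (slot j) *+ (inr m == slot j).
  rewrite /no_slots; case: ifPn => [/existsP[j /eqP ->]|nex].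
    rewrite add0r (bigD1 j) //= eqxx mulr1n big1 ?addr0 // => k nk.
    by rewrite (inj_eq slot_inj) eq_sym (negPf nk).
  rewrite big1 ?addr0 // => j _; case: eqP => // E; case/existsP: nex; exists j; exact/eqP.
rewrite /low_form (eq_bigr (fun m : 'X_{1..4 < 5} => no_slots n (inr m) *: 'X_[m] +
   \sum_j (n (slot j) *+ (inr m == slot j)) *: 'X_[m])); last first.
  by move=> m _; rewrite {1}nE scalerDl scaler_suml.
rewrite big_split /=; congr (_ + _); rewrite exchange_big /= [RHS]big_mkcond /=.
apply: eq_bigr => j _.
have low0 : (slot_mon j ord0 <= 1)%N.
  rewrite /slot_mon; case: unlift => [k|]; last by rewrite mulmnE mnm1E.
  by rewrite mnmDE mulmnE !mnm1E /=; case: (k == _).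
rewrite big_mkcond (bigD1 (BMultinom (mdeg_slot_mon j))) //= low0 andbT eqxx mulr1n.
rewrite [X in _ + X]big1 ?addr0 // => m nm; case: ifP => // _.
case: eqP => [[E]|_]; last by rewrite mulr0n scale0r.
by case/eqP: nm; apply: val_inj; rewrite E.
Qed.

Lemma normal_quartic_slots n : normal_quartic n =
  normal_quartic (no_slots n) + \sum_j n (slot j) *: ('X_vi ^+ 3 * 'X_j).
Proof.
have lf k : lform (no_slots n) k = lform n k.
  apply: eq_bigr => j _; congr (_ *: _); rewrite /no_slots; case: existsP => // -[l /eqP].
  by [].
rewrite /normal_quartic /nq3 /nq4 !lf !(low_form_slots n).
have X0E : 'X_[slot_mon ord0] = 'X_yi ^+ 3 :> {mpoly K[4]}.
  by rewrite /slot_mon unlift_none mpolyXn.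
have XkE k : 'X_[slot_mon (lift ord0 k)] = 'X_yi ^+ 3 * 'X_k :> {mpoly K[4]}.
  by rewrite /slot_mon liftK mpolyXD mpolyXn.
have deg0E : mdeg (slot_mon ord0) = 3%N by rewrite /slot_mon unlift_none mdegMn mdeg1.
have degkE k : mdeg (slot_mon (lift ord0 k)) = 4%N.
  by rewrite /slot_mon liftK mdegD mdegMn !mdeg1.
have -> : \sum_(j | mdeg (slot_mon j) == 3%N) n (slot j) *: 'X_[slot_mon j] =
    n (slot ord0) *: 'X_yi ^+ 3 :> {mpoly K[4]}.
  rewrite big_mkcond big_ord_recl deg0E eqxx X0E big1 => [|k _]; first exact: addr0.
  by rewrite degkE.
have -> : \sum_(j | mdeg (slot_mon j) == 4%N) n (slot j) *: 'X_[slot_mon j] =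
    \sum_k n (slot (lift ord0 k)) *: ('X_yi ^+ 3 * 'X_k) :> {mpoly K[4]}.
  rewrite big_mkcond big_ord_recl deg0E /= add0r; apply: eq_bigr => k _.
  by rewrite degkE eqxx XkE.
apply: meval_row_inj => v.
have S1 : (\sum_k n (slot (lift ord0 k)) *: ('X_yi ^+ 3 * 'X_k) : {mpoly K[4]}).@[zpart v 0] =
    \sum_k n (slot (lift ord0 k)) * (v 0 vi ^+ 3 * v 0 (lift ord0 k)).
  rewrite raddf_sum /=; apply: eq_bigr => k _.
  by rewrite mevalZ mevalM meval_exp !mevalXU !mxE.
have S2 : (\sum_j n (slot j) *: ('X_vi ^+ 3 * 'X_j) : {mpoly K[5]}).@[v 0] =
    n (slot ord0) * (v 0 vi ^+ 3 * v 0 0) +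
    \sum_k n (slot (lift ord0 k)) * (v 0 vi ^+ 3 * v 0 (lift ord0 k)).
  rewrite raddf_sum big_ord_recl /= mevalZ mevalM meval_exp !mevalXU; congr (_ + _).
  by apply: eq_bigr => k _; rewrite mevalZ mevalM meval_exp !mevalXU.
rewrite mevalD !meval_cone_form !mevalD S1 S2 mevalZ [('X_yi ^+ 3).@[_]]meval_exp [('X_yi).@[_]]mevalXU [zpart v 0 yi]mxE -/vi.
by ring.
Qed.

Lemma gradient_slot j (v : 'rV[K]_5) l : v 0 vi = 1 ->
  ('X_vi ^+ 3 * 'X_j : {mpoly K[5]})^`M(l).@[v 0] = v 0 j *+ (3 * (l == vi)) + (l == j)%:R.
Proof.
move=> v1.
have dX k : ('X_k : {mpoly K[5]})^`M(l).@[v 0] = (l == k)%:R.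
  rewrite mderivX mnm1E eq_sym mevalZ; case: eqP => [->|_]; last by rewrite mul0r.
  have -> : (U_(k) - U_(k) = 0 :> 'X_{1..5})%MM by apply/mnmP => h; rewrite mnmBE subnn mnm0E.
  by rewrite mpolyX0 meval1 mulr1.
rewrite !exprS expr0 mulr1 !mderivM !(mevalD, mevalM) !dX !mevalXU v1.
by case: (l == vi); case: (l == j); rewrite /=; ring.
Qed.

(* A point of the singular locus with i-th y-coordinate 1 determines the
   coefficients of the monomials y_i^3 X_j: the parameters of the quartics with
   such a singular point depend on one parameter less. *)
Lemma generic_no_singular_slot : exists P : (params -> K) -> K,
  [/\ polyfun P, exists n, P n != 0 &
   forall n v, gradient (normal_quartic n) v = 0 -> v 0 vi = 1 -> P n = 0].
Proof.
pose pt (y : params -> K) : 'rV[K]_5 := \row_j if j == vi then 1 else y (slot j).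
pose g (y : params -> K) l := (normal_quartic (no_slots y))^`M(l).@[pt y 0].
have Pns s : polyfun (fun y : params -> K => no_slots y s).
  rewrite /no_slots; case: [exists _, _]; [exact: polyfun_const|exact: polyfun_var].
have Ppt j : polyfun (fun y => pt y 0 j).
  apply: (@polyfun_ext _ _ (fun y => if j == vi then 1 else y (slot j))).
    by move=> y; rewrite mxE.
  by case: (j == vi); [exact: polyfun_const|exact: polyfun_var].
have Pg l : polyfun (g^~ l).
  apply: (polyfam_meval (F := fun y => (normal_quartic (no_slots y))^`M(l)) (x := fun j y => pt y 0 j)) => //.
  apply: (polyfam_linear (mderiv l)).
  exact: (polyfam_comp (G := fun s y => no_slots y s) (@polyfam_normal_quartic K)).
(* The solution of g_l + c_l = 0 for l different from [vi] and g_vi + 3 (c_0 v_0 + ... + c_4 v_4) +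
   c_vi = 0, where v_vi = 1; the 4 collects 3 c_vi + c_vi. *)
pose sol l y : K := if l == vi
  then 4%:R^-1 * (3%:R * (\sum_(j | j != vi) g y j * pt y 0 j) - g y vi) else - g y l.
have Psol l : polyfun (sol l).
  rewrite /sol; case: (l == vi); last exact: polyfunN.
  apply: polyfunM; first exact: polyfun_const.
  apply: polyfunB => //; apply: polyfunM; first exact: polyfun_const.
  by apply: polyfun_sum => j _; apply: polyfunM.
pose Psi s y : K := if [pick l | s == slot l] is Some l then sol l y else y s.
have PPsi s : polyfun (Psi s).
  by rewrite /Psi; case: pickP => [l _|_]; [exact: Psol|exact: polyfun_var].
pose J := {s : params | s != slot vi}.
pose ext s (z : J -> K) : K := if insub s is Some u then z u else 0.
have Pext s : polyfun (ext s).
  by rewrite /ext; case: insubP => [u _ _|_]; [exact: polyfun_var|exact: polyfun_const].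
have ltJ : (#|{: J}| < #|{: params}|)%N.
  rewrite card_sig; have <- := cardC (pred1 (slot vi)).
  by rewrite card1 add1n ltnS; apply: eq_leq; apply: eq_card.
have [P [PP nzP P0]] := algebraically_dependent ltJ (fun s => polyfun_comp (PPsi s) Pext).
exists P; split=> // n v gv v1.
pose y s : K := if [pick l | s == slot l] is Some l then v 0 l else n s.
have y_slot j : y (slot j) = v 0 j.
  by rewrite /y; case: pickP => [l /eqP/slot_inj <-|/(_ j)] //; rewrite eqxx.
pose z (u : J) := y (val u).
have ptE : pt (ext^~ z) = v.
  apply/rowP => j; rewrite mxE; have [->//|nj] := eqVneq j vi.
  have nslot : slot j != slot vi by rewrite (inj_eq slot_inj).
  by rewrite /ext insubT /z /= y_slot.
have nsE : no_slots (ext^~ z) = no_slots n.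
  apply/funext => s; rewrite /no_slots; case: ifPn => // nex.
  have ns : s != slot vi by apply: contraNneq nex => ->; apply/existsP; exists vi.
  rewrite /ext insubT /z /= /y; case: pickP => // l sl.
  by case/existsP: nex; exists l.
have gE l : g (ext^~ z) l = (normal_quartic (no_slots n))^`M(l).@[v 0].
  by rewrite /g ptE nsE.
pose c j := n (slot j).
have rel l : g (ext^~ z) l + (\sum_j c j * v 0 j) *+ (3 * (l == vi)) + c l = 0.
  have := congr1 (fun M : 'rV_5 => M 0 l) gv; rewrite !mxE normal_quartic_slots.
  rewrite mderivD mevalD -gE (raddf_sum (mderiv l)) (raddf_sum (meval _)) /= => e; rewrite -[RHS]e -addrA; congr (_ + _).
  rewrite [RHS](eq_bigr (fun j => c j * v 0 j *+ (3 * (l == vi)) + c j *+ (l == j))).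
    rewrite big_split -sumrMnl /=; congr (_ + _).
    by rewrite (bigD1 l) //= eqxx mulr1n big1 ?addr0 // => j /negPf nj; rewrite eq_sym nj.
  move=> j _; rewrite mderivZ mevalZ gradient_slot // mulrDr mulrnAr.
  by case: (l == j); rewrite ?mulr1 ?mulr0.
have solE l : sol l (ext^~ z) = c l.
  have cl k : k != vi -> c k = - g (ext^~ z) k.
    by move=> nk; apply/eqP; rewrite -addr_eq0; have := rel k; rewrite (negPf nk) muln0 mulr0n addr0 addrC => ->.
  rewrite /sol; case: eqVneq => [->|nl]; last by rewrite cl.
  have := rel vi; rewrite eqxx muln1 (bigD1 vi) //= v1 mulr1 ptE.
  rewrite (eq_bigr (fun j => - (g (ext^~ z) j * v 0 j))); last by move=> j nj; rewrite cl // mulNr.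
  rewrite sumrN; set S := \sum_(_ | _) _ => e.
  have -> : c vi = 4%:R^-1 * (4%:R * c vi) by rewrite mulKf ?pnatr_eq0.
  congr (_ * _); apply/eqP; rewrite -subr_eq0; apply/eqP; rewrite -[RHS]oppr0 -[in RHS]e.
  by ring.
have PsiE : (fun s => Psi s (ext^~ z)) = n.
  apply/funext => s; rewrite /Psi; case: pickP => [l /eqP -> |ns]; first by rewrite solE.
  have nvi : s != slot vi by rewrite ns.
  rewrite /ext insubT /z /= /y; case: pickP => // l; by rewrite ns.
by have := P0 z; rewrite PsiE.
Qed.

End Slots.

Lemma normal_quartic_y0 n (v : 'rV[K]_5) :
  (forall i : 'I_3, v 0 (lift ord0 (lift ord0 i)) = 0) ->
  (normal_quartic n).@[v 0] = v 0 0 ^+ 2 * v 0 1 ^+ 2.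
Proof.
move=> y0; rewrite meval_normal_quartic /=.
have -> : ypart (zpart v) = fun i => 0 * ypart (zpart v) i.
  by apply/funext => i; rewrite mul0r /ypart mxE y0.
rewrite /cone2 /cone3 /cone4 !lvalZ !low_valZ // !expr0n /= !mul0r !mulr0 !addr0 mxE.
have -> : lift ord0 0 = 1 :> 'I_5 by apply: val_inj.
by rewrite mulr0 addr0 mulrC.
Qed.

(** A singular point with some nonzero y-coordinate can be rescaled to make it 1, a case excluded
    generically. On the line y = 0 the quartic is x0^2 z1^2, and its derivative in x0 leaves only
    the two coordinate points. *)
Theorem generic_singular_locus : exists G : (params -> K) -> K,
  [/\ polyfun G, exists n, G n != 0 & forall n, G n != 0 ->
    forall v : 'rV[K]_5, gradient (normal_quartic n) v = 0 ->
      exists c, v = c *: delta_mx 0 0 \/ v = c *: delta_mx 0 1].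
Proof.
have [P0 [PP0 [n0 nz0] z0]] := generic_no_singular_slot 0.
have [P1 [PP1 [n1 nz1] z1]] := generic_no_singular_slot 1.
have [P2 [PP2 [n2 nz2] z2]] := generic_no_singular_slot 2.
have [n01 [nz01 nz01']] := polyfun_irreducible PP0 PP1 nz0 nz1.
have P01 := polyfunM PP0 PP1.
have [n012 [nz012 nz012']] := polyfun_irreducible P01 PP2 (mulf_neq0 nz01 nz01') nz2.
exists (fun n => P0 n * P1 n * P2 n); split; first exact: polyfunM.
  by exists n012; apply: mulf_neq0.
move=> n; rewrite !mulf_eq0 !negb_or => /andP[/andP[n0' n1'] n2'] v gv.
have y0 (i : 'I_3) : v 0 (lift ord0 (lift ord0 i)) = 0.
  apply/eqP; apply: contraT => vn0.
  pose w := (v 0 (lift ord0 (lift ord0 i)))^-1 *: v.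
  have gw : gradient (normal_quartic n) w = 0 by apply: gradient_eq0_scale; rewrite ?invr_eq0.
  have w1 : w 0 (lift ord0 (lift ord0 i)) = 1 by rewrite mxE mulVf.
  have [/eqP i0|[/eqP i1|/eqP i2]] : i == 0 \/ i == 1 \/ i == 2.
    by case: i {w gw w1 vn0} => [[|[|[|//]]]] lti; [left|right; left|right; right]; apply/eqP/val_inj.
  - by case/eqP: n0'; apply: (z0 n w gw); rewrite -i0.
  - by case/eqP: n1'; apply: (z1 n w gw); rewrite -i1.
  by case/eqP: n2'; apply: (z2 n w gw); rewrite -i2.
have xz : v 0 0 * v 0 1 = 0.
  have lineE : line_poly (normal_quartic n) v (delta_mx 0 0) =
      ((v 0 0)%:P + 'X) ^+ 2 * ((v 0 1) ^+ 2)%:P.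
    apply: poly_horner_inj => t; rewrite horner_line_poly normal_quartic_y0; last first.
      by move=> i; rewrite !mxE y0 /= mulr0 addr0.
    by rewrite !hornerE !mxE /= mulr1 mulr0 addr0.
  have := coef1_line_poly (normal_quartic n) v (delta_mx 0 0).
  rewrite gv trmx0 mulmx0 mxE lineE.
  have -> (p : {poly K}) : p`_1 = p^`().[0] by rewrite horner_coef0 coef_deriv.
  rewrite expr2 !derivM derivD !derivC derivX !hornerE => e.
  have : 2%:R * (v 0 0 * v 0 1 ^+ 2) = 0 by rewrite -[RHS]e /=; ring.
  move/eqP; rewrite !mulf_eq0 pnatr_eq0 /= orbb.
  by case/orP => /eqP ->; rewrite ?mul0r ?mulr0.
have vE : v = v 0 0 *: delta_mx 0 0 + v 0 1 *: delta_mx 0 1.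
  apply/rowP => j; rewrite !mxE; have [k ->|->] := unliftP ord0 j; last first.
    by rewrite /= mulr1 mulr0 addr0.
  have [k' ->|->] := unliftP ord0 k; first by rewrite y0 /= !mulr0 addr0.
  by rewrite /= mulr0 mulr1 add0r; congr (v 0 _); apply: val_inj.
move/eqP: xz; rewrite mulf_eq0 => /orP[] /eqP v0.
  by exists (v 0 1); right; rewrite {1}vE v0 scale0r add0r.
by exists (v 0 0); left; rewrite {1}vE v0 scale0r addr0.
Qed.

End Singular.

(** * Ranks of the two singularities *)

Section Ranks.
Variable K : numClosedFieldType.
Implicit Types n : params -> K.

Lemma rank_congruence r m (E : 'M[K]_(r, m)) (D : 'M[K]_r) :
  row_free E -> D \in unitmx -> \rank (E^T *m D *m E) = r.
Proof.
move=> fE uD; rewrite mxrankMfree // -mxrank_tr trmx_mul trmxK mxrankMfree //.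
by rewrite mxrank_tr; apply: mxrank_unit.
Qed.

Lemma rank_row' m k (B : 'M[K]_(m.+1, k)) (v : 'rV[K]_m.+1) i :
  v *m B = 0 -> v 0 i != 0 -> \rank (row' i B) = \rank B.
Proof.
move=> vB vi; apply/eqP; rewrite eqn_leq; apply/andP; split.
  apply: mxrankS; apply/row_subP => j.
  by rewrite (_ : row j (row' i B) = row (lift i j) B) ?row_sub //; apply/rowP => l; rewrite !mxE.
apply: mxrankS; apply/row_subP => j.
have sub l : (row (lift i l) B <= row' i B)%MS.
  by rewrite (_ : row (lift i l) B = row l (row' i B)) ?row_sub //; apply/rowP => h; rewrite !mxE.
have [l ->|->] := unliftP i j; first exact: sub.
have : v 0 i *: row i B = - \sum_(l | l != i) v 0 l *: row l B.
  apply/eqP; rewrite -addr_eq0; apply/eqP; rewrite -[RHS]vB mulmx_sum_row.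
  by rewrite [RHS](bigD1 i).
move=> e; have -> : row i B = (v 0 i)^-1 *: (- \sum_(l | l != i) v 0 l *: row l B).
  by rewrite -e scalerA mulVf ?scale1r.
apply: scalemx_sub; rewrite eqmx_opp; apply: summx_sub => l nl; apply: scalemx_sub.
by have [h ->|lE] := unliftP i l; [exact: sub|rewrite lE eqxx in nl].
Qed.

(** The radial vector v is in the kernel of the symmetric Hessian, so row i and column i are
    combinations of the others and may be deleted. *)
Lemma rank_chart_hessian m (F : {mpoly K[m.+1]}) i (v : 'rV[K]_m.+1) :
  v *m hessian F v = 0 -> v 0 i != 0 -> \rank (chart_hessian F i v) = \rank (hessian F v).
Proof.
move=> vH vi.
have -> : chart_hessian F i v = (row' i (row' i (hessian F v))^T)^T.
  by apply/matrixP => j k; rewrite !mxE.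
rewrite mxrank_tr (rank_row' _ vi) ?mxrank_tr ?(rank_row' vH vi) //.
have -> : (row' i (hessian F v))^T = hessian F v *m col' i 1%:M.
  rewrite -{2}hessian_sym; apply/matrixP => j k; rewrite !mxE (bigD1 (lift i k)) //=.
  rewrite !mxE eqxx mulr1 big1 ?addr0 // => l nl; by rewrite !mxE (negPf nl) mulr0.
by rewrite mulmxA vH mul0mx.
Qed.

Let i2 : 'I_5 := lift ord0 (lift ord0 0).
Let i3 : 'I_5 := lift ord0 (lift ord0 1).

Lemma zpartD (v w : 'rV[K]_5) : zpart (v + w) = zpart v + zpart w.
Proof. by apply/rowP => i; rewrite !mxE. Qed.

Lemma zpartZ c (v : 'rV[K]_5) : zpart (c *: v) = c *: zpart v.
Proof. by apply/rowP => i; rewrite !mxE. Qed.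

Lemma zpart_e0 : zpart (delta_mx 0 0) = 0 :> 'rV[K]_4.
Proof. by apply/rowP => i; rewrite !mxE. Qed.

Lemma line_poly_node n c (w : 'rV[K]_5) j (q a b : K) :
    (forall t, (normal_quartic n).@[(c *: delta_mx 0 j + t *: w) 0] =
       (c ^+ 2 * t ^+ 2 * q + t ^+ 3 * a + t ^+ 4 * b)) ->
  line_poly (normal_quartic n) (c *: delta_mx 0 j) w =
    (c ^+ 2 * q)%:P * 'X^2 + a%:P * 'X^3 + b%:P * 'X^4.
Proof.
move=> lineE.
by apply: poly_horner_inj => t; rewrite horner_line_poly lineE !hornerE /=; ring.
Qed.

Lemma coef2_hessian n c (w : 'rV[K]_5) j (q a b : K) :
    line_poly (normal_quartic n) (c *: delta_mx 0 j) w =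
      (c ^+ 2 * q)%:P * 'X^2 + a%:P * 'X^3 + b%:P * 'X^4 ->
  (w *m hessian (normal_quartic n) (c *: delta_mx 0 j) *m w^T) 0 0 = 2%:R * c ^+ 2 * q.
Proof.
move=> lineE; rewrite -coef2_line_poly lineE.
rewrite !coefD !coefCM !coefXn /= !mulr0 !addr0 mulr1 -mulr_natl.
ring.
Qed.

Lemma hessian_from_quadratic (m r : nat) (p : {mpoly K[m]}) v (E : 'M[K]_(r, m)) (D : 'M[K]_r) k :
    D^T = D ->
    (forall w : 'rV_m, (w *m hessian p v *m w^T) 0 0 = k * (w *m E^T *m D *m (w *m E^T)^T) 0 0) ->
  hessian p v = E^T *m (k *: D) *m E.
Proof.
move=> symD quad; apply: sym_mx_eq_quadratic; first exact: hessian_sym.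
  by rewrite !trmx_mul trmxK linearZ /= symD mulmxA.
by move=> w; rewrite quad trmx_mul trmxK !mulmxA -scalemxAr -!scalemxAl [RHS]mxE.
Qed.

(** For distinct a and b, the symmetric matrix of the quadratic form x_a x_b. *)
Definition half2 r (a b : nat) : 'M[K]_r :=
  \matrix_(i, j) (2%:R^-1 * (((i == a :> nat) && (j == b :> nat)) || ((i == b :> nat) && (j == a :> nat)))%:R).

Let D3 : 'M[K]_3 := delta_mx 0 0 + half2 3 1 2.
Let D4 : 'M[K]_4 := half2 4 0 1 + half2 4 2 3.

Let half2_sym r a b : (half2 r a b)^T = half2 r a b.
Proof. by apply/matrixP => i j; rewrite !mxE orbC [in RHS]andbC [X in _ || X]andbC. Qed.

Let D3_unit : D3 \in unitmx.
Proof.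
suff : D3 *m (delta_mx 0 0 + 4%:R *: half2 3 1 2) = 1%:M by case/mulmx1_unit.
apply/matrixP => i j; rewrite !mxE !big_ord_recl big_ord0 !mxE.
by case: i => [[|[|[|//]]]] lti; case: j => [[|[|[|//]]]] ltj; rewrite /=; field.
Qed.

Let D4_unit : D4 \in unitmx.
Proof.
suff : D4 *m (4%:R *: D4) = 1%:M by case/mulmx1_unit.
apply/matrixP => i j; rewrite !mxE !big_ord_recl big_ord0 !mxE.
by case: i => [[|[|[|[|//]]]]] lti; case: j => [[|[|[|[|//]]]]] ltj; rewrite /=; field.
Qed.

Let D3_quad (x : 'rV[K]_3) : (x *m D3 *m x^T) 0 0 = x 0 0 ^+ 2 + x 0 1 * x 0 2.
Proof.
rewrite !mxE !big_ord_recl big_ord0 !mxE !big_ord_recl !big_ord0 !mxE /=.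
have -> : lift ord0 ord0 = 1 :> 'I_3 by apply: val_inj.
have -> : lift ord0 (lift ord0 ord0) = 2 :> 'I_3 by apply: val_inj.
by field.
Qed.

Let D4_quad (x : 'rV[K]_4) : (x *m D4 *m x^T) 0 0 =
  x 0 0 * x 0 1 + x 0 (inord 2) * x 0 (inord 3).
Proof.
rewrite !mxE !big_ord_recl big_ord0 !mxE !big_ord_recl !big_ord0 !mxE /=.
have -> : lift ord0 ord0 = 1 :> 'I_4 by apply: val_inj.
have -> : lift ord0 (lift ord0 ord0) = inord 2 :> 'I_4 by apply: val_inj; rewrite /= inordK.
have -> : lift ord0 (lift ord0 (lift ord0 ord0)) = inord 3 :> 'I_4 by apply: val_inj; rewrite /= inordK.
by field.
Qed.

Let sel3 : 'M[K]_(3, 5) := \matrix_(i, j) (j == i.+1 :> nat)%:R.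

(** The embedding of the hyperplane z1 = 0; its transpose is the projection from the point (0 : 1 :
    0 : 0 : 0). *)
Definition insert1 : 'M[K]_(4, 5) := \matrix_(i, j) (j == lift 1 i)%:R.

Let sel3_free : row_free sel3.
Proof.
apply/row_freeP; exists sel3^T; apply/matrixP => i j; rewrite !mxE !big_ord_recl big_ord0 !mxE.
by case: i => [[|[|[|//]]]] lti; case: j => [[|[|[|//]]]] ltj; rewrite /=; ring.
Qed.

Lemma insert1K : insert1 *m insert1^T = 1%:M.
Proof.
apply/matrixP => i j; rewrite !mxE (bigD1 (lift 1 i)) //= big1 => [|k nk].
  by rewrite !mxE eqxx mul1r addr0 (inj_eq (@lift_inj _ _)).
by rewrite !mxE (negPf nk) mul0r.
Qed.

Lemma drop1E (v : 'rV[K]_5) k : (v *m insert1^T) 0 k = v 0 (lift 1 k).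
Proof.
rewrite mxE (bigD1 (lift 1 k)) //= !mxE eqxx mulr1 big1 ?addr0 // => l nl.
by rewrite !mxE (negPf nl) mulr0.
Qed.

Lemma normal_quartic_drop1 n (v : 'rV[K]_5) : let x := v *m insert1^T in
  (normal_quartic n).@[v 0] = v 0 1 ^+ 2 * cone2 n (x 0 0) (ypart x) +
    v 0 1 * cone3 n (x 0 0) (ypart x) + cone4 n (x 0 0) (ypart x).
Proof.
rewrite /= meval_normal_quartic drop1E.
have -> : ypart (v *m insert1^T) = ypart (zpart v).
  apply/funext => i; rewrite /ypart drop1E mxE; congr (v 0 _); apply: val_inj.
  by case: i => [[|[|[|//]]]] lti.
have -> : lift 1 0 = 0 :> 'I_5 by apply: val_inj.
rewrite mxE; have -> : lift ord0 0 = 1 :> 'I_5 by apply: val_inj.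
by [].
Qed.

(** One expansion gives everything at this point: the absence of degrees 0 and 1 shows that it is
    singular, and the coefficient of degree 2 is its tangent cone. *)
Lemma line_poly_e0 n c (w : 'rV[K]_5) :
  let q := (nq2 K).@[zpart w 0] in let a := (nq3 n).@[zpart w 0] in
  let b := (nq4 n).@[zpart w 0] in
  line_poly (normal_quartic n) (c *: delta_mx 0 0) w =
  (c ^+ 2 * q)%:P * 'X^2 + (2%:R * c * w 0 0 * q + c * a)%:P * 'X^3 +
  (w 0 0 ^+ 2 * q + w 0 0 * a + b)%:P * 'X^4.
Proof.
move=> q a b; apply: line_poly_node.
  move=> t; rewrite meval_cone_form zpartD !zpartZ zpart_e0 scaler0 add0r.
  rewrite (meval_homog _ _ (nq2_homog K)) (meval_homog _ _ (nq3_homog n)) (meval_homog _ _ (nq4_homog n)).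
  by rewrite -/q -/a -/b !mxE /= mulr1; ring.
Qed.

Lemma hessian_e0 n c : c != 0 -> let v := c *: delta_mx 0 0 : 'rV[K]_5 in
  v *m hessian (normal_quartic n) v = 0 /\ \rank (hessian (normal_quartic n) v) = 3.
Proof.
move=> cn0 v.
have HE : hessian (normal_quartic n) v = sel3^T *m ((2%:R * c ^+ 2) *: D3) *m sel3.
  apply: hessian_from_quadratic => [|w].
    by rewrite linearD /= trmx_delta half2_sym.
  rewrite (coef2_hessian (line_poly_e0 n c w)).
  rewrite D3_quad meval_nq2; congr (_ * _).
    have selE k : (w *m sel3^T) 0 k = w 0 (lift ord0 (widen_ord (leqnSn _) k)).
      rewrite mxE (bigD1 (lift ord0 (widen_ord (leqnSn _) k))) //= !mxE /= /bump /= add1n eqxx mulr1.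
      rewrite big1 ?addr0 // => l nl; rewrite !mxE; case: eqP => [e|]; last by rewrite mulr0.
      by case/eqP: nl; apply: val_inj.
    rewrite !selE /ypart !mxE; congr (w 0 _ ^+ 2 + w 0 _ * w 0 _); exact: val_inj.
rewrite HE rank_congruence ?sel3_free ?unitmxZ ?D3_unit ?unitfE ?mulf_neq0 ?expf_neq0 ?pnatr_eq0 //.
split=> //; rewrite !mulmxA; have -> : v *m sel3^T = 0; last by rewrite !mul0mx.
apply/rowP => i; rewrite /v -scalemxAl -rowE !mxE mulr0 //.
Qed.

Lemma line_poly_e1 n c (w : 'rV[K]_5) :
  let x := w *m insert1^T in let q := cone2 n (x 0 0) (ypart x) in
  let a := cone3 n (x 0 0) (ypart x) in let b := cone4 n (x 0 0) (ypart x) in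
  line_poly (normal_quartic n) (c *: delta_mx 0 1) w =
  (c ^+ 2 * q)%:P * 'X^2 + (2%:R * c * w 0 1 * q + c * a)%:P * 'X^3 +
  (w 0 1 ^+ 2 * q + w 0 1 * a + b)%:P * 'X^4.
Proof.
move=> x q a b; apply: line_poly_node.
  move=> t; rewrite normal_quartic_drop1 /=.
  have -> : (c *: delta_mx 0 1 + t *: w) *m insert1^T = t *: x.
    rewrite mulmxDl -!scalemxAl -/x [delta_mx 0 1 *m _](_ : _ = 0) ?scaler0 ?add0r //.
    by apply/rowP => k; rewrite drop1E !mxE eqxx /= [_ == 1]eq_sym (negPf (neq_lift _ _)).
  rewrite ypartZ [(t *: x) 0 0]mxE cone2Z cone3Z cone4Z -/q -/a -/b.
  by rewrite !mxE /= mulr1; ring.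
Qed.

Lemma hessian_e1 n c : c != 0 -> \det (cone_coord n) != 0 ->
  let v := c *: delta_mx 0 1 : 'rV[K]_5 in
  v *m hessian (normal_quartic n) v = 0 /\ \rank (hessian (normal_quartic n) v) = 4.
Proof.
move=> cn0 dn0 v; pose E := (cone_coord n)^T *m insert1.
have HE : hessian (normal_quartic n) v = E^T *m ((2%:R * c ^+ 2) *: D4) *m E.
  apply: hessian_from_quadratic => [|w].
    by rewrite linearD /= !half2_sym.
  rewrite (coef2_hessian (line_poly_e1 n c w)).
  rewrite D4_quad /E trmx_mul trmxK mulmxA !mul_cone_coord !inordK //=.
  by rewrite /cone2 !mul1r !mul0r !add0r.
have freeE : row_free E.
  apply: inj_row_free => u; rewrite /E mulmxA => u0.
  have : u *m (cone_coord n)^T = 0 by rewrite -[LHS]mulmx1 -insert1K mulmxA u0 mul0mx.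
  move=> u1; rewrite -[u]mulmx1 -(@mulmxV _ _ (cone_coord n)^T) ?unitmx_tr ?unitmxE ?unitfE //.
  by rewrite mulmxA u1 mul0mx.
rewrite HE rank_congruence ?freeE ?unitmxZ ?D4_unit ?unitfE ?mulf_neq0 ?expf_neq0 ?pnatr_eq0 //.
split=> //; rewrite !mulmxA; have -> : v *m E^T = 0; last by rewrite !mul0mx.
rewrite /E trmx_mul trmxK mulmxA; have -> : v *m insert1^T = 0; last by rewrite mul0mx.
by apply/rowP => k; rewrite drop1E !mxE eqxx /= [_ == 1]eq_sym (negPf (neq_lift _ _)) mulr0.
Qed.

End Ranks.

(** * Points and lines *)

Section Subspaces.
Variable K : numClosedFieldType.

Lemma represented_subst N d (Z Z' : 'rV[K]_d -> Prop) (g : 'M[K]_d) :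
  g \in unitmx -> (forall v, Z' v <-> Z (v *m g)) -> represented N Z -> represented N Z'.
Proof.
move=> ug ZZ' [w [wZ wI wC]]; exists (fun i => w i *m invmx g); split.
- move=> i; have [wn0 Zw] := wZ i; split; last by apply/ZZ'; rewrite mulmxKV.
  by apply: contraNneq wn0 => e; rewrite -[w i](mulmxKV ug) e mul0mx.
- move=> i j c e; apply: (wI i j c); rewrite -[w i](mulmxKV ug) e -scalemxAl mulmxKV //.
move=> v vn0 /ZZ' Zv; have vgn0 : v *m g != 0.
  by apply: contraNneq vn0 => e; rewrite -[v](mulmxK ug) e mul0mx.
have [i [c e]] := wC _ vgn0 Zv; exists i, c.
by rewrite -[v](mulmxK ug) e scalemxAl.
Qed.

Lemma vline_eqP d (v w : 'rV[K]_d) : v != 0 -> <[v]>%VS = <[w]>%VS -> exists c, v = c *: w.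
Proof. by move=> vn0 e; apply/vlineP; rewrite -e memv_line. Qed.

Lemma proj_point_line n (p : {vspace 'rV[K]_n.+1}) v :
  proj_point p -> v \in p -> v != 0 -> p = <[v]>%VS.
Proof.
move=> dp vp vn0; apply/esym/eqP; rewrite eqEdim -memvE vp /= dim_vline vn0.
by rewrite [X in (X <= _)%N]dp.
Qed.

Lemma proj_pointP n (p : {vspace 'rV[K]_n.+1}) : proj_point p ->
  exists2 v, v != 0 & p = <[v]>%VS.
Proof.
move=> dp; have pn0 : vpick p != 0.
  by rewrite vpick0; apply: contra_eq_neq dp => ->; rewrite dimv0.
by exists (vpick p) => //; apply: proj_point_line; rewrite ?memv_pick.
Qed.

Lemma proj_point_vline n (v : 'rV[K]_n.+1) : v != 0 -> proj_point <[v]>%VS.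
Proof. by move=> vn0; rewrite /proj_point dim_vline vn0. Qed.

Lemma has_exactly_points N n (Z : 'rV[K]_n.+1 -> Prop) :
  (forall c v, Z v -> Z (c *: v)) -> represented N Z ->
  has_exactly N (fun p : {vspace 'rV[K]_n.+1} => proj_point p /\ forall v, v \in p -> Z v).
Proof.
move=> Zc [w [wZ wI wC]]; exists [seq <[w i]>%VS | i <- enum 'I_N]; split.
- rewrite map_inj_uniq ?enum_uniq // => i j /vline_eqP e.
  by have [c] := e (wZ i).1; apply: wI.
- by rewrite size_map size_enum_ord.
move=> p; split=> [/mapP[i _ ->]|[dp pZ]].
  split; first exact: proj_point_vline (wZ i).1.
  by move=> v /vlineP[c ->]; apply: Zc; case: (wZ i).
have [v vn0 pE] := proj_pointP dp.
have vp : v \in p by rewrite pE memv_line.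
have [i [c e]] := wC v vn0 (pZ v vp); apply/mapP; exists i; rewrite ?mem_enum //.
have cn0 : c != 0 by apply: contraNneq vn0 => c0; rewrite e c0 scale0r.
apply: proj_point_line => //; last by case: (wZ i).
by rewrite pE; apply/vlineP; exists c^-1; rewrite e scalerA mulVf ?scale1r.
Qed.

Lemma proj_line_add n (v w : 'rV[K]_n.+1) : v != 0 -> w \notin <[v]>%VS ->
  proj_line (<[v]> + <[w]>)%VS.
Proof.
move=> vn0 nw; have wn0 : w != 0 by apply: contraNneq nw => ->; rewrite mem0v.
rewrite /proj_line dimv_disjoint_sum ?dim_vline ?vn0 ?wn0 //.
apply/eqP; rewrite -subv0; apply/subvP => u; rewrite memv_cap memv0 => /andP[/vlineP[a ->] /vlineP[b e]].
have [b0|bn0] := eqVneq b 0; first by rewrite e b0 scale0r.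
by case/negP: nw; apply/vlineP; exists (b^-1 * a); rewrite -scalerA e scalerA mulVf ?scale1r.
Qed.

Lemma lines_through_representatives n (p L : {vspace 'rV[K]_n.+1}) v :
  v != 0 -> p = <[v]>%VS -> proj_line L -> (p <= L)%VS ->
  exists2 w, w \notin <[v]>%VS & L = (<[v]> + <[w]>)%VS.
Proof.
move=> vn0 -> dL sub.
have /subvPn[w wL nw] : ~~ (L <= <[v]>)%VS.
  apply/negP => /dimvS; rewrite dim_vline vn0 [X in (X <= _)%N]dL.
  by [].
exists w => //; apply/esym/eqP; rewrite eqEdim subv_add sub -memvE wL /=.
by rewrite (proj_line_add vn0 nw) [X in (X <= _)%N]dL.
Qed.

Section Lines.
Variables (n : params -> K) (M : 'M[K]_5) (w : 'rV[K]_5) (c : K).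
Hypotheses (uM : M \in unitmx) (cn0 : c != 0) (wM : w *m M = c *: delta_mx 0 1).
Let F := lin_subst M (normal_quartic n).

Let lift1 (x : 'rV[K]_4) : 'rV[K]_5 := x *m insert1 K *m invmx M.

Let lift1M x : lift1 x *m M = x *m insert1 K. Proof. by rewrite mulmxKV. Qed.

Let insert1_1 (x : 'rV[K]_4) : (x *m insert1 K) 0 1 = 0.
Proof.
by rewrite mxE big1 // => k _; rewrite mxE (negPf (neq_lift _ _)) mulr0.
Qed.

Let insert1K' (x : 'rV[K]_4) : x *m insert1 K *m (insert1 K)^T = x.
Proof. by rewrite -mulmxA insert1K mulmx1. Qed.

Let drop_e1 : (delta_mx 0 1 : 'rV[K]_5) *m (insert1 K)^T = 0.
Proof. by apply/rowP => k; rewrite drop1E !mxE eqxx /= [_ == 1]eq_sym (negPf (neq_lift _ _)). Qed.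

Let wn0 : w != 0.
Proof.
apply/eqP => w0; move: wM; rewrite w0 mul0mx => /rowP/(_ 1); rewrite !mxE mulr1 => /esym/eqP.
by rewrite (negPf cn0).
Qed.

Let F_eval a b (x : 'rV[K]_4) : F.@[(a *: w + b *: lift1 x) 0] =
  (a * c) ^+ 2 * (b ^+ 2 * cone2 n (x 0 0) (ypart x)) +
  (a * c) * (b ^+ 3 * cone3 n (x 0 0) (ypart x)) + b ^+ 4 * cone4 n (x 0 0) (ypart x).
Proof.
rewrite /F meval_lin_subst mulmxDl -!scalemxAl wM lift1M normal_quartic_drop1 /=.
rewrite mulmxDl -!scalemxAl drop_e1 !scaler0 add0r insert1K' ypartZ [(b *: x) 0 0]mxE.
rewrite cone2Z cone3Z cone4Z.
rewrite [X in X ^+ 2](_ : _ = a * c); last first.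
  by rewrite mxE [X in X + _]mxE [X in _ + X]mxE insert1_1 !mxE /= mulr0 addr0 mulr1.
rewrite [X in _ + X * _ + _](_ : _ = a * c) //.
by rewrite mxE [X in X + _]mxE [X in _ + X]mxE insert1_1 !mxE /= mulr0 addr0 mulr1.
Qed.

Let lift1_notin x : x != 0 -> lift1 x \notin <[w]>%VS.
Proof.
move=> xn0; apply/negP => /vlineP[k e]; case/eqP: xn0.
by rewrite -[x]insert1K' -lift1M e -scalemxAl wM scalerA -scalemxAl drop_e1 scaler0.
Qed.

(** A line through the node is spanned by it and a point of the hyperplane z1 = 0. The equation
    restricted to the line has [cone2], [cone3] and [cone4] at that point as coefficients, so the
    line lies on the quartic exactly when all three vanish. *)
Theorem lines_through_node : represented 24 (line_zero n) ->
  has_exactly 24 (lines_through F <[w]>%VS).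
Proof.
move=> [x [xZ xI xC]].
exists [seq (<[w]> + <[lift1 (x i)]>)%VS | i <- enum 'I_24]; split.
- rewrite map_inj_uniq ?enum_uniq // => i j e.
  have : lift1 (x i) \in (<[w]> + <[lift1 (x j)]>)%VS.
    by rewrite -e (subvP (addvSr _ _)) // memv_line.
  case/memv_addP => _ /vlineP[a ->] [_ /vlineP[b ->] eq1].
  apply: (xI i j b); rewrite -[x i]insert1K' -lift1M eq1 mulmxDl -!scalemxAl wM lift1M.
  by rewrite mulmxDl -!scalemxAl drop_e1 !scaler0 add0r insert1K'.
- by rewrite size_map size_enum_ord.
move=> L; split=> [/mapP[i _ ->]|[dL sub FL]].
  have [xn0 [x2 x3 x4]] := xZ i; split.
  + exact: proj_line_add wn0 (lift1_notin xn0).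
  + exact: addvSl.
  move=> v /memv_addP[_ /vlineP[a ->] [_ /vlineP[b ->] ->]].
  by rewrite F_eval x2 x3 x4 !mulr0 !addr0.
have [u nu LE] := lines_through_representatives wn0 erefl dL sub.
pose y := u *m M *m (insert1 K)^T.
have uE : u = ((u *m M) 0 1 / c) *: w + lift1 y.
  apply: (can_inj (mulmxK uM)); rewrite mulmxDl -scalemxAl wM lift1M scalerA divfK //.
  apply/rowP => k; rewrite [RHS]mxE [X in _ = X + _]mxE.
  have [l ->|->] := unliftP 1 k.
    rewrite [X in _ = _ * X + _]mxE [lift 1 l == 1]eq_sym (negPf (neq_lift _ _)) andbF mulr0 add0r.
    by rewrite -[RHS]drop1E insert1K' [RHS]drop1E.
  by rewrite [X in _ = _ * X + _]mxE !eqxx mulr1 insert1_1 addr0.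
have yL : lift1 y \in L.
  have -> : lift1 y = - ((u *m M) 0 1 / c) *: w + u by rewrite [X in _ + X]uE scaleNr addKr.
  by rewrite LE memv_add // ?memv_line // memvZ ?memv_line.
have wL : w \in L by rewrite LE (subvP (addvSl _ _)) ?memv_line.
have yn0 : y != 0.
  apply: contraNneq nu => y0; rewrite uE y0 /lift1 !mul0mx addr0.
  by rewrite memvZ ?memv_line.
have evalL a : (a * c) ^+ 2 * cone2 n (y 0 0) (ypart y) + (a * c) * cone3 n (y 0 0) (ypart y) +
    cone4 n (y 0 0) (ypart y) = 0.
  have := FL (a *: w + 1 *: lift1 y); rewrite F_eval !expr1n !mul1r => -> //.
  by rewrite scale1r memvD // memvZ.
have y4 : cone4 n (y 0 0) (ypart y) = 0.
  by have := evalL 0; rewrite mul0r expr0n /= !mul0r !add0r.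
(* With the value at 0 removed, the values at 1 and -1 of the quadratic polynomial in a c separate
   its two other coefficients. *)
have e1 := evalL c^-1; have e2 := evalL (- c^-1).
rewrite y4 addr0 mulVf // expr1n !mul1r in e1.
rewrite y4 addr0 mulNr mulVf // sqrrN expr1n !mul1r mulN1r in e2.
have y2 : cone2 n (y 0 0) (ypart y) = 0.
  apply: (mulfI (_ : 2%:R != 0 :> K)); rewrite ?pnatr_eq0 // mulr0.
  rewrite -[RHS]addr0 -[X in X + _]e1 -[X in _ + X]e2; ring.
have y3 : cone3 n (y 0 0) (ypart y) = 0 by move: e1; rewrite y2 add0r.
have [i [k yk]] := xC y yn0 (And3 y2 y3 y4).
have kn0 : k != 0 by apply: contraNneq yn0 => k0; rewrite yk k0 scale0r.
apply/mapP; exists i; rewrite ?mem_enum //; apply/esym/eqP; rewrite eqEdim.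
rewrite (proj_line_add wn0 (lift1_notin (xZ i).1)) [X in (X <= _)%N]dL leqnn andbT.
rewrite subv_add -!memvE wL /=.
have -> : lift1 (x i) = k^-1 *: lift1 y.
  by rewrite /lift1 yk -!scalemxAl scalerA mulVf ?scale1r.
by rewrite memvZ.
Qed.

End Lines.
End Subspaces.

Section Good.
Variable K : numClosedFieldType.
Implicit Types n : params -> K.

(** The first four conditions put every admissible transform of the quartic into the second type;
    the last one provides the lines. *)
Definition good n : Prop :=
  [/\ forall v : 'rV[K]_5, gradient (normal_quartic n) v = 0 ->
        exists c, v = c *: delta_mx 0 0 \/ v = c *: delta_mx 0 1,
      (nq3 n).@[(delta_mx 0 ord_max : 'rV_4) 0] != 0,
      \det (cone_coord n) != 0,
      represented 24 (cone_zero n) & represented 24 (line_zero n)].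

Lemma polyfun_and (I : Type) (f g : (I -> K) -> K) : polyfun f -> polyfun g ->
  (exists v, f v != 0) -> (exists v, g v != 0) -> exists v, f v * g v != 0.
Proof.
move=> Pf Pg [v fv] [w gw]; have [u [fu gu]] := polyfun_irreducible Pf Pg fv gw.
by exists u; apply: mulf_neq0.
Qed.

Theorem generic_good : exists D : (params -> K) -> K,
  [/\ polyfun D, exists n, D n != 0 & forall n, D n != 0 -> good n].
Proof.
have [G1 [P1 nz1 g1]] := generic_singular_locus K.
have [G2 [P2 nz2 g2]] := generic_cone_zeros K.
have [G3 [P3 [n3 [nz3 nz3']] g3]] := generic_line_zeros K.
pose q n := (nq3 n).@[(delta_mx 0 ord_max : 'rV[K]_4) 0].
have Pq : polyfun q by apply: (polyfam_scalar (meval _) (@polyfam_nq3 K)).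
have Pd : polyfun (fun n => \det (cone_coord n)).
  by apply: polyfun_det => i j; apply: polyfun_cone_coord.
have nzq : exists n, q n != 0.
  pose p : {mpoly K[4]} := 'X_ord_max ^+ 3.
  have hp : p \is 3.-homog by apply: (dhomogMn 3 (var_homog _ _)).
  have dp : deg0 1 p.
    apply: (@deg0_leq _ 0) => //.
    have -> : p = 'X_(lift ord0 2) ^+ 3 by congr ('X_ _ ^+ 3); apply: val_inj.
    exact: deg0_varX.
  have h0 : (0 : {mpoly K[4]}) \is 4.-homog by exact: rpred0.
  have d0 : deg0 1 (0 : {mpoly K[4]}) by move=> m; rewrite mcoeff0 eqxx.
  have [l3 _] := low_form_sum (fun _ _ => 0) hp h0 dp d0.
  have lf0 k : lform (params_of (fun _ _ => 0) (p + 0)) k = 0 by apply: big1 => i _; rewrite scale0r.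
  exists (params_of (fun _ _ => 0) (p + 0)); rewrite /q /nq3 l3 !lf0.
  by rewrite addr0 mulr0 add0r meval_exp mevalXU mxE !eqxx expr1n oner_eq0.
exists (fun n => G1 n * G2 n * (G3 n * \det (cone_coord n)) * q n); split.
- by do 2?apply: polyfunM => //; apply: polyfunM.
- apply: polyfun_and => //; first by do 2?apply: polyfunM => //; apply: polyfunM.
  apply: polyfun_and; [exact: polyfunM|exact: polyfunM|exact: polyfun_and|].
  by exists n3; apply: mulf_neq0.
move=> n; rewrite !mulf_eq0 !negb_or => /andP[/andP[/andP[n1 n2] /andP[n3' nd]] nq].
by split=> //; [exact: g1|exact: g2|exact: g3].
Qed.

Lemma has_exactly_ext (T : eqType) k (P Q : T -> Prop) :
  (forall x, P x <-> Q x) -> has_exactly k P -> has_exactly k Q.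
Proof.
by move=> PQ [s [us ss sP]]; exists s; split=> // x; split=> [/sP/PQ|/PQ/sP].
Qed.

Lemma projective_closure_cone (a b c : {mpoly K[4]}) :
  a \is 2.-homog -> b \is 3.-homog -> c \is 4.-homog ->
  projective_closure (a + b + c) = cone_form a b c.
Proof.
move=> ha hb hc; rewrite /projective_closure !big_ord_recr big_ord0 /= !pihomogD.
rewrite (pihomog_dE ha) (pihomog_dE hb) (pihomog_dE hc).
rewrite !(pihomog_ne0 _ ha) // !(pihomog_ne0 _ hb) // !(pihomog_ne0 _ hc) //.
by rewrite !addr0 !add0r comp_mpoly0 !mulr0 !add0r expr0 mul1r expr1.
Qed.

Lemma q2_homog : q2 K \is 2.-homog.
Proof. by apply: rpred_sum => i _; apply: (dhomogMn 2 (var_homog _ _)). Qed.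

Lemma gradient_e0 n c : gradient (normal_quartic n) (c *: delta_mx 0 0) = 0.
Proof.
apply: mx_eq_linear => w; rewrite -coef1_line_poly line_poly_e0 trmx0 mulmx0.
by rewrite !coefD !coefCM !coefXn /= !mulr0 !addr0 mxE.
Qed.

Lemma gradient_e1 n c : gradient (normal_quartic n) (c *: delta_mx 0 1) = 0.
Proof.
apply: mx_eq_linear => w; rewrite -coef1_line_poly line_poly_e1 trmx0 mulmx0.
by rewrite !coefD !coefCM !coefXn /= !mulr0 !addr0 mxE.
Qed.

Lemma meval_e0 n c : (normal_quartic n).@[(c *: delta_mx 0 0 : 'rV_5) 0] = 0.
Proof.
rewrite -(coef0_line_poly _ _ 0) line_poly_e0.
by rewrite !coefD !coefCM !coefXn /= !mulr0 !addr0.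
Qed.

Lemma meval_e1 n c : (normal_quartic n).@[(c *: delta_mx 0 1 : 'rV_5) 0] = 0.
Proof.
rewrite -(coef0_line_poly _ _ 0) line_poly_e1.
by rewrite !coefD !coefCM !coefXn /= !mulr0 !addr0.
Qed.

Lemma chart_hessian_lin_subst n (M : 'M[K]_5) v i r :
  M \in unitmx -> v *m M *m hessian (normal_quartic n) (v *m M) = 0 ->
  \rank (hessian (normal_quartic n) (v *m M)) = r -> v 0 i != 0 ->
  \rank (chart_hessian (lin_subst M (normal_quartic n)) i v) = r.
Proof.
move=> uM vH rH vi; rewrite rank_chart_hessian ?hessian_lin_subst //; last first.
  by rewrite !mulmxA vH mul0mx.
rewrite mxrankMfree ?row_free_unit ?unitmx_tr //.
by rewrite -mxrank_tr trmx_mul mxrankMfree ?row_free_unit ?unitmx_tr // mxrank_tr.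
Qed.

Lemma gradient_lin_subst_eq0 n (M : 'M[K]_5) v : M \in unitmx ->
  gradient (lin_subst M (normal_quartic n)) v = 0 <-> gradient (normal_quartic n) (v *m M) = 0.
Proof.
move=> uM; rewrite gradient_lin_subst; split=> [e|->]; last by rewrite mul0mx.
by rewrite -[LHS](@mulmxK _ _ _ M^T) ?unitmx_tr // e mul0mx.
Qed.

Lemma singular_atP n (M : 'M[K]_5) v : M \in unitmx ->
  singular_at (lin_subst M (normal_quartic n)) <[v]>%VS <->
  (forall c, (normal_quartic n).@[(c *: v *m M) 0] = 0 /\
     gradient (normal_quartic n) (c *: v *m M) = 0).
Proof.
move=> uM; split=> [[F0 G0] c|FG].
  have vc : c *: v \in <[v]>%VS by rewrite memvZ ?memv_line.
  split; first by rewrite -meval_lin_subst F0.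
  by apply/gradient_lin_subst_eq0 => //; apply/rowP => i; rewrite !mxE G0.
split=> [_ /vlineP[c ->]|i _ /vlineP[c ->]]; first by rewrite meval_lin_subst (FG c).1.
have /(gradient_lin_subst_eq0 _ _ uM)/rowP/(_ i) := (FG c).2.
by rewrite !mxE.
Qed.

(** The matrix M is arbitrary and might send o2 to either singular point of the normal quartic; rank
    4 against rank 3 decides which one it is. *)
Theorem second_type_lines n (M : 'M[K]_5) f o2 :
  M \in unitmx -> good n -> projective_closure f = lin_subst M (normal_quartic n) ->
  second_type f o2 -> has_exactly 24 (lines_through (projective_closure f) o2).
Proof.
move=> uM [sing _ dn0 _ lines] VE [_ []]; rewrite VE => -[po2 _] _ _ [sing2 rank2] _.
have [w wn0 wE] := proj_pointP po2; rewrite wE in sing2 rank2 *.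
have [_ g2] := (singular_atP n w uM).1 sing2 1; rewrite scale1r in g2.
have [c wM] := sing _ g2.
have cn0 : c != 0.
  apply: contraNneq wn0 => c0; rewrite -[w](mulmxK uM).
  by case: wM => ->; rewrite c0 scale0r mul0mx.
case: wM => wM; last exact: lines_through_node uM cn0 wM lines.
have [i wi] : exists i, w 0 i != 0.
  by apply/existsP; apply: contraNT wn0; rewrite negb_exists => /forallP w0;
     apply/eqP/rowP => i; rewrite mxE; apply/eqP; rewrite -[_ == _]negbK.
have := rank2 w i (memv_line _) wi; have [k r] := hessian_e0 n cn0.
by rewrite (@chart_hessian_lin_subst n M w i 3) // wM.
Qed.

End Good.

(** * Quartics of the second type *)

Section AffineForm.
Variable K : numClosedFieldType.
Implicit Types n : params -> K.

(* The linear changes of coordinates x0 -> x0 + l(z), z -> z g of P^4. *)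
Definition chart_change (g : 'M[K]_4) (l : 'rV[K]_4) : 'M[K]_5 :=
  \matrix_(i, j) match unlift ord0 i, unlift ord0 j with
    | Some k, Some m => g k m | Some k, None => l 0 k
    | None, Some _ => 0 | None, None => 1 end.

Lemma chart_change_0 g l (v : 'rV[K]_5) :
  (v *m chart_change g l) 0 0 = v 0 0 + (zpart v *m l^T) 0 0.
Proof.
rewrite !mxE big_ord_recl !mxE unlift_none mulr1; congr (_ + _).
by apply: eq_bigr => k _; rewrite !mxE liftK unlift_none.
Qed.

Lemma zpart_chart_change g l (v : 'rV[K]_5) :
  zpart (v *m chart_change g l) = zpart v *m g.
Proof.
apply/rowP => j; rewrite !mxE big_ord_recl !mxE unlift_none liftK mulr0 add0r.
by apply: eq_bigr => k _; rewrite !mxE !liftK.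
Qed.

Lemma zpart_eq0 (v : 'rV[K]_5) : zpart v = 0 -> v = v 0 0 *: delta_mx 0 0.
Proof.
move=> /rowP z0; apply/rowP => j; rewrite !mxE; have [k ->|->] := unliftP ord0 j.
  by have := z0 k; rewrite !mxE => ->; rewrite /= mulr0.
by rewrite mulr1.
Qed.

Lemma chart_change_unit g l : g \in unitmx -> chart_change g l \in unitmx.
Proof.
move=> ug; rewrite -row_free_unit; apply: inj_row_free => v v0.
have z0 : zpart v = 0.
  rewrite -[zpart v](mulmxK ug) -(zpart_chart_change g l) v0.
  by apply/rowP => j; rewrite mxE big1 => [|k _]; rewrite !mxE ?mul0r.
rewrite (zpart_eq0 z0) (_ : v 0 0 = 0) ?scale0r //.
by have := chart_change_0 g l v; rewrite v0 z0 mul0mx !mxE addr0.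
Qed.

Definition linear_poly (l : 'rV[K]_4) : {mpoly K[4]} := \sum_k l 0 k *: 'X_k.

Lemma meval_linear_poly l (z : 'rV[K]_4) : (linear_poly l).@[z 0] = (z *m l^T) 0 0.
Proof.
rewrite raddf_sum mxE; apply: eq_bigr => k _.
by rewrite /= mevalZ mevalXU mxE mulrC.
Qed.

Lemma linear_poly_homog l : linear_poly l \is 1.-homog.
Proof. by apply: rpred_sum => k _; apply: dhomogZ; apply: var_homog. Qed.

Variables (g : 'M[K]_4) (l : 'rV[K]_4).
Hypotheses (ug : g \in unitmx) (q2g : forall z : 'rV[K]_4, (nq2 K).@[(z *m g) 0] = (q2 K).@[z 0])
  (e4g : (delta_mx 0 ord_max : 'rV[K]_4) *m g = delta_mx 0 ord_max).

(** This and [affine_q4] are the coefficients of x0 and 1 after substituting x0 + l(z) for x0 and z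
    g for z in the normal quartic. *)
Definition affine_q3 n : {mpoly K[4]} :=
  lin_subst g (nq3 n) + 2%:R *: (linear_poly l * q2 K).
Definition affine_q4 n : {mpoly K[4]} :=
  lin_subst g (nq4 n) + linear_poly l * lin_subst g (nq3 n) + linear_poly l ^+ 2 * q2 K.
Definition affine_form n : {mpoly K[4]} := q2 K + affine_q3 n + affine_q4 n.

Lemma affine_q3_homog n : affine_q3 n \is 3.-homog.
Proof.
apply: rpredD; first exact: lin_subst_homog (nq3_homog n).
by apply: dhomogZ; apply: (dhomogM (linear_poly_homog l) (q2_homog K)).
Qed.

Lemma affine_q4_homog n : affine_q4 n \is 4.-homog.
Proof.
apply: rpredD; last exact: (dhomogM (dhomogMn 2 (linear_poly_homog l)) (q2_homog K)).
apply: rpredD; first exact: lin_subst_homog (nq4_homog n).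
exact: (dhomogM (linear_poly_homog l) (lin_subst_homog g (nq3_homog n))).
Qed.

Lemma meval_affine_q3 n (z : 'rV[K]_4) : (affine_q3 n).@[z 0] =
  (nq3 n).@[(z *m g) 0] + 2%:R * ((z *m l^T) 0 0 * (q2 K).@[z 0]).
Proof. by rewrite mevalD meval_lin_subst mevalZ mevalM meval_linear_poly. Qed.

Lemma meval_affine_q4 n (z : 'rV[K]_4) : (affine_q4 n).@[z 0] =
  (nq4 n).@[(z *m g) 0] + (z *m l^T) 0 0 * (nq3 n).@[(z *m g) 0] +
  (z *m l^T) 0 0 ^+ 2 * (q2 K).@[z 0].
Proof.
rewrite 2!mevalD [X in _ + X + _]mevalM [X in _ + X]mevalM meval_exp.
by rewrite !meval_lin_subst !meval_linear_poly.
Qed.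

Lemma projective_closure_affine_form n :
  projective_closure (affine_form n) = lin_subst (chart_change g l) (normal_quartic n).
Proof.
rewrite projective_closure_cone ?q2_homog ?affine_q3_homog ?affine_q4_homog //.
apply: meval_row_inj => v; rewrite meval_lin_subst !meval_cone_form meval_affine_q3 meval_affine_q4.
by rewrite zpart_chart_change chart_change_0 q2g; ring.
Qed.

Lemma polyfam_affine_form : polyfam affine_form.
Proof.
have Pg : polyfam (fun n => lin_subst g (nq3 n)).
  exact: (polyfam_linear (comp_mpoly _) (@polyfam_nq3 K)).
apply: polyfamD; first (apply: polyfamD; first exact: polyfam_const).
  by apply: polyfamD => //; apply: polyfam_const.
apply: polyfamD; last exact: polyfam_const.
apply: polyfamD; first exact: (polyfam_linear (comp_mpoly _) (@polyfam_nq4 K)).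
by apply: polyfamM => //; apply: polyfam_const.
Qed.

Let M := chart_change g l.
Let uM : M \in unitmx. Proof. exact: chart_change_unit. Qed.

Let e0M : (delta_mx 0 0 : 'rV[K]_5) *m M = delta_mx 0 0.
Proof.
apply/rowP => j; rewrite -rowE !mxE unlift_none; by have [k ->|->] := unliftP ord0 j.
Qed.

Theorem good_second_type n : good n -> second_type (affine_form n) <[(delta_mx 0 1 *m invmx M)%R]>%VS.
Proof.
move=> [sing q3n dn0 zeros _]; pose w := delta_mx 0 1 *m invmx M : 'rV[K]_5.
have wM : w *m M = delta_mx 0 1 by rewrite mulmxKV.
have e1n0 : (delta_mx 0 1 : 'rV[K]_5) != 0.
  by apply/eqP => /rowP/(_ 1); rewrite !mxE => /eqP; rewrite oner_eq0.
have e0n0 : (delta_mx 0 0 : 'rV[K]_5) != 0.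
  by apply/eqP => /rowP/(_ 0); rewrite !mxE => /eqP; rewrite oner_eq0.
have wn0 : w != 0 by apply: contraNneq e1n0 => w0; rewrite -wM w0 mul0mx.
have VE := projective_closure_affine_form n.
have sing0 : singular_at (projective_closure (affine_form n)) (o1 K).
  rewrite VE; apply/singular_atP => // c; rewrite -scalemxAl e0M.
  by rewrite meval_e0 gradient_e0.
have sing1 : singular_at (projective_closure (affine_form n)) <[w]>%VS.
  rewrite VE; apply/singular_atP => // c; rewrite -scalemxAl wM.
  by rewrite meval_e1 gradient_e1.
have neq : <[w]>%VS != o1 K.
  apply/eqP => /(vline_eqP wn0)[c e]; have := congr1 (mulmx^~ M) e.
  rewrite wM -scalemxAl e0M => /rowP/(_ 1); rewrite !mxE => /eqP.
  by rewrite /= mulr0 oner_eq0.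
split.
  exists (affine_q3 n), (affine_q4 n); split.
  - by split; [exact: affine_q3_homog|exact: affine_q4_homog].
  - by [].
  - pose Z (z : 'rV[K]_4) := [/\ (q2 K).@[z 0] = 0, (affine_q3 n).@[z 0] = 0 & (affine_q4 n).@[z 0] = 0].
    have ZE z : Z z <-> cone_zero n (z *m g).
      rewrite /Z /cone_zero meval_affine_q3 meval_affine_q4 q2g.
      split=> -[e2]; rewrite e2 !mulr0 !addr0 => e3; rewrite e3 mulr0 addr0 => e4; by split.
    have := has_exactly_points _ (represented_subst ug ZE zeros).
    have Zc c (v : 'rV[K]_4) : Z v -> Z (c *: v).
      move=> [e2 e3 e4]; rewrite /Z (meval_homog _ _ (q2_homog K)).
      rewrite (meval_homog _ _ (affine_q3_homog n)) (meval_homog _ _ (affine_q4_homog n)).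
      by rewrite e2 e3 e4 !mulr0.
    move=> /(_ Zc); apply: has_exactly_ext => p; split=> [[dp pZ]|[dp p2 p3 p4]].
      by split=> // v /pZ[].
    by split=> // v vp; split; [exact: p2|exact: p3|exact: p4].
  rewrite (@meval_eq _ _ _ ((delta_mx 0 ord_max : 'rV[K]_4) 0)); last by move=> i; rewrite mxE.
  rewrite meval_affine_q3 e4g -q2g e4g meval_nq2 /ypart !mxE /= expr0n mul0r addr0 !mulr0 addr0.
  exact: q3n.
have line (p : {vspace 'rV[K]_5}) (v u : 'rV[K]_5) c : v != 0 -> p = <[v]>%VS -> v = c *: u -> u != 0 -> p = <[u]>%VS.
  move=> vn0 -> e un0; apply: proj_point_line un0; first exact: proj_point_vline.
  have cn0 : c != 0 by apply: contraNneq vn0 => c0; rewrite e c0 scale0r.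
  by apply/vlineP; exists c^-1; rewrite e scalerA mulVf ?scale1r.
split.
- by split; [exact: proj_point_vline|].
- move=> p dp; split; last by case=> ->.
  have [v vn0 pE] := proj_pointP dp; rewrite VE pE => /(singular_atP _ _ uM)/(_ 1)[_].
  rewrite scale1r => /sing[c [] vM]; [left|right]; rewrite -pE.
    apply: (line p v _ c vn0 pE _ e0n0).
    by rewrite -[v](mulmxK uM) vM -scalemxAl -{1}e0M mulmxK.
  apply: (line p v _ c vn0 pE _ wn0).
  by rewrite -[v](mulmxK uM) vM -scalemxAl.
- split=> // v i /vlineP[c vE] vi; rewrite VE.
  have cn0 : c != 0 by apply: contraNneq vi => c0; rewrite vE c0 scale0r mxE.
  have [h r] := hessian_e0 n cn0.
  have vM : v *m M = c *: delta_mx 0 0 by rewrite vE -scalemxAl e0M.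
  by apply: chart_hessian_lin_subst; rewrite ?vM.
- split=> // v i /vlineP[c vE] vi; rewrite VE.
  have cn0 : c != 0 by apply: contraNneq vi => c0; rewrite vE c0 scale0r mxE.
  have [h r] := hessian_e1 cn0 dn0.
  have vM : v *m M = c *: delta_mx 0 1 by rewrite vE -scalemxAl wM.
  by apply: chart_hessian_lin_subst; rewrite ?vM.
move=> on; have := on (delta_mx 0 0 + w); rewrite VE meval_lin_subst mulmxDl e0M wM.
rewrite normal_quartic_y0 => [|i]; last first.
  by rewrite !mxE /= addr0.
rewrite !mxE /= addr0 add0r !expr1n mulr1 => e.
by have /eqP := e (memv_add (memv_line _) (memv_line _)); rewrite oner_eq0.
Qed.

End AffineForm.

(** * Reduction of a quartic of the second type to the normal form *)

Section Reduction.
Variable K : numClosedFieldType.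
Implicit Types n : params -> K.

Lemma two_neq0 : 2%:R != 0 :> K. Proof. by rewrite pnatr_eq0. Qed.

Lemma split_square d (p : {mpoly K[4]}) : p \is d.+2.-homog -> exists s r,
  [/\ s \is d.-homog, r \is d.+2.-homog, deg0 1 r & p = 'X_ord0 ^+ 2 * s + r].
Proof.
move=> hp; pose hi (m : 'X_{1..4}) := (1 < m ord0)%N.
have m2 (m : 'X_{1..4}) : hi m -> m = (U_(ord0) *+ 2 + (m - U_(ord0) *+ 2))%MM.
  move=> him; apply/mnmP => i; rewrite mnmDE mnmBE mulmnE mnm1E.
  by have [<-|_] := eqVneq ord0 i; rewrite ?mul0n ?subn0 // mul1n subnKC.
exists (\sum_(m <- msupp p | hi m) p@_m *: 'X_[(m - U_(ord0) *+ 2)%MM]).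
exists (\sum_(m <- msupp p | ~~ hi m) p@_m *: 'X_[m]); split.
- rewrite big_seq_cond; apply: rpred_sum => m /andP[mp him]; apply: dhomogZ; rewrite dhomogX.
  have : mdeg m = d.+2 by exact: (dhomog_mf hp).
  by rewrite {1}(m2 m him) mdegD mdegMn mdeg1 mul1n add2n => -[e]; apply/eqP.
- rewrite big_seq_cond; apply: rpred_sum => m /andP[mp him]; apply: dhomogZ; rewrite dhomogX.
  by apply/eqP; exact: (dhomog_mf hp).
- elim/big_ind: _ => [m|p1 p2|m him k]; [by rewrite mcoeff0 eqxx|exact: deg0D|].
  rewrite mcoeffZ mcoeffX mulf_eq0 negb_or => /andP[_].
  by case: (m =P k) => [<- _|_]; rewrite ?eqxx // leqNgt.
rewrite {1}[p]mpolyE (bigID hi) /=; congr (_ + _); rewrite mulr_sumr.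
apply: eq_bigr => m him; rewrite -scalerAr mpolyXn -mpolyXD -m2 //.
Qed.

Lemma linear_form (s : {mpoly K[4]}) : s \is 1.-homog ->
  exists a : 'rV[K]_4, forall z : 'rV[K]_4, s.@[z 0] = (z *m a^T) 0 0.
Proof.
move=> hs; exists (gradient s 0) => z; rewrite -coef1_line_poly.
have -> : line_poly s 0 z = s.@[z 0] *: 'X; last by rewrite coefZ coefX mulr1.
by apply: poly_horner_inj => t; rewrite horner_line_poly add0r (meval_homog _ _ hs) !hornerE mulrC.
Qed.

Lemma quadratic_form (s : {mpoly K[4]}) : s \is 2.-homog ->
  exists2 B : 'M[K]_4, B^T = B & forall z : 'rV[K]_4, s.@[z 0] = (z *m B *m z^T) 0 0.
Proof.
move=> hs; exists (2%:R^-1 *: hessian s 0); first by rewrite linearZ /= hessian_sym.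
move=> z; rewrite -scalemxAr -scalemxAl mxE -coef2_line_poly.
have -> : line_poly s 0 z = s.@[z 0] *: 'X^2.
  by apply: poly_horner_inj => t; rewrite horner_line_poly add0r (meval_homog _ _ hs) hornerZ hornerXn mulrC.
by rewrite coefZ coefXn mulr1 -[X in _ * X]mulr_natl mulKf ?two_neq0.
Qed.

Definition lin3 (a y : 'I_3 -> K) : K := \sum_(i < 3) a i * y i.

Lemma lin3E a y : lin3 a y = a 0 * y 0 + a 1 * y 1 + a 2 * y 2.
Proof.
rewrite /lin3 !big_ord_recl big_ord0 addr0 addrA.
by congr (_ + a _ * y _ + a _ * y _); apply: val_inj.
Qed.

Definition vec3 (a b c : K) (i : 'I_3) : K := tnth [tuple a; b; c] i.

Lemma lin3_vec a b c y : lin3 (vec3 a b c) y = a * y 0 + b * y 1 + c * y 2.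
Proof. by rewrite lin3E. Qed.

Lemma binary_quadratic_factor (a b c : K) : exists d e f g, forall x y,
  a * x ^+ 2 + b * (x * y) + c * y ^+ 2 = (d * x + e * y) * (f * x + g * y).
Proof.
have [->|an0] := eqVneq a 0.
  by exists 0, 1, b, c => x y; ring.
pose r := sqrtC (b ^+ 2 - 4%:R * a * c).
have rE : r ^+ 2 = b ^+ 2 - 4%:R * a * c by exact: sqrtCK.
have n2 := two_neq0.
exists a, ((b + r) / 2%:R), 1, ((b - r) / (2%:R * a)) => x y.
have -> : c = (b ^+ 2 - r ^+ 2) / (4%:R * a) by rewrite rE; field; rewrite an0 ?n2.
by field; rewrite an0.
Qed.

(** Completing the square in y_1 leaves a binary form, which splits into linear factors. Without a
    term y_1^2, a mixed term with y_1 is absorbed into a product, and a single square remains. *)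
Lemma ternary_quadratic (a b c d e f : K) : exists l1 l2 l3 : 'I_3 -> K, forall y : 'I_3 -> K,
  a * y 0 ^+ 2 + b * y 1 ^+ 2 + c * y 2 ^+ 2 +
  d * (y 0 * y 1) + e * (y 0 * y 2) + f * (y 1 * y 2) = lin3 l1 y ^+ 2 + lin3 l2 y * lin3 l3 y.
Proof.
have n2 := two_neq0.
have [->|an0] := eqVneq a 0; last first.
  have [k kE] : exists k, k ^+ 2 = a by exists (sqrtC a); exact: sqrtCK.
  have kn0 : k != 0 by move: an0; rewrite -kE sqrf_eq0.
  have [p [q [r [s fac]]]] := binary_quadratic_factor
    (b - d ^+ 2 / (4%:R * a)) (f - d * e / (2%:R * a)) (c - e ^+ 2 / (4%:R * a)).
  exists (vec3 k (d / (2%:R * k)) (e / (2%:R * k))).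
  exists (vec3 0 p q), (vec3 0 r s) => y; rewrite !lin3_vec !mul0r !add0r -fac.
  by rewrite -kE; field.
have [->|dn0] := eqVneq d 0; last first.
  pose k := c - e * f / d + b * e ^+ 2 / d ^+ 2.
  have kE : sqrtC k ^+ 2 = k by exact: sqrtCK.
  exists (vec3 0 0 (sqrtC k)), (vec3 0 d e), (vec3 1 (b / d) (f / d - b * e / d ^+ 2)) => y.
  by rewrite !lin3_vec !mul0r !add0r exprMn kE /k; field.
have [->|en0] := eqVneq e 0.
  have [p [q [r [s fac]]]] := binary_quadratic_factor b f c.
  exists (vec3 0 0 0), (vec3 0 p q), (vec3 0 r s) => y.
  by rewrite !lin3_vec !mul0r !add0r -fac; ring.
exists (vec3 0 (sqrtC b) 0), (vec3 0 0 e), (vec3 1 (f / e) (c / e)) => y.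
by rewrite !lin3_vec !mul0r !add0r !addr0 exprMn sqrtCK; field.
Qed.

Lemma split_quadratic (l : 'I_3 -> K) (B : 'I_3 -> 'I_3 -> K) : exists L : 'I_4 -> 'I_3 -> K,
  forall y, lin3 (L 0) y + lin3 (L 1) y = lin3 l y /\
    lin3 (L 0) y * lin3 (L 1) y + lin3 (L (inord 2)) y * lin3 (L (inord 3)) y =
    \sum_i \sum_j B i j * (y i * y j).
Proof.
have n2 := two_neq0.
pose h i j := B i j - l i * l j / 4%:R.
have [l1 [l2 [l3 lE]]] := ternary_quadratic (- h 0 0) (- h 1 1) (- h 2 2)
  (- h 0 1 - h 1 0) (- h 0 2 - h 2 0) (- h 1 2 - h 2 1).
pose L (k : 'I_4) i := tnth [tuple l i / 2%:R - l1 i; l i / 2%:R + l1 i; - l2 i; l3 i] k.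
have L2 : L (inord 2) = fun i => - l2 i by apply/funext => i; rewrite /L (tnth_nth 0) inordK.
have L3 : L (inord 3) = l3 by apply/funext => i; rewrite /L (tnth_nth 0) inordK.
have L0 : L 0 = fun i => l i / 2%:R - l1 i by [].
have L1 : L 1 = fun i => l i / 2%:R + l1 i by [].
exists L => y; rewrite L2 L3 L0 L1; split; first by rewrite !lin3E; field.
have sumE (F : 'I_3 -> K) : \sum_i F i = F 0 + F 1 + F 2.
  rewrite !big_ord_recl big_ord0 addr0 addrA.
  by congr (_ + F _ + F _); apply: val_inj.
rewrite sumE !sumE.
have := lE y; rewrite !lin3E /h => {}lE.
apply/eqP; rewrite -subr_eq0; apply/eqP; move/eqP: lE; rewrite -subr_eq0 => /eqP lE.
by rewrite -[RHS]lE /=; field.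
Qed.

Lemma low_val_0 n d e (y : 'I_3 -> K) : (e < d)%N -> (forall i, y i = 0) -> low_val n d e y = 0.
Proof.
move=> lt_ed y0; rewrite (_ : y = fun i => 0 * y i); last by apply/funext => i; rewrite mul0r.
by rewrite low_valZ 1?ltnW // expr0n subn_eq0 leqNgt lt_ed mul0r.
Qed.

(** The conditions at the first basis vector remove z1^3 from [p3] and z1^4, z1^3 y_j from [p4], the
    monomials missing in the normal form. The coefficients of z1^2 are then a linear and a quadratic
    form in y. *)
Lemma node_form (p3 p4 : {mpoly K[4]}) : p3 \is 3.-homog -> p4 \is 4.-homog ->
  p3.@[(delta_mx 0 0 : 'rV[K]_4) 0] = 0 ->
  (forall u, (line_poly p4 (delta_mx 0 0) u)`_0 = 0 /\ (line_poly p4 (delta_mx 0 0) u)`_1 = 0) ->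
  exists n, nq3 n = p3 /\ nq4 n = p4.
Proof.
move=> h3 h4 p30 p40.
have [s3 [r3 [hs3 hr3 d3 p3E]]] := split_square h3.
have [s4 [r4 [hs4 hr4 d4 p4E]]] := split_square h4.
have [a aE] := linear_form hs3; have [B symB BE] := quadratic_form hs4.
have low L := low_form_sum L hr3 hr4 d3 d4.
pose n0 := params_of (fun _ _ => 0) (r3 + r4).
have rE (z : 'rV[K]_4) : r3.@[z 0] = z 0 0 * low_val n0 3 1 (ypart z) + low_val n0 3 0 (ypart z) /\
    r4.@[z 0] = z 0 0 * low_val n0 4 1 (ypart z) + low_val n0 4 0 (ypart z).
  by have [e3 e4] := low (fun _ _ => 0); rewrite -!meval_low_form e3 e4.
have p3z (z : 'rV[K]_4) : p3.@[z 0] = z 0 0 ^+ 2 * (z *m a^T) 0 0 + r3.@[z 0].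
  by rewrite p3E mevalD mevalM meval_exp mevalXU aE.
have p4z (z : 'rV[K]_4) : p4.@[z 0] = z 0 0 ^+ 2 * (z *m B *m z^T) 0 0 + r4.@[z 0].
  by rewrite p4E mevalD mevalM meval_exp mevalXU BE.
have a0 : a 0 0 = 0.
  have y0 i : ypart (delta_mx 0 0 : 'rV[K]_4) i = 0 by rewrite /ypart mxE.
  rewrite -[RHS]p30 p3z (rE _).1 !low_val_0 // mulr0 !addr0 -rowE [a^T]lock !mxE -lock.
  by rewrite expr1n mul1r !mxE.
have B0 (u : 'rV[K]_4) : (u *m B) 0 0 = 0.
  pose e0 : 'rV[K]_4 := delta_mx 0 0.
  pose k i := low_val n0 4 i (ypart u).
  have lineE : line_poly p4 e0 u = (B 0 0)%:P + (2%:R * ((u *m B) 0 0 + u 0 0 * B 0 0))%:P * 'X +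
     'X^2 * ((u 0 0 ^+ 2 * B 0 0 + 4%:R * u 0 0 * (u *m B) 0 0)%:P +
       (2%:R * u 0 0 ^+ 2 * (u *m B) 0 0)%:P * 'X + (1 + (u 0 0)%:P * 'X) ^+ 2 * ((u *m B *m u^T) 0 0)%:P +
       (1 + (u 0 0)%:P * 'X) * (k 1%N)%:P * 'X + (k 0%N)%:P * 'X^2).
    apply: poly_horner_inj => t; rewrite horner_line_poly p4z (rE _).2.
    have z0 : (e0 + t *: u) 0 0 = 1 + t * u 0 0 by rewrite !mxE.
    have yE : ypart (e0 + t *: u) = fun i => t * ypart u i.
      by apply/funext => i; rewrite /ypart !mxE /= add0r.
    rewrite z0 yE !low_valZ // -/(k 1%N) -/(k 0%N) !hornerE /=.
    pose f (x y : 'rV[K]_4) : K := (x *m B *m y^T) 0 0.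
    have fDl c x y z : f (x + c *: y) z = f x z + c * f y z.
      by rewrite /f !mulmxDl -!scalemxAl [LHS]mxE [X in _ + X]mxE.
    have fC x y : f x y = f y x.
      by rewrite /f -[x *m B *m _]trmxK [LHS]mxE !trmx_mul !trmxK symB mulmxA.
    have f0 y : f y e0 = (y *m B) 0 0 by rewrite /f trmx_delta -colE mxE.
    have -> : ((e0 + t *: u) *m B *m (e0 + t *: u)^T) 0 0 =
        B 0 0 + 2%:R * t * (u *m B) 0 0 + t ^+ 2 * (u *m B *m u^T) 0 0.
      rewrite -/(f (e0 + t *: u) (e0 + t *: u)) -/(f u u) fDl (fC e0) (fC u (_ + _)) !fDl (fC e0 u) !f0.
      by rewrite -rowE mxE; ring.
    by ring.
  have [c0 c1] := p40 u; rewrite lineE in c0 c1.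
  rewrite !coefD coefCM coefX coefXnM coefC /= mulr0 !addr0 in c0.
  rewrite !coefD coefCM coefX coefXnM coefC /= c0 mulr1 add0r addr0 !mulr0 addr0 in c1.
  by apply: (mulfI two_neq0); rewrite c1 mulr0.
have yE (z : 'rV[K]_4) i : z 0 (lift ord0 i) = ypart z i by [].
have [L LE] := split_quadratic (fun i => a 0 (lift ord0 i)) (fun i j => B (lift ord0 i) (lift ord0 j)).
exists (params_of L (r3 + r4)); have [l3 l4] := low L.
have lE k y : lval (params_of L (r3 + r4)) k y = lin3 (L k) y by [].
split; apply: meval_row_inj => z; have [e1 e2] := LE (ypart z).
  rewrite /nq3 mevalD mevalM meval_exp mevalXU mevalD !meval_lform !lE e1 l3 p3z; congr (_ * _ + _).
  rewrite mxE big_ord_recl mxE a0 mulr0 add0r.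
  by apply: eq_bigr => i _; rewrite !mxE mulrC.
rewrite /nq4 mevalD mevalM meval_exp mevalXU mevalD !mevalM !meval_lform !lE e2 l4 p4z; congr (_ * _ + _).
have B0' j : B 0 j = 0 by rewrite -symB mxE -(B0 (delta_mx 0 j)) -rowE mxE.
rewrite [RHS]mxE [RHS]big_ord_recl B0 mul0r add0r exchange_big /=; apply: eq_bigr => i _.
rewrite [(z *m B) 0 _]mxE [X in _ = X * _]big_ord_recl B0' mulr0 add0r mulr_suml; apply: eq_bigr => j _.
by rewrite !mxE -/(ypart z i) -/(ypart z j); ring.
Qed.

End Reduction.

Section Frame.
Variable K : numClosedFieldType.

Lemma meval_q2 (z : 'rV[K]_4) :
  (q2 K).@[z 0] = z 0 0 ^+ 2 + ypart z 0 ^+ 2 + ypart z 1 ^+ 2.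
Proof.
rewrite /q2 raddf_sum /= big_mkcond !big_ord_recl big_ord0 /= !addr0 addrA.
rewrite !meval_exp !mevalXU /ypart.
by congr (_ ^+ 2 + z 0 _ ^+ 2 + z 0 _ ^+ 2); apply: val_inj.
Qed.

Lemma ord3P (i : 'I_3) : i = 0 \/ i = 1 \/ i = 2.
Proof.
by case: i => [[|[|[|//]]]] lti; [left|right; left|right; right]; apply: val_inj.
Qed.

(** A vector killed by g lies in the radical of [q2], hence on the vertex line, which g fixes. *)
Lemma isometry_unit (g : 'M[K]_4) :
  (forall z : 'rV[K]_4, (nq2 K).@[(z *m g) 0] = (q2 K).@[z 0]) ->
  (delta_mx 0 ord_max : 'rV[K]_4) *m g = delta_mx 0 ord_max -> g \in unitmx.
Proof.
move=> q2g e4g; rewrite -row_free_unit; apply: inj_row_free => z z0.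
have q0 : (q2 K).@[z 0] = 0.
  by rewrite -q2g z0 meval_nq2 /ypart !mxE expr0n mul0r addr0.
have orth (w : 'rV[K]_4) : w 0 0 * z 0 0 + ypart w 0 * ypart z 0 + ypart w 1 * ypart z 1 = 0.
  have : (q2 K).@[(w + z) 0] = (q2 K).@[w 0] by rewrite -!q2g mulmxDl z0 addr0.
  move=> e; apply: (mulfI (two_neq0 K)); rewrite mulr0.
  transitivity ((q2 K).@[(w + z) 0] - (q2 K).@[w 0] - (q2 K).@[z 0]).
    by rewrite !meval_q2 /ypart !mxE; ring.
  by rewrite e q0 subrr subr0.
have z00 : z 0 0 = 0 by have := orth (delta_mx 0 0); rewrite /ypart !mxE /= mul1r !mul0r !addr0.
have z01 : ypart z 0 = 0.
  by have := orth (delta_mx 0 (lift ord0 0)); rewrite /ypart !mxE /= mul1r !mul0r addr0 add0r.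
have z02 : ypart z 1 = 0.
  by have := orth (delta_mx 0 (lift ord0 1)); rewrite /ypart !mxE /= mul1r !mul0r !add0r.
have zE : z = z 0 ord_max *: delta_mx 0 ord_max.
  apply: row4P => [|i]; first by rewrite mxE z00 mxE mulr0.
  have [->|[->|->]] := ord3P i; rewrite mxE [delta_mx _ _ _ _]mxE ?mulr0 //=.
  by rewrite mulr1; congr (z 0 _); apply: val_inj.
by move: z0; rewrite {1}zE -scalemxAl e4g -zE.
Qed.

Lemma exists_frame (a : 'rV[K]_4) : (q2 K).@[a 0] = 1 -> exists g : 'M[K]_4,
  [/\ forall z : 'rV[K]_4, (nq2 K).@[(z *m g) 0] = (q2 K).@[z 0],
      (delta_mx 0 ord_max : 'rV[K]_4) *m g = delta_mx 0 ord_max &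
      a *m g = delta_mx 0 0].
Proof.
rewrite meval_q2 => a1.
(* The sign keeps the denominator of the reflection nonzero: 1 - a_0 and 1 + a_0 cannot both
   vanish. *)
have [e [e2 en]] : exists e, e ^+ 2 = 1 /\ 1 - e * a 0 0 != 0.
  have [eq1|ne1] := eqVneq (1 - a 0 0) 0; last first.
    by exists 1; rewrite expr1n mul1r.
  exists (-1); rewrite sqrrN expr1n; split=> //.
  have -> : 1 - (-1) * a 0 0 = 2%:R - (1 - a 0 0) by ring.
  by rewrite eq1 subr0 two_neq0.
(* In the first three variables, up to the sign e of the first coordinate, this is
   the reflection exchanging a and e times the first basis vector. *)
pose al (z : 'rV[K]_4) := a 0 0 * z 0 0 + ypart a 0 * ypart z 0 + ypart a 1 * ypart z 1.
pose h z := (al z - e * z 0 0) / (1 - e * a 0 0).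
pose be z := ypart z 0 - ypart a 0 * h z.
pose ga z := ypart z 1 - ypart a 1 * h z.
(* The middle entries factor [be z] squared plus [ga z] squared, and the last entry is sheared so
   that a goes to the first basis vector exactly. *)
pose G z : 'rV[K]_4 := \row_j tnth [tuple al z; be z + 'i * ga z; be z - 'i * ga z; ypart z 2 - ypart a 2 * al z] j.
pose g : 'M[K]_4 := \matrix_(i, j) G (delta_mx 0 i) 0 j.
have sum4 (F : 'I_4 -> K) : \sum_i F i = F 0 + F (lift ord0 0) + F (lift ord0 1) + F (lift ord0 2).
  rewrite !big_ord_recl big_ord0 addr0 !addrA.
  by congr (_ + F _ + F _ + F _); apply: val_inj.
have gE z : z *m g = G z.
  apply/rowP => j; rewrite mxE sum4 !mxE.
  by case: j => [[|[|[|[|//]]]]] ltj; rewrite !(tnth_nth 0) /= /be /ga /h /al /ypart !mxE /=; field; rewrite ?en.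
have G0 z : G z 0 0 = al z by rewrite mxE.
have G1 z : ypart (G z) 0 = be z + 'i * ga z by rewrite /ypart mxE.
have G2 z : ypart (G z) 1 = be z - 'i * ga z by rewrite /ypart mxE.
have G3 z : ypart (G z) 2 = ypart z 2 - ypart a 2 * al z by rewrite /ypart mxE.
have i2 : 'i ^+ 2 = -1 :> K by exact: sqrCi.
have ala : al a = 1 by rewrite -a1 /al; ring.
have qG z : al z ^+ 2 + be z ^+ 2 + ga z ^+ 2 = z 0 0 ^+ 2 + ypart z 0 ^+ 2 + ypart z 1 ^+ 2.
  have k : h z * (1 - e * a 0 0) = al z - e * z 0 0 by rewrite divfK.
  have a1' : ypart a 1 ^+ 2 = 1 - a 0 0 ^+ 2 - ypart a 0 ^+ 2 by rewrite -a1; ring.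
  have alz : ypart a 1 * ypart z 1 = al z - a 0 0 * z 0 0 - ypart a 0 * ypart z 0 by rewrite /al; ring.
  have alE : al z = h z * (1 - e * a 0 0) + e * z 0 0 by rewrite k; ring.
  have -> : al z ^+ 2 + be z ^+ 2 + ga z ^+ 2 = al z ^+ 2 + ypart z 0 ^+ 2 + ypart z 1 ^+ 2 -
      2%:R * h z * (ypart a 0 * ypart z 0 + ypart a 1 * ypart z 1) +
      (ypart a 0 ^+ 2 + ypart a 1 ^+ 2) * h z ^+ 2 by rewrite /be /ga; ring.
  rewrite alz a1' alE; apply/eqP; rewrite -subr_eq0.
  rewrite (_ : _ - _ = (e ^+ 2 - 1) * (z 0 0 - h z * a 0 0) ^+ 2); last by ring.
  by rewrite e2 subrr mul0r.
have ha : be a = 0 /\ ga a = 0.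
  have h1 : h a = 1 by rewrite /h ala divff.
  by rewrite /be /ga h1 !mulr1 !subrr; split.
exists g; split=> [z||].
- rewrite gE meval_nq2 meval_q2 G0 G1 G2 -qG.
  rewrite [X in _ + X](_ : _ = be z ^+ 2 - 'i ^+ 2 * ga z ^+ 2); last by ring.
  by rewrite i2; ring.
- rewrite gE; apply: row4P => [|i]; rewrite ?G0.
    by rewrite /al /ypart !mxE /=; ring.
  have al0 : al (delta_mx 0 ord_max) = 0 by rewrite /al /ypart !mxE /=; ring.
  have h0 : h (delta_mx 0 ord_max) = 0 by rewrite /h al0 mxE /= mulr0 subr0 mul0r.
  rewrite -/(ypart _ i) -/(ypart (delta_mx 0 ord_max) i).
  have [->|[->|->]] := ord3P i; rewrite ?G1 ?G2 ?G3 /be /ga ?h0 ?al0 /ypart !mxE /=; ring.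
rewrite gE; apply: row4P => [|i]; first by rewrite G0 ala mxE.
rewrite -/(ypart _ i) -/(ypart (delta_mx 0 0) i).
have [->|[->|->]] := ord3P i; rewrite ?G1 ?G2 ?G3 ?ha.1 ?ha.2 ?ala [RHS]mxE /=; ring.
Qed.
End Frame.

Section SecondTypeNormal.
Variable K : numClosedFieldType.

(** On the line o1 o2 the equation is quadratic in x0 with a double root at o2. Its leading
    coefficient, the value of [q2], is nonzero because the line is not on V, and can be scaled to 1;
    the other two are those of (x0 - v_0)^2. *)
Lemma second_type_node (q3 q4 : {mpoly K[4]}) o2 : q3 \is 3.-homog -> q4 \is 4.-homog ->
  second_type (q2 K + q3 + q4) o2 -> exists v : 'rV[K]_5,
  [/\ (q2 K).@[zpart v 0] = 1, q3.@[zpart v 0] = - (2%:R * v 0 0), q4.@[zpart v 0] = v 0 0 ^+ 2 &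
      gradient (cone_form (q2 K) q3 q4) v = 0].
Proof.
move=> h3 h4 [_ [[po2 _] _ _ [[lies2 grad2] _] nline]].
rewrite projective_closure_cone ?q2_homog // in lies2 grad2 nline.
set V := cone_form _ _ _ in lies2 grad2 nline *.
have [w wn0 o2E] := proj_pointP po2.
have sing c : V.@[(c *: w) 0] = 0 /\ gradient V (c *: w) = 0.
  have cw : c *: w \in o2 by rewrite o2E memvZ ?memv_line.
  by split; [exact: lies2|apply/rowP => i; rewrite !mxE grad2].
have lineE (v : 'rV[K]_5) s : V.@[(v + s *: delta_mx 0 0) 0] =
    (v 0 0 + s) ^+ 2 * (q2 K).@[zpart v 0] + (v 0 0 + s) * q3.@[zpart v 0] + q4.@[zpart v 0].
  by rewrite meval_cone_form zpartD zpartZ zpart_e0 scaler0 addr0 !mxE /= mulr1.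
have values c (v := c *: w) : 2%:R * v 0 0 * (q2 K).@[zpart v 0] + q3.@[zpart v 0] = 0 /\
    v 0 0 ^+ 2 * (q2 K).@[zpart v 0] + v 0 0 * q3.@[zpart v 0] + q4.@[zpart v 0] = 0.
  have [V0 G0] := sing c; split; last by rewrite -[RHS]V0 meval_cone_form.
  have := coef1_line_poly V v (delta_mx 0 0).
  have -> : line_poly V v (delta_mx 0 0) =
      (v 0 0 ^+ 2 * (q2 K).@[zpart v 0] + v 0 0 * q3.@[zpart v 0] + q4.@[zpart v 0])%:P +
      (2%:R * v 0 0 * (q2 K).@[zpart v 0] + q3.@[zpart v 0])%:P * 'X + ((q2 K).@[zpart v 0])%:P * 'X^2.
    apply: poly_horner_inj => t; rewrite horner_line_poly lineE !hornerE /=; ring.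
  by rewrite G0 trmx0 mulmx0 [X in _ = X -> _]mxE !coefD !coefCM coefX coefXn coefC /= mulr0 addr0 mulr1 add0r.
have N0 : (q2 K).@[zpart w 0] != 0.
  apply/eqP => N0; apply: nline => _ /memv_addP[_ /vlineP[s ->] [u uo2 ->]].
  move: uo2; rewrite o2E => /vlineP[c ->]; rewrite addrC lineE.
  have [e1 e2] := values c.
  have Nc : (q2 K).@[zpart (c *: w) 0] = 0 by rewrite zpartZ (meval_homog _ _ (q2_homog K)) N0 mulr0.
  rewrite Nc mulr0 add0r in e1; rewrite Nc e1 !mulr0 !add0r in e2.
  by rewrite Nc e1 e2 !mulr0 !addr0.
pose c := (sqrtC (q2 K).@[zpart w 0])^-1.
have q2v : (q2 K).@[zpart (c *: w) 0] = 1.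
  by rewrite zpartZ (meval_homog _ _ (q2_homog K)) exprVn sqrtCK mulVf.
have [e1 e2] := values c; rewrite q2v !mulr1 in e1 e2.
have e3 : q3.@[zpart (c *: w) 0] = - (2%:R * (c *: w) 0 0) by apply/eqP; rewrite -addr_eq0 addrC e1.
exists (c *: w); split=> //; last exact: (sing c).2.
by apply/eqP; rewrite -subr_eq0; apply/eqP; rewrite -[RHS]e2 e3; ring.
Qed.

Theorem second_type_affine_form f o2 : second_type f o2 -> exists g l n,
  [/\ g \in unitmx, forall z : 'rV[K]_4, (nq2 K).@[(z *m g) 0] = (q2 K).@[z 0],
      (delta_mx 0 ord_max : 'rV[K]_4) *m g = delta_mx 0 ord_max & f = affine_form g l n].
Proof.
move=> st; have [[q3 [q4 [[h3 h4] fE _ _]]] _] := st; rewrite fE in st.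
have [v [q2v q3v q4v gradv]] := second_type_node h3 h4 st.
pose a := zpart v; have [g [q2g e4g ag]] := exists_frame q2v.
have ug := isometry_unit q2g e4g.
(* A multiple of the polar form of a, so that l(a) = -v_0 by [q2v]: the substitution of x0 + l for
   x0 moves o2 to x0 = 0. *)
pose l : 'rV[K]_4 := \row_i (if (i < 3)%N then - v 0 0 * a 0 i else 0).
have la : (a *m l^T) 0 0 = - v 0 0.
  rewrite -[RHS]mulr1 -[X in _ * X]q2v -/a meval_q2 mxE !big_ord_recl big_ord0 /ypart !mxE /=.
  have -> : lift ord0 1 = lift ord0 (lift ord0 ord0) :> 'I_4 by apply: val_inj.
  by ring.
pose p3 := q3 - 2%:R *: (linear_poly l * q2 K).
pose p4 := q4 - linear_poly l * q3 + linear_poly l ^+ 2 * q2 K.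
have hl := linear_poly_homog l.
have hp3 : p3 \is 3.-homog.
  by apply: rpredB => //; apply: dhomogZ; apply: (dhomogM hl (q2_homog K)).
have hp4 : p4 \is 4.-homog.
  apply: rpredD; last exact: (dhomogM (dhomogMn 2 hl) (q2_homog K)).
  by apply: rpredB => //; apply: (dhomogM hl h3).
have p3E (z : 'rV[K]_4) : p3.@[z 0] = q3.@[z 0] - 2%:R * ((z *m l^T) 0 0 * (q2 K).@[z 0]).
  by rewrite mevalB mevalZ mevalM meval_linear_poly.
have p4E (z : 'rV[K]_4) : p4.@[z 0] = q4.@[z 0] - (z *m l^T) 0 0 * q3.@[z 0] +
    (z *m l^T) 0 0 ^+ 2 * (q2 K).@[z 0].
  rewrite mevalD mevalB [X in _ - X + _]mevalM [X in _ + X]mevalM meval_exp.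
  by rewrite !meval_linear_poly.
have [n [n3 n4]] : exists n, nq3 n = lin_subst (invmx g) p3 /\ nq4 n = lin_subst (invmx g) p4.
  have ae0 : delta_mx 0 0 *m invmx g = a by rewrite -ag mulmxK.
  apply: node_form; [exact: lin_subst_homog|exact: lin_subst_homog| |].
    by rewrite meval_lin_subst ae0 p3E la q2v q3v; ring.
  move=> u; rewrite line_poly_lin_subst ae0.
  (* [p4] is the equation of V on the hyperplane x0 = -l(z), which contains v; w is the direction in
     this hyperplane above z, so singularity of V at v passes to [p4] at a. *)
  pose z := u *m invmx g; pose w : 'rV[K]_5 := \row_i (if unlift ord0 i is Some k then z 0 k else - (z *m l^T) 0 0).
  have -> : line_poly p4 a z = line_poly (cone_form (q2 K) q3 q4) v w.
    apply: poly_horner_inj => t; rewrite !horner_line_poly meval_cone_form p4E.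
    have zw : zpart w = z by apply/rowP => j; rewrite mxE [LHS]mxE liftK.
    have vw : (v + t *: w) 0 0 = - ((a + t *: z) *m l^T) 0 0.
      rewrite mulmxDl -scalemxAl [LHS]mxE [X in - X]mxE la.
      by rewrite [X in _ + X]mxE [w 0 0]mxE unlift_none [X in _ = - (_ + X)]mxE; ring.
    by rewrite zpartD zpartZ zw vw; ring.
  rewrite coef0_line_poly coef1_line_poly gradv trmx0 mulmx0 [X in _ /\ X = _]mxE; split=> //.
  by rewrite meval_cone_form q2v q3v q4v; ring.
exists g, l, n; split=> //; rewrite fE /affine_form; congr (_ + _ + _).
  rewrite /affine_q3 n3 lin_substM mulmxV // lin_subst1 /p3; ring.
rewrite /affine_q4 n3 n4 !lin_substM mulmxV // !lin_subst1 /p4 /p3 -mul_mpolyC; ring.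
Qed.
End SecondTypeNormal.

(** * Generality *)

Section Generality.
Variable K : numClosedFieldType.

Definition poly_of_coefs (c : 'X_{1..4 < 5} -> K) : {mpoly K[4]} := \sum_m c m *: 'X_[m].

Lemma mcoeff_poly_of_coefs c (m : 'X_{1..4 < 5}) : (poly_of_coefs c)@_m = c m.
Proof.
rewrite raddf_sum (bigD1 m) //= mcoeffZ mcoeffX eqxx mulr1 big1 ?addr0 // => l nl.
by rewrite mcoeffZ mcoeffX val_eqE (negPf nl) mulr0.
Qed.

(** The closure only sees coefficients of degree at most 4, which are the coordinates used by
    [zariski_open]. *)
Lemma projective_closure_coefs f :
  projective_closure (poly_of_coefs (fun m => f@_m)) = projective_closure f.
Proof.
apply: eq_bigr => d _; congr (_ * (_ \mPo _)); apply/mpolyP => m.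
rewrite !mcoeff_pihomog; case: eqP => // md.
have lt5 : (mdeg m < 5)%N by rewrite md.
exact: (mcoeff_poly_of_coefs _ (BMultinom lt5)).
Qed.

Lemma polyfam_projective_closure :
  polyfam (fun c => projective_closure (poly_of_coefs c)).
Proof.
apply: polyfam_sum => d _; apply: polyfamM; first exact: polyfam_const.
apply: (polyfam_linear (comp_mpoly _)); apply: (polyfam_linear (pihomog mdeg d)).
by apply: polyfam_sum => m _; apply: polyfamZ; [exact: polyfun_var|exact: polyfam_const].
Qed.

Definition form_coefs (F : {mpoly K[5]}) (m : 'X_{1..5 < 5}) : K := F@_m.

Lemma form_coefs_inj F G : F \is 4.-homog -> G \is 4.-homog ->
  form_coefs F =1 form_coefs G -> F = G.
Proof.
move=> hF hG eqFG; apply/mpolyP => m; have [md|nmd] := eqVneq (mdeg m) 4%N.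
  have lt5 : (mdeg m < 5)%N by rewrite md.
  exact: (eqFG (BMultinom lt5)).
have zero (p : {mpoly K[5]}) : p \is 4.-homog -> p@_m = 0.
  move=> hp; apply: memN_msupp_eq0; apply: contra nmd => /(dhomog_mf hp) md.
  exact/eqP.
by rewrite !zero.
Qed.

Let space : finType := (params + 'I_5 * 'I_5)%type.
Let param (w : space -> K) : params -> K := fun s => w (inl s).
Let change (w : space -> K) : 'M[K]_5 := \matrix_(i, j) w (inr (i, j)).
Let quartic w := lin_subst (change w) (normal_quartic (param w)).

Lemma normal_quartic_homog (n : params -> K) : normal_quartic n \is 4.-homog.
Proof. by apply: cone_form_homog; [exact: nq2_homog|exact: nq3_homog|exact: nq4_homog]. Qed.

(** Chevalley's theorem for the map from (n, M) to the coefficients of the transformed quartic, with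
    D(n) det M as the open condition on the source. The matrix M of the last clause may be
    singular. *)
Lemma generic_orbit (D : (params -> K) -> K) : polyfun D -> (exists n, D n != 0) ->
  exists P : ('X_{1..5 < 5} -> K) -> K,
    [/\ polyfun P,
        exists n (M : 'M[K]_5), M \in unitmx /\ P (form_coefs (lin_subst M (normal_quartic n))) != 0 &
        forall n M, P (form_coefs (lin_subst M (normal_quartic n))) != 0 ->
          exists n' M', [/\ D n' != 0, M' \in unitmx &
            lin_subst M (normal_quartic n) = lin_subst M' (normal_quartic n')]].
Proof.
move=> PD [n0 nz0]; pose Psi m w := form_coefs (quartic w) m.
have encode n M : exists w, param w = n /\ change w = M.
  exists (fun s => match s with inl p => n p | inr (i, j) => M i j end).
  by split; [apply: funext|apply/matrixP => i j; rewrite mxE].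
have Pquartic : polyfam quartic.
  apply: polyfam_lin_subst => [i j|].
    by apply: polyfun_ext (polyfun_var _ _) => w; rewrite mxE.
  by apply: (polyfam_comp (@polyfam_normal_quartic K)) => s; exact: polyfun_var.
have PPsi m : polyfun (Psi m) by apply: (polyfam_scalar (mcoeff m) Pquartic).
have PE : polyfun (fun w => D (param w) * \det (change w)).
  apply: polyfunM; first by apply: (polyfun_comp PD) => s; exact: polyfun_var.
  by apply: polyfun_det => i j; apply: polyfun_ext (polyfun_var _ _) => w; rewrite mxE.
have nzE : exists w, D (param w) * \det (change w) != 0.
  by have [w [wn wM]] := encode n0 1%:M; exists w; rewrite wn wM det1 mulr1.
have [P [PP [w1 nz1] orb]] := chevalley PPsi PE nzE.
exists P; split=> //.
  have PPP : polyfun (fun w => P (Psi^~ w)) by apply: (polyfun_comp PP).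
  have [w0 nzw0] := nzE; have [w [Pw Ew]] := polyfun_irreducible PPP PE nz1 nzw0.
  exists (param w), (change w); split=> //.
  by rewrite unitmxE unitfE; apply: contraNneq Ew => ->; rewrite mulr0.
move=> n M; have [w [<- <-]] := encode n M => /orb[w' nzw' eqw].
exists (param w'), (change w'); split.
- by apply: contraNneq nzw' => ->; rewrite mul0r.
- by rewrite unitmxE unitfE; apply: contraNneq nzw' => ->; rewrite mulr0.
apply: form_coefs_inj; try exact: lin_subst_homog (normal_quartic_homog _).
by move=> m; rewrite -[RHS]/(Psi m w') eqw.
Qed.

Theorem general_second_type_lines :
  for_general (fun f : {mpoly K[4]} => exists o2, second_type f o2)
    (fun f => forall o2, second_type f o2 ->
       has_exactly 24 (lines_through (projective_closure f) o2)).
Proof.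
have [D [PD nzD goodD]] := generic_good K.
have [P [PP [n1 [M1 [uM1 nz1]]] orbP]] := generic_orbit PD nzD.
(* The union over all invertible matrices makes membership independent of the projective coordinates
   in which V is written. *)
pose U (f : {mpoly K[4]}) := exists M : 'M[K]_5, M \in unitmx /\
  P (form_coefs (lin_subst M (projective_closure f))) != 0.
have PU (I : Type) (F : (I -> K) -> {mpoly K[5]}) M : polyfam F ->
    polyfun (fun v => P (form_coefs (lin_subst M (F v)))).
  move=> PF; apply: (polyfun_comp PP) => m; apply: (polyfam_scalar (mcoeff m)).
  by apply: polyfam_lin_subst PF => i j; apply: polyfun_const.
have openU : zariski_open U.
  exists (fun p => exists M : 'M[K]_5, M \in unitmx /\ forall f,
    p.@[coefs f] = P (form_coefs (lin_subst M (projective_closure f)))) => f.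
  split=> [[M [uM nz]]|[p [M [uM pE]]]]; last by rewrite pE; exists M.
  have [p pE] := polyfun_mpoly (PU _ _ M polyfam_projective_closure).
  have pfE h : p.@[coefs h] = P (form_coefs (lin_subst M (projective_closure h))).
    by rewrite -(projective_closure_coefs h) pE.
  by exists p; [exists M|rewrite pfE].
(* The normal form of a member of the family may be varied with fixed g and l. *)
have dense W : zariski_open W ->
    (exists f : {mpoly K[4]}, (exists o2, second_type f o2) /\ W f) ->
    exists f, [/\ exists o2, second_type f o2, U f & W f].
  move=> [S WE] [f [[o2 st] /WE[p Sp nzp]]].
  have [g [l [n0 [ug q2g e4g fE]]]] := second_type_affine_form st.
  have PW : polyfun (fun n => p.@[coefs (affine_form g l n)]).
    apply: meval_polyfun => i; apply: (polyfam_scalar (mcoeff _)).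
    exact: polyfam_affine_form.
  have PN : polyfun (fun n => P (form_coefs (lin_subst M1 (normal_quartic n)))).
    exact: PU (@polyfam_normal_quartic K).
  have nz : exists n, D n * P (form_coefs (lin_subst M1 (normal_quartic n))) != 0.
    by apply: polyfun_and => //; exists n1.
  have [n] : exists n, (D n * P (form_coefs (lin_subst M1 (normal_quartic n)))) *
      p.@[coefs (affine_form g l n)] != 0.
    by apply: polyfun_and => //; [exact: polyfunM|exists n0; rewrite -fE].
  rewrite !mulf_eq0 !negb_or => /andP[/andP[Dn Pn] pn].
  exists (affine_form g l n); split.
  - by eexists; apply: good_second_type => //; exact: goodD.
  (* The inverse undoes the chart change, leaving the value of [P] at the transform by [M1], which
     [Pn] makes nonzero. *)
  - exists (M1 *m invmx (chart_change g l)); split.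
      by rewrite unitmx_mul uM1 unitmx_inv chart_change_unit.
    by rewrite projective_closure_affine_form // lin_substM mulmxKV // chart_change_unit.
  by apply/WE; exists p.
exists U; split=> //; last first.
  move=> f [o st] [M [uM nz]] o2 st2.
  have [g [l [n0 [ug q2g e4g fE]]]] := second_type_affine_form st2.
  have VE : projective_closure f = lin_subst (chart_change g l) (normal_quartic n0).
    by rewrite fE projective_closure_affine_form.
  (* The parameters [n0] found for [f] need not be good. It is enough that V is a linear transform
     of some good normal quartic, possibly in quite different coordinates. *)
  rewrite VE lin_substM in nz; have [n [M' [Dn uM' eqF]]] := orbP _ _ nz.
  apply: (second_type_lines (M := invmx M *m M') _ (goodD _ Dn) _ st2).
    by rewrite unitmx_mul unitmx_inv uM.
  by rewrite -lin_substM -eqF lin_substM mulKmx // VE.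
have [n Dn] := nzD.
have q2e0 : (q2 K).@[(delta_mx 0 0 : 'rV[K]_4) 0] = 1.
  by rewrite meval_q2 /ypart !mxE /= !expr0n !addr0 expr1n.
have [g [q2g e4g _]] := exists_frame q2e0.
have ug := isometry_unit q2g e4g.
(* Density in the whole family also gives nonemptiness; the sample member is built from a good n,
   any isometry and l = 0. *)
have [] := dense (fun _ => True).
- exists (eq 1) => f; split=> // _; exists 1 => //; by rewrite meval1 oner_eq0.
- by exists (affine_form g 0 n); split=> //; eexists; apply: good_second_type => //; exact: goodD.
by move=> f [? ? _]; exists f.
Qed.
End Generality.

Theorem proposition0p1 (R : realType) :
  for_general
    (fun f : {mpoly R[i][4]} => exists o2, second_type f o2)
    (fun f : {mpoly R[i][4]} => forall o2, second_type f o2 ->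
       has_exactly 24 (lines_through (projective_closure f) o2)).
Proof.
exact: general_second_type_lines.
Qed.
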